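(* Let $a\in\mathbb R$, let $m\ge 2$ be an integer, and let $P_m,Q_m$ be homogeneous polynomials of degree $m$ in two real variables. Consider the system $$\frac{dx}{dt}=ax-y+P_m(x,y),\qquad \frac{dy}{dt}=x+ay+Q_m(x,y),$$ and let $$\psi(\theta)=\cos\theta\cdot Q_m(\cos\theta,\sin\theta)-\sin\theta\cdot P_m(\cos\theta,\sin\theta).$$ If $(m-1)a\,\psi(\theta)+\dot\psi(\theta)\neq 0$ for all $\theta$, then the system has at most $1$ limit cycle, counted with multiplicity. This upper bound is sharp (there exist such systems satisfying the hypothesis which have exactly one limit cycle). Furthermore, if the limit cycle exists, then it surrounds the origin, and it is stable when $(m-1)a+\dot\psi/\psi>0$ and unstable when $(m-1)a+\dot\psi/\psi<0$.
   Context: $\dot\psi$ denotes the derivative of $\psi$ with respect to $\theta$. A limit cycle is an isolated (non-constant) periodic orbit; its multiplicity is its multiplicity as a fixed point of the Poincaré return map. A periodic orbit surrounds the origin if the origin lies in the bounded component of its complement. *)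

(* Defs.v *)
From mathcomp Require Import all_boot all_order all_algebra.
(* [mpoly] is imported without its notations, which clash with those of
   analysis. *)
From mathcomp.multinomials Require mpoly.
Import -(notations) mpoly.
From mathcomp Require Import all_classical all_reals all_analysis.

Set Implicit Arguments.
Unset Strict Implicit.
Unset Printing Implicit Defensive.

Import Order.TTheory GRing.Theory Num.Theory.
Import numFieldNormedType.Exports.

Local Open Scope classical_set_scope.
Local Open Scope ring_scope.

Notation mpoly2 R := (mpoly 2 R).

Definition eval2 (R : realType) (P : mpoly2 R) (x y : R) : R :=
  meval (fun i : 'I_2 => if i == ord0 then x else y) P.

(* The zero polynomial is homogeneous of every degree. *)
Definition homogeneous (R : realType) (m : nat) (P : mpoly2 R) : Prop :=
  P \is ishomog1 m mdeg.

Section PlanarSystems.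
Variable R : realType.
Implicit Types (X : R * R -> R * R) (z : R -> R * R) (g : set (R * R)).
Implicit Types (p n q : R * R) (e d t : R).

(* The derivative is two-sided at the endpoints of [I] as well; a solution of a
   locally Lipschitz field on a closed interval always extends a little beyond
   it, so this is no restriction. *)
Definition solution X (I : set R) z : Prop := forall t, I t ->
  is_derive t 1 (fun s => (z s).1) (X (z t)).1 /\
  is_derive t 1 (fun s => (z s).2) (X (z t)).2.

Definition periodic_orbit X g : Prop := exists z T,
  [/\ solution X setT z,
      0 < T /\ (forall t, z (t + T) = z t),
      (exists t, z t != z 0)
    & g = range z].

Definition limit_cycle X g : Prop :=
  periodic_orbit X g /\
  exists U : set (R * R), [/\ open U, g `<=` U
    & forall g', periodic_orbit X g' -> g' `<=` U -> g' = g].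

(* The solution starting at the point [p + s n] of the open segment
   [{p + r n : |r| < e}] first comes back to that segment at [p + s' n]. *)
Definition first_return X p n (e s s' : R) : Prop := exists z tau,
  [/\ 0 < tau, solution X `[0, tau] z,
      z 0 = p + s *: n /\ z tau = p + s' *: n,
      `|s'| < e
    & forall t r, 0 < t < tau -> `|r| < e -> z t != p + r *: n].

(* For a periodic orbit through [p], [Pi 0 = 0] says that the orbit meets the
   segment in [p] only. *)
Definition return_map X p n (e : R) (Pi : R -> R) : Prop :=
  [/\ 0 < e, Pi 0 = 0 & \forall s \near 0, first_return X p n e s (Pi s)].

Definition transversal X p n : Prop := (X p).1 * n.2 - (X p).2 * n.1 != 0.

(* [f] is [k] times differentiable at [x], its derivatives of order [< k] vanish
   at [x], and the [k]-th one does not.  As [derive1n] is total, the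
   differentiability has to be required separately. *)
Definition zero_of_multiplicity (f : R -> R) (x : R) (k : nat) : Prop :=
  [/\ forall j, (j.+1 < k)%N -> \forall y \near x, derivable (derive1n j f) y 1,
      forall j, (j < k)%N -> derivable (derive1n j f) x 1 /\ derive1n j f x = 0
    & derive1n k f x != 0].

Definition fixpoint_of_multiplicity (f : R -> R) (x : R) (k : nat) : Prop :=
  zero_of_multiplicity (fun s => f s - s) x k.

(* The multiplicity depends neither on the base point nor on the section;
   it is required to be [k] for all of them. *)
Definition cycle_multiplicity X g (k : nat) : Prop :=
  forall p n, g p -> transversal X p n ->
    exists e Pi, return_map X p n e Pi /\ fixpoint_of_multiplicity Pi 0 k.

Definition at_most_limit_cycles X (N : nat) : Prop :=
  exists mu : set (R * R) -> nat,
    (forall g, limit_cycle X g -> cycle_multiplicity X g (mu g)) /\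
    (forall s : seq (set (R * R)), uniq s ->
       (forall g, g \in s -> limit_cycle X g) -> (\sum_(g <- s) mu g <= N)%N).

Definition surrounds g p : Prop :=
  ~ g p /\ bounded_set (connected_component (~` g) p).

Definition tube g (e : R) : set (R * R) := \bigcup_(p in g) ball p e.

(* Orbital asymptotic stability: Lyapunov stability and local attractivity. *)
Definition stable_cycle X g : Prop :=
  (forall e, 0 < e -> exists2 d, 0 < d & forall q, tube g d q ->
     exists z, [/\ z 0 = q, solution X `[0, +oo[ z
                 & forall t, 0 <= t -> tube g e (z t)]) /\
  (exists2 d, 0 < d & forall q, tube g d q ->
     exists z, [/\ z 0 = q, solution X `[0, +oo[ z
                 & forall e, 0 < e -> \forall t \near +oo, tube g e (z t)]).

(* Unstable means repelling, i.e. stable after reversal of time. *)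
Definition unstable_cycle X g : Prop := stable_cycle (fun q => - X q) g.

End PlanarSystems.

Section HomogeneousNonlinearity.
Variable R : realType.
Implicit Types (P Q : mpoly2 R) (a th : R) (m : nat).

Definition hom_system a P Q (q : R * R) : R * R :=
  (a * q.1 - q.2 + eval2 P q.1 q.2, q.1 + a * q.2 + eval2 Q q.1 q.2).

Definition psi P Q th : R :=
  cos th * eval2 Q (cos th) (sin th) - sin th * eval2 P (cos th) (sin th).

Definition psi_condition a m P Q : Prop :=
  forall th, (m%:R - 1) * a * psi P Q th + derive1 (psi P Q) th != 0.

Definition stability_index a m P Q th : R :=
  (m%:R - 1) * a + derive1 (psi P Q) th / psi P Q th.

End HomogeneousNonlinearity.

(* Main.v *)
(* Write n = m - 1, so that in polar coordinates r' = r (a + phi r^n) and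
   th' = 1 + psi r^n. By Rolle's theorem applied to exp (n a th) psi, the
   hypothesis forces psi, and hence S = n a + psi'/psi, to have constant signs.
   In the coordinate u = 1 / (psi r^n) the system becomes
     u' = - (S u + D),   th' = 1 + 1/u,   with D = psi'/psi + n phi/psi.
   Put L u = u + ln |u|, so that dL/dth = - (S u + D) along orbits. Where u = -1,
   the angle turns back; but there L has its maximum on the ray, and
   L + \int D - \int S is monotone in time, so that a periodic orbit which
   touches u = -1 never meets the same ray again, which is absurd. Hence a
   periodic orbit is a graph u = y th over the angle; it surrounds the origin.
   For two graphs y1, y2 the square of W = L y1 - L y2 is strictly monotone, as
   W' = - S (y1 - y2): this gives uniqueness, and the same computation with a
   nearby trajectory gives stability, the sign of S deciding the direction. The
   linearised equation W' = - (S / L' y) W has a coefficient of constant sign,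
   so the multiplier of the return map is not 1 and the cycle is simple. *)

Require Import Defs.
From mathcomp Require Import all_boot all_order all_algebra.
From mathcomp.multinomials Require mpoly.
Import -(notations) mpoly.
From mathcomp Require Import all_classical all_reals all_analysis.
From mathcomp Require Import ring lra.

Import Order.TTheory GRing.Theory Num.Theory.
Import numFieldNormedType.Exports.

Local Open Scope classical_set_scope.
Local Open Scope ring_scope.

Set Implicit Arguments.
Unset Strict Implicit.
Unset Printing Implicit Defensive.

(** * Calculus on the real line *)

(** The coordinate u is chosen because u' is affine in u with coefficients that depend on the angle
    alone: D cancels in the difference of two graphs, and only S, of known sign, survives. Besides
    the sign [e] of u, the sign [kap] of 1 + u is fixed along a cycle, and [e * kap] is its sense of
    rotation. A factor [tau], 1 or -1, on the time lets one argument serve both signs of S. The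
    obstacle is the behaviour near the cycle, where a flow has to be constructed and the return map
    differentiated. The equation of u over the angle is clipped to a band around the cycle; it is
    then globally Lipschitz and has solutions on the whole line, and time is recovered by inverting
    the primitive of dt/dth. Differentiability in the initial data is avoided: if M solves the
    linearised equation, the quotient (y - y0) / M changes over one turn by a relative amount of the
    order of the initial deviation. This gives the derivative of the return map at its fixed point,
    on every transversal segment. *)

Section Calculus.
Variable R : realType.
Implicit Types (f g : R -> R) (x y a b l t : R).

Lemma isd_eq f x a b : is_derive x 1 f a -> a = b -> is_derive x 1 f b.
Proof. by move=> ? <-. Qed.

Lemma isd_add f g x a b : is_derive x 1 f a -> is_derive x 1 g b ->
  is_derive x 1 (fun t => f t + g t) (a + b).
Proof. by move=> df dg; exact: (is_deriveD df dg). Qed.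

Lemma isd_opp f x a : is_derive x 1 f a -> is_derive x 1 (fun t => - f t) (- a).
Proof. by move=> df; exact: (is_deriveN df). Qed.

Lemma isd_mul f g x a b : is_derive x 1 f a -> is_derive x 1 g b ->
  is_derive x 1 (fun t => f t * g t) (a * g x + f x * b).
Proof.
move=> df dg; apply: isd_eq (is_deriveM df dg) _.
by rewrite /GRing.scale /= addrC mulrC.
Qed.

Lemma isd_inv f x a : f x != 0 -> is_derive x 1 f a ->
  is_derive x 1 (fun t => (f t)^-1) (- (a / f x ^+ 2)).
Proof.
move=> fx df; apply: isd_eq (is_deriveV fx df) _.
by rewrite /GRing.scale /= mulNr mulrC.
Qed.

Lemma isd_pow f k x a : is_derive x 1 f a ->
  is_derive x 1 (fun t => f t ^+ k) (k%:R * f x ^+ k.-1 * a).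
Proof.
move=> df; rewrite -exprfctE; apply: isd_eq (is_deriveX k df) _.
by rewrite /GRing.scale /= -mulr_natl.
Qed.

Lemma isd_comp f g x a b : is_derive (g x) 1 f a -> is_derive x 1 g b ->
  is_derive x 1 (fun t => f (g t)) (a * b).
Proof. by move=> df dg; exact: (is_derive1_comp df dg). Qed.

Lemma isd_cst c x : is_derive x 1 (fun=> c : R) 0.
Proof. exact: is_derive_cst. Qed.

Lemma isd_id x : is_derive x 1 (fun t : R => t) 1.
Proof. exact: is_derive_id. Qed.

Lemma isd_exp f x a : is_derive x 1 f a ->
  is_derive x 1 (fun t => expR (f t)) (expR (f x) * a).
Proof. by move=> df; apply: isd_comp. Qed.

Lemma isd_ln f x a : 0 < f x -> is_derive x 1 f a ->
  is_derive x 1 (fun t => ln (f t)) ((f x)^-1 * a).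
Proof. by move=> fx df; apply: isd_comp => //; exact: is_derive1_ln. Qed.

Lemma isd_cos f x a : is_derive x 1 f a ->
  is_derive x 1 (fun t => cos (f t)) (- sin (f x) * a).
Proof. by move=> df; apply: isd_comp. Qed.

Lemma isd_sin f x a : is_derive x 1 f a ->
  is_derive x 1 (fun t => sin (f t)) (cos (f x) * a).
Proof. by move=> df; apply: isd_comp. Qed.

Lemma isd_atan f x a : is_derive x 1 f a ->
  is_derive x 1 (fun t => atan (f t)) ((1 + f x ^+ 2)^-1 * a).
Proof. by move=> df; apply: isd_comp. Qed.

Lemma isd_sqrt f x a : 0 < f x -> is_derive x 1 f a ->
  is_derive x 1 (fun t => Num.sqrt (f t)) ((2 * Num.sqrt (f x))^-1 * a).
Proof. by move=> fx df; apply: isd_comp => //; exact: is_derive1_sqrt. Qed.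

End Calculus.

(** Syntax-directed differentiation: the rules fill an existential variable with the derivative, so
    that [der] leaves the equation between it and the announced value, along with the side
    conditions of the rules. *)
Ltac der1 :=
  lazymatch goal with
  | |- is_derive _ _ (fun=> ?c) _ => eapply isd_cst
  | |- is_derive _ _ (fun t => t) _ => eapply isd_id
  | |- is_derive _ _ (fun t => @?f t + @?g t) _ => eapply (@isd_add _ f g)
  | |- is_derive _ _ (fun t => - @?f t) _ => eapply (@isd_opp _ f)
  | |- is_derive _ _ (fun t => @?f t * @?g t) _ => eapply (@isd_mul _ f g)
  | |- is_derive _ _ (fun t => (@?f t)^-1) _ => eapply (@isd_inv _ f)
  | |- is_derive _ _ (fun t => @?f t ^+ ?k) _ => eapply (@isd_pow _ f k)
  | |- is_derive _ _ (fun t => expR (@?f t)) _ => eapply (@isd_exp _ f)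
  | |- is_derive _ _ (fun t => ln (@?f t)) _ => eapply (@isd_ln _ f)
  | |- is_derive _ _ (fun t => cos (@?f t)) _ => eapply (@isd_cos _ f)
  | |- is_derive _ _ (fun t => sin (@?f t)) _ => eapply (@isd_sin _ f)
  | |- is_derive _ _ (fun t => atan (@?f t)) _ => eapply (@isd_atan _ f)
  | |- is_derive _ _ (fun t => Num.sqrt (@?f t)) _ => eapply (@isd_sqrt _ f)
  | |- is_derive _ _ (fun t => ?f (@?g t)) _ =>
      lazymatch g with (fun t => t) => fail | _ => is_var f; eapply (@isd_comp _ f g) end
  end.
Ltac der := eapply isd_eq; [repeat der1; eauto|].

(** * Mean value theorem, monotonicity and Gronwall's inequality *)

Section Calculus2.
Variable R : realType.
Implicit Types (f g : R -> R) (x y a b l t : R).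

Lemma isd_near f g x a : (\forall t \near x, f t = g t) ->
  is_derive x 1 f a -> is_derive x 1 g a.
Proof.
by move=> fg df; exact: (near_eq_is_derive fg df).
Qed.

Lemma isd_cont f x a : is_derive x 1 f a -> f t @[t --> x] --> f x.
Proof. by move=> [df _]; apply/differentiable_continuous/derivable1_diffP. Qed.

Lemma mean_value f df a b : a < b ->
  (forall t, a <= t <= b -> is_derive t 1 f (df t)) ->
  exists2 c, a < c < b & f b - f a = df c * (b - a).
Proof.
move=> ab fd; have [||c cab fE] := @MVT _ f df a b ab.
- by move=> t; rewrite in_itv /= => /andP[at_ tb]; apply: fd; rewrite !ltW.
- apply: derivable_within_continuous => t; rewrite in_itv /= => tab.
  by have [] := fd t tab.
- by exists c => //; move: cab; rewrite in_itv.
Qed.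

Lemma isd_ge0_le f df a b : a <= b ->
  (forall t, a <= t <= b -> is_derive t 1 f (df t)) ->
  (forall t, a <= t <= b -> 0 <= df t) -> f a <= f b.
Proof.
rewrite le_eqVlt => /predU1P[->//|ab] fd df0.
have [c /andP[ac cb] e] := mean_value ab fd.
rewrite -subr_ge0 e mulr_ge0 ?df0 ?subr_ge0 ?(ltW ab)//.
by rewrite !ltW.
Qed.

Lemma isd_gt0_lt f df a b : a < b ->
  (forall t, a <= t <= b -> is_derive t 1 f (df t)) ->
  (forall t, a < t < b -> 0 < df t) -> f a < f b.
Proof.
move=> ab fd df0; have [c /andP[ac cb] e] := mean_value ab fd.
by rewrite -subr_gt0 e mulr_gt0 ?df0 ?subr_gt0 ?ac.
Qed.

Lemma der0_cst f : (forall t, is_derive t 1 f 0) -> forall x y, f x = f y.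
Proof. by move=> fd x y; apply: is_derive_0_is_cst. Qed.

(** The derivative is known at [x] only, so the mean value theorem does not apply; Caratheodory's
    slope function is continuous at [x] and stays positive near it. *)
Lemma isd_sign_pos f x a : is_derive x 1 f a -> 0 < a ->
  exists2 e : R, 0 < e & forall t, `|t - x| < e ->
    (x < t -> f x < f t) /\ (t < x -> f t < f x).
Proof.
move=> fd a0.
have [h [fE hc hx]] := (is_derive1_caratheodory f x a).1 fd.
have /nbhs_ballP[e /= e0 he] : \forall t \near x, 0 < h t.
  by apply: (cvgr_gt _ hc); rewrite hx.
exists e => // t tx; have ht : 0 < h t.
  by apply: he; rewrite /ball /= distrC.
split=> xt; rewrite -subr_gt0.
  by rewrite fE mulr_gt0// subr_gt0.
by rewrite -opprB oppr_gt0 fE nmulr_llt0 // subr_lt0.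
Qed.

(** The square of [f] is differentiable where its absolute value need not be; multiplied by
    exp(-2Kt) it decreases and by exp(2Kt) it increases, which gives the estimates in the two
    directions of time. *)
Lemma gronwall f df K a b : a <= b -> 
  (forall t, a <= t <= b -> is_derive t 1 f (df t)) ->
  (forall t, a <= t <= b -> `|df t| <= K * `|f t|) ->
  `|f b| <= `|f a| * expR (K * (b - a)) /\
  `|f a| <= `|f b| * expR (K * (b - a)).
Proof.
move=> ab fd dfK.
have bnd t : a <= t <= b -> `|f t * df t| <= K * f t ^+ 2.
  move=> /dfK H; rewrite normrM -(real_normK (num_real (f t))) expr2.
  by rewrite mulrCA ler_wpM2l.
have sqr_le u v c : 0 <= u -> 0 <= v -> u ^+ 2 <= v ^+ 2 * expR (2 * c) -> u <= v * expR c.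
  move=> u0 v0; rewrite mulr_natl mulr2n expRD -expr2 -exprMn => H.
  by rewrite -(@ler_pXn2r _ 2) ?nnegrE// mulr_ge0 ?expR_ge0.
split; apply: sqr_le => //; rewrite !real_normK ?num_real//.
  suff H : - (f a ^+ 2 * expR (- (2 * K * a))) <= - (f b ^+ 2 * expR (- (2 * K * b))).
    move: H; rewrite lerN2 => H.
    rewrite -(@ler_pM2r _ (expR (- (2 * K * b)))) ?expR_gt0// -[leRHS]mulrA -expRD.
    by rewrite (_ : 2 * (K * (b - a)) + _ = - (2 * K * a)) //; ring.
  apply: (@isd_ge0_le (fun t => - (f t ^+ 2 * expR (- (2 * K * t))))
    (fun t => - (2 * f t * df t - 2 * K * f t ^+ 2) * expR (- (2 * K * t)))) => //.
    by move=> t tab; der; rewrite /=; ring.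
  move=> t tab; rewrite mulr_ge0 ?expR_ge0//.
  have := bnd t tab; rewrite ler_norml => /andP[]; lra.
suff H : f a ^+ 2 * expR (2 * K * a) <= f b ^+ 2 * expR (2 * K * b).
  rewrite -(@ler_pM2r _ (expR (2 * K * a))) ?expR_gt0// -[leRHS]mulrA -expRD.
  by rewrite (_ : 2 * (K * (b - a)) + _ = 2 * K * b) //; ring.
apply: (@isd_ge0_le (fun t => f t ^+ 2 * expR (2 * K * t))
    (fun t => (2 * f t * df t + 2 * K * f t ^+ 2) * expR (2 * K * t))) => //.
  by move=> t tab; der; rewrite /=; ring.
move=> t tab; rewrite mulr_ge0 ?expR_ge0//.
have := bnd t tab; rewrite ler_norml => /andP[]; lra.
Qed.

End Calculus2.

(** * Primitives, inverse functions, periodic functions, polar coordinates and a continuation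
    principle *)

Section Calculus3.
Variable R : realType.
Implicit Types (f g : R -> R) (x y a b l t P T c d : R).

Lemma eps_delta f x l : (f t @[t --> x] --> l) <->
  forall e, 0 < e -> exists2 d : R, 0 < d & forall t, `|t - x| < d -> `|f t - l| < e.
Proof.
split=> [/cvgrPdist_lt H e /H /nbhs_ballP[d /= d0 hd]|H].
  exists d => // t tx; rewrite distrC; apply: hd.
  by rewrite /ball /= distrC.
apply/cvgrPdist_lt => e /H[d d0 hd]; apply/nbhs_ballP; exists d => // t.
by rewrite /ball /= distrC [in X in _ -> X]distrC; exact: hd.
Qed.

Lemma lip_cont f B : (forall x y, `|f x - f y| <= B * `|x - y|) -> continuous f.
Proof.
move=> fB x; apply/eps_delta => e e0.
have B1 : 0 < `|B| + 1 by have := normr_ge0 B; lra.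
exists (e / (`|B| + 1)); first by rewrite divr_gt0.
move=> t; rewrite ltr_pdivlMr// => h; apply: le_lt_trans (fB _ _) _.
apply: le_lt_trans h; rewrite mulrC ler_wpM2l//; have := ler_norm B; lra.
Qed.

Lemma ivt f a b : a <= b -> (forall t, a <= t <= b -> f x @[x --> t] --> f t) ->
  f a * f b <= 0 -> exists2 c, a <= c <= b & f c = 0.
Proof.
move=> ab fc fab; have [||c] := @IVT _ f a b 0 ab.
- apply: continuous_in_subspaceT => t; rewrite inE /= in_itv /=; exact: fc.
- rewrite ge_min le_max.
  apply/andP; split; apply/orP.
    by have [?|?] := leP (f a) 0; [left|right; nra].
  by have [?|?] := leP 0 (f a); [left|right; nra].
- by rewrite in_itv /=; exists c.
Qed.

Lemma sqr_sign s : s = 1 \/ s = -1 -> s * s = 1 :> R.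
Proof. by case=> ->; rewrite ?mulrNN mulr1. Qed.

Lemma sqr_pos x : x != 0 -> 0 < x ^+ 2.
Proof. by move=> x0; rewrite lt_neqAle sqr_ge0 andbT eq_sym expf_neq0. Qed.

Lemma const_sign f : continuous f -> (forall x, f x != 0) ->
  exists2 s : R, s = 1 \/ s = -1 & forall x, 0 < s * f x.
Proof.
move=> fc f0.
have same x y : x <= y -> 0 < f x * f y.
  move=> xy; rewrite ltNge; apply/negP => H.
  have [|c _ e] := ivt xy _ H; first by move=> t _; exact: fc.
  by have := f0 c; rewrite e eqxx.
have same' x y : 0 < f x * f y.
  by have [/same//|/ltW/same] := leP x y; rewrite mulrC.
have := f0 0; rewrite neq_lt => /orP[] h; [exists (-1)|exists 1]; do ?by [left|right].
  by move=> x; rewrite mulN1r oppr_gt0; move: (same' 0 x); rewrite nmulr_rgt0.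
by move=> x; rewrite mul1r; move: (same' 0 x); rewrite pmulr_rgt0.
Qed.

Lemma prim_right f : continuous f ->
  exists F : R -> R, forall x, -1 < x -> is_derive x 1 F (f x).
Proof.
move=> fc; exists (fun x => (\int[lebesgue_measure]_(t in `[-1, x]) f t)%R) => x x1.
have [||d e] := @continuous_FTC1_closed R f (-1) x (x + 1) _ _ x1 (fc x).
- by rewrite ltrDl.
- apply: continuous_compact_integrable; first exact: segment_compact.
  by apply: continuous_subspaceT.
by rewrite -e derive1E; exact: derivableP.
Qed.

(** A primitive to the right of -1 and a reflected one to the left of 1 have the same derivative on
    the overlap; normalised to vanish at 0 they agree there and glue. *)
Lemma primitive f : continuous f ->
  exists F : R -> R, forall x, is_derive x 1 F (f x).
Proof.
move=> fc; have [F dF] := prim_right fc.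
have [|G dG] := @prim_right (fun x => f (- x)).
  by move=> x; apply: continuous_comp; [exact: opp_continuous|exact: fc].
have dG' x : x < 1 -> is_derive x 1 (fun t => G 0 - G (- t)) (f x).
  move=> x1; der; [apply: dG; rewrite ltrNl opprK//|].
  by rewrite opprK; ring.
have dF' x : -1 < x -> is_derive x 1 (fun t => F t - F 0) (f x).
  by move=> x1; der; ring.
have FG x : -1 < x < 1 -> F x - F 0 = G 0 - G (- x).
  have h t : -1 < t < 1 -> is_derive t 1 (fun t => F t - F 0 - (G 0 - G (- t))) 0.
    move=> /andP[t1 t2]; apply: isd_eq; first by der1; [exact: dF'|der1; exact: dG'].
    by rewrite subrr.
  move=> /andP[x1 x2]; apply/eqP; rewrite -subr_eq0; apply/eqP.
  have [x0|x0|->] := ltgtP x 0; last by rewrite oppr0; ring.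
  - have [t /andP[? ?]|c _] := @mean_value _ (fun t => F t - F 0 - (G 0 - G (- t)))
      (fun=> 0) _ _ x0; first by apply: h; apply/andP; split; lra.
    by rewrite mul0r oppr0 !subrr => /eqP; rewrite subr_eq0 => /eqP/esym.
  - have [t /andP[? ?]|c _] := @mean_value _ (fun t => F t - F 0 - (G 0 - G (- t)))
      (fun=> 0) _ _ x0; first by apply: h; apply/andP; split; lra.
    by rewrite mul0r oppr0 !subrr subr0.
exists (fun x => if 0 <= x then F x - F 0 else G 0 - G (- x)) => x.
have [x0|x0] := ltP (-1) x.
  apply: isd_near (dF' x x0); near=> t.
  case: ifPn => //; rewrite -ltNge => t0; apply: FG.
  by rewrite (lt_trans t0 ltr01) andbT; near: t; apply: lt_nbhsr.
have x1 : x < 1 by lra.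
have x2 : x < 0 by lra.
apply: isd_near (dG' x x1); near=> t; have : t < 0 by near: t; exact: lt_nbhsl.
by rewrite ltNge => /negbTE ->.
Unshelve. all: by end_near. Qed.

(** A derivative of constant sign gives injectivity; the uniform bound [c] is what makes [f]
    onto. *)
Lemma inverse_fun f (df : R -> R) (s c : R) : s = 1 \/ s = -1 ->
  (forall x, is_derive x 1 f (df x)) -> 0 < c -> (forall x, c <= s * df x) ->
  exists g, [/\ cancel f g, cancel g f & forall y, is_derive y 1 g (df (g y))^-1].
Proof.
move=> s1 fd c0 cdf; have ss := sqr_sign s1.
have mono x y : x <= y -> c * (y - x) <= s * f y - s * f x.
  move=> xy; rewrite -subr_ge0.
  have -> : s * f y - s * f x - c * (y - x) = (s * f y - c * y) - (s * f x - c * x) by ring.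
  rewrite subr_ge0; apply: (@isd_ge0_le _ (fun t => s * f t - c * t) (fun t => s * df t - c)) => //.
    by move=> t _; der; rewrite /=; ring.
  by move=> t _; rewrite subr_ge0.
have inj : injective f.
  suff H x y : x < y -> f x <> f y.
    by move=> x y e; have [/H|/H|//] := ltgtP x y; rewrite e.
  move=> xy e; have := mono x y (ltW xy); rewrite e subrr leNgt mulr_gt0// subr_gt0//.
have fc : continuous f by move=> x; exact: isd_cont (fd x).
have surj y : exists x, f x = y.
  (* Growing at rate at least [c], the function [s * f] passes the value [s * y] within distance [B]
     of 0. *)
  pose B := `|s * y - s * f 0| / c.
  have B0 : 0 <= B by rewrite divr_ge0// ltW.
  have cB : c * B = `|s * y - s * f 0| by rewrite /B mulrC divfK// gt_eqF.
  have [|||x _ e] := @ivt (fun x => s * f x - s * y) (- B) B.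
  - by rewrite ge0_cp.
  - move=> t _; apply: cvgB; last exact: cvg_cst.
    by apply: cvgM; [exact: cvg_cst|exact: fc].
  - have h1 := mono 0 B B0; have h2 := mono (- B) 0 _.
    rewrite subr0 cB in h1; rewrite sub0r opprK cB oppr_le0 in h2.
    have := h2 B0 => {}h2.
    rewrite mulr_le0_ge0 //; first by rewrite subr_le0; have := ler_norm (s * f 0 - s * y); rewrite distrC; lra.
    by rewrite subr_ge0; have := ler_norm (s * y - s * f 0); lra.
  exists x; have : s * (f x - y) = 0 by rewrite -e; ring.
  move=> /eqP; rewrite mulf_eq0 => /orP[/eqP s0|]; last by rewrite subr_eq0 => /eqP.
  by move: ss; rewrite s0 mul0r => /eqP; rewrite eq_sym oner_eq0.
have [g gK] := choice surj.
have fK : cancel f g by move=> x; apply: inj; rewrite gK.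
exists g; split => // y; rewrite -{1}(gK y); apply: is_derive_inverse.
- by near=> t; exact: fK.
- by near=> t; exact: fc.
- by apply: contraTneq (cdf (g y)) => ->; rewrite mulr0 -ltNge.
Unshelve. all: by end_near. Qed.

Lemma per_nat f T : (forall x, f (x + T) = f x) ->
  forall (k : nat) x, f (x + k%:R * T) = f x.
Proof.
move=> fT; elim=> [|k IH] x; first by rewrite mul0r addr0.
by rewrite -natr1 mulrDl mul1r addrA fT IH.
Qed.

Lemma per_int f T : (forall x, f (x + T) = f x) ->
  forall (k : int) x, f (x + k%:~R * T) = f x.
Proof.
move=> fT [k|k] x; first exact: per_nat.
have := per_nat fT k.+1 (x - k.+1%:R * T); rewrite subrK => ->.
by rewrite NegzE mulrNz mulNr.
Qed.

Lemma per_red T x : 0 < T -> exists k : int, 0 <= x + k%:~R * T < T.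
Proof.
move=> T0; exists (- Num.floor (x / T)); rewrite mulrNz mulNr subr_ge0.
rewrite -ler_pdivlMr// ge_floor /= ltrBlDr -[X in X + _]mul1r -mulrDl.
by rewrite -ltr_pdivrMr// addrC -intrD1 floorD1_gt.
Qed.

Lemma per_bounded f T : 0 < T -> continuous f -> (forall x, f (x + T) = f x) ->
  exists2 B : R, 0 < B & forall x, `|f x| <= B.
Proof.
move=> T0 fc fT.
have [|c _ H] := @EVT_max R (fun x => `|f x|) 0 T (ltW T0).
  apply: continuous_subspaceT => x; apply: (@continuous_comp _ _ _ f (fun x => `|x|)); first exact: fc.
  exact: norm_continuous.
exists (`|f c| + 1) => [|x]; first by rewrite ltr_wpDl.
have [k /andP[k0 k1]] := per_red x T0.
rewrite -(per_int fT k x) (le_trans (H _ _)) ?lerDl//.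
by rewrite in_itv /= k0 ltW.
Qed.

Lemma per_lbound f T : 0 < T -> continuous f -> (forall x, f (x + T) = f x) ->
  (forall x, f x != 0) -> exists2 c : R, 0 < c & forall x, c <= `|f x|.
Proof.
move=> T0 fc fT f0.
have [|c _ H] := @EVT_min R (fun x => `|f x|) 0 T (ltW T0).
  apply: continuous_subspaceT => x; apply: (@continuous_comp _ _ _ f (fun x => `|x|)); first exact: fc.
  exact: norm_continuous.
exists `|f c|; rewrite ?normr_gt0// => x.
have [k /andP[k0 k1]] := per_red x T0.
rewrite -(per_int fT k x) H//.
by rewrite in_itv /= k0 ltW.
Qed.

Lemma cos1_period x : cos x = 1 -> exists k : int, x = k%:~R * (2 * pi).
Proof.
have pi0 := pi_gt0 R; have T0 : 0 < 2 * pi :> R by rewrite mulr_gt0.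
have cosT y : cos (y + 2 * pi) = cos y :> R.
  by rewrite mulr_natl; exact: cosD2pi.
have [k /andP[k0 k1]] := per_red x T0; move=> c1.
exists (- k); rewrite mulrNz mulNr; apply/eqP; rewrite -addr_eq0; apply/eqP.
set y := x + _ in k0 k1 *.
have cy : cos y = 1 by rewrite /y (per_int cosT).
have [ypi|ypi] := leP y pi.
  by apply: (@cos_inj R); rewrite ?in_itv /= ?k0 ?ypi ?lexx ?pi_ge0// cos0.
have : 2 * pi - y = 0.
  apply: (@cos_inj R); rewrite ?in_itv /= ?lexx ?pi_ge0//; last first.
    by rewrite cos0 addrC cosT cosN.
  by apply/andP; split; lra.
by move=> /eqP; rewrite subr_eq0 => /eqP e; move: k1; rewrite e ltxx.
Qed.

Lemma cos_sin_eq x y : cos x = cos y -> sin x = sin y ->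
  exists k : int, x = y + k%:~R * (2 * pi).
Proof.
move=> c s; have [|k e] := @cos1_period (x - y).
  by rewrite cosB c s -!expr2 cos2Dsin2.
by exists k; rewrite -e addrC subrK.
Qed.

Lemma polar_ex x y : x ^+ 2 + y ^+ 2 != 0 ->
  exists r th, [/\ 0 < r, x = r * cos th & y = r * sin th].
Proof.
move=> h; have h0 : 0 < x ^+ 2 + y ^+ 2 by rewrite lt_neqAle eq_sym h addr_ge0 ?sqr_ge0.
pose r := Num.sqrt (x ^+ 2 + y ^+ 2); have r0 : 0 < r by rewrite sqrtr_gt0.
have rr : r ^+ 2 = x ^+ 2 + y ^+ 2 by rewrite sqr_sqrtr// ltW.
have xr : -1 <= x / r <= 1.
  rewrite -ler_norml normrM normfV (gtr0_norm r0) ler_pdivrMr// mul1r.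
  rewrite -(@ler_pXn2r _ 2) ?nnegrE// ?(ltW r0)// real_normK ?num_real// rr lerDl sqr_ge0//.
have c : cos (acos (x / r)) = x / r by apply: acosK; rewrite in_itv.
have s : sin (acos (x / r)) ^+ 2 = (y / r) ^+ 2.
  rewrite sin2cos2 c !exprMn exprVn rr; field; exact: h.
have [y0|y0] := leP 0 y.
  exists r, (acos (x / r)); split => //; first by rewrite c mulrCA divff ?mulr1// gt_eqF.
  have -> : sin (acos (x / r)) = y / r; last by rewrite mulrCA divff ?mulr1// gt_eqF.
  apply/eqP; rewrite -(@eqrXn2 _ 2)// ?s ?divr_ge0 ?(ltW r0)//.
  by rewrite sin_ge0_pi// acos_ge0//= acos_lepi.
exists r, (- acos (x / r)); split => //; first by rewrite cosN c mulrCA divff ?mulr1// gt_eqF.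
rewrite sinN; have -> : sin (acos (x / r)) = - (y / r); last by rewrite opprK mulrCA divff ?mulr1// gt_eqF.
apply/eqP; rewrite -(@eqrXn2 _ 2)// ?s ?sqrrN ?oppr_ge0 ?pmulr_lle0 ?invr_gt0 ?(ltW y0)//.
by rewrite sin_ge0_pi// acos_ge0//= acos_lepi.
Qed.

(** Bootstrap: at the first point where [c <= f], which is the infimum of [A], the weak bound holds
    up to that point, so the hypothesis gives the strict one there and, by continuity, slightly
    beyond, a contradiction. *)
Lemma continuation f a c : continuous f -> f a < c ->
  (forall x, a <= x -> (forall t, a <= t <= x -> f t <= c) -> f x < c) ->
  forall x, a <= x -> f x < c.
Proof.
move=> fc fac H x ax; rewrite ltNge; apply/negP => cx.
pose A := [set t | a <= t <= x /\ c <= f t].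
have A0 : has_inf A.
  split; first by exists x; rewrite /A /= ax lexx.
  by exists a => t [/andP[]].
have infa : a <= inf A by apply: lb_le_inf; [exact: A0.1|move=> t [/andP[]]].
have infx : inf A <= x by apply: ge_inf; [exact: A0.2|rewrite /A /= ax lexx].
have below t : a <= t < inf A -> f t < c.
  move=> /andP[at_ ti]; rewrite ltNge; apply/negP => ct.
  suff : inf A <= t by rewrite leNgt ti.
  apply: ge_inf; [exact: A0.2|split => //].
  by rewrite at_ (le_trans (ltW ti)).
have fi : f (inf A) < c.
  apply: H => // t /andP[at_]; rewrite le_eqVlt => /predU1P[->|ti]; last first.
    by rewrite ltW// below// at_.
  have [/eqP ai|ai] := boolP (inf A == a); first by rewrite ai ltW.
  rewrite leNgt; apply/negP => cf.
  have /nbhs_ballP[e /= e0 he] : \forall t \near inf A, c < f t.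
    exact: (cvgr_gt _ (fc (inf A))).
  have ia : a < inf A by rewrite lt_neqAle eq_sym ai.
  pose u := Num.max a (inf A - e / 2).
  have ui : u < inf A by rewrite gt_max ia /= ltrBlDr ltrDl divr_gt0.
  have := below u; rewrite le_max lexx ui /= => /(_ isT).
  apply/negP; rewrite -leNgt ltW// he// /ball /=.
  rewrite gtr0_norm ?subr_gt0// ltrBlDr -ltrBlDl.
  rewrite lt_max; apply/orP; right; rewrite ltrD2l ltrN2 ltr_pdivrMr//; lra.
have /nbhs_ballP[e /= e0 he] : \forall t \near inf A, f t < c.
  exact: (cvgr_lt _ (fc (inf A))).
have [t [/andP[at_ tx] ct] te] := inf_adherent e0 A0.
have : f t < c.
  have it : inf A <= t by apply: ge_inf; [exact: A0.2|rewrite /A /= at_ tx].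
  apply: he; rewrite /ball /= distrC ger0_norm ?subr_ge0// ltrBlDl//.
by rewrite ltNge ct.
Qed.

End Calculus3.

(** * Global solutions of bounded, globally Lipschitz scalar equations *)

Section Picard.
Variable R : realType.
Implicit Types (f g : R -> R) (x y a b l t : R).

Lemma isd_lip f (df : R -> R) B : (forall t, is_derive t 1 f (df t)) ->
  (forall t, `|df t| <= B) -> forall x y, `|f x - f y| <= B * `|x - y|.
Proof.
move=> fd dB.
suff H x y : y < x -> `|f x - f y| <= B * `|x - y|.
  move=> x y; have [xy|yx|->] := ltgtP x y; [|exact: H|by rewrite !subrr normr0 mulr0].
  by rewrite distrC [`|x - y|]distrC; exact: H.
move=> yx; have [c _ ->] := mean_value yx (fun t _ => fd t).
by rewrite normrM ler_wpM2r.
Qed.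

Lemma le_half_pow x c d : (forall n : nat, x <= c / 2 ^+ n + d) -> x <= d.
Proof.
move=> H; rewrite leNgt; apply/negP => dx.
have e0 : 0 < x - d by rewrite subr_gt0.
pose n := (Num.truncn (`|c| / (x - d))).+1.
have hn : `|c| / (x - d) < n%:R by exact: truncnS_gt.
have n2 : n%:R <= 2 ^+ n :> R by rewrite -natrX ler_nat ltnW// ltn_expl.
have := H n; rewrite leNgt => /negP; apply.
rewrite -ltrBrDr ltr_pdivrMr ?exprn_gt0//.
rewrite ltr_pdivrMr// in hn; apply: le_lt_trans (ler_norm c) _.
by apply: lt_le_trans hn _; rewrite mulrC ler_pM2l.
Qed.

(** The bounds [u n - 2 * C / 2 ^+ n] increase and [u n + 2 * C / 2 ^+ n] decrease, so the supremum
    of the former lies in all the nested intervals. *)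
Lemma geometric_limit (u : nat -> R) C :
  (forall n, `|u n.+1 - u n| <= C / 2 ^+ n) ->
  exists s, forall n, `|u n - s| <= 2 * C / 2 ^+ n.
Proof.
move=> H.
have half n : C / 2 ^+ n = 2 * (C / 2 ^+ n.+1).
  rewrite exprS; field; exact: expf_neq0.
have Hn n := H n; have Cn n : 0 <= C / 2 ^+ n by apply: le_trans (H n).
pose lo n := u n - 2 * C / 2 ^+ n; pose hi n := u n + 2 * C / 2 ^+ n.
have lo_le n : lo n <= lo n.+1.
  have := H n; rewrite /lo ler_norml -!mulrA (half n) => /andP[]; lra.
have hi_le n : hi n.+1 <= hi n.
  have := H n; rewrite /hi ler_norml -!mulrA (half n) => /andP[]; lra.
have lo_add n k : lo n <= lo (n + k)%N.
  by elim: k => [|k IH]; rewrite ?addn0// addnS (le_trans IH).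
have hi_add n k : hi (n + k)%N <= hi n.
  by elim: k => [|k IH]; rewrite ?addn0// addnS (le_trans (hi_le _)).
have lohi n m : lo n <= hi m.
  apply: le_trans (lo_add n m) _; apply: le_trans (hi_add m n).
  rewrite addnC /lo /hi -!mulrA; have := Cn (m + n)%N; lra.
exists (sup (range lo)) => n.
have hs : has_sup (range lo).
  split; first by exists (lo 0%N); exists 0%N.
  by exists (hi 0%N) => _ [m _ <-].
have h1 : lo n <= sup (range lo) by apply: ub_le_sup; [exact: hs.2|exists n].
have h2 : sup (range lo) <= hi n by apply: ge_sup; [exact: hs.1|move=> _ [m _ <-]].
by rewrite ler_norml; move: h1 h2; rewrite /lo /hi; lra.
Qed.

(** A smooth substitute for exp(2K|t - t0|), of the same size up to a factor 2. *)
Let wt (K t0 t : R) := expR (2 * K * (t - t0)) + expR (- (2 * K * (t - t0))).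

Lemma wt_ge1 K t0 t : 0 <= K -> 1 <= wt K t0 t.
Proof.
move=> K0; rewrite /wt; have [h|h] := leP 0 (t - t0).
  have : 1 <= expR (2 * K * (t - t0)) by rewrite (le_trans _ (expR_ge1Dx _))// lerDl mulr_ge0// mulr_ge0.
  by have := expR_ge0 (- (2 * K * (t - t0))); lra.
have : 1 <= expR (- (2 * K * (t - t0))).
  by rewrite (le_trans _ (expR_ge1Dx _))// lerDl -mulrN mulr_ge0 ?mulr_ge0// oppr_ge0 ltW.
by have := expR_ge0 (2 * K * (t - t0)); lra.
Qed.

(** Integrating [K * A * wt] turns the sum of the exponentials into A/2 times their difference,
    which is bounded by A/2 times the sum. This is the origin of the contraction ratio 1/2. *)
Lemma wt_comparison (h dh : R -> R) (A K t0 : R) : 0 <= A ->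
  (forall t, is_derive t 1 h (dh t)) -> h t0 = 0 ->
  (forall t, `|dh t| <= K * A * wt K t0 t) ->
  forall t, `|h t| <= A / 2 * wt K t0 t.
Proof.
move=> A0 hd h0 dhA t.
pose g t := A / 2 * (expR (2 * K * (t - t0)) - expR (- (2 * K * (t - t0)))).
have gd x : is_derive x 1 g (K * A * wt K t0 x).
  by rewrite /g; der; rewrite /wt /=; field.
have g0 : g t0 = 0 by rewrite /g subrr mulr0 oppr0 subrr mulr0.
have gw : `|g t| <= A / 2 * wt K t0 t.
  rewrite /g /wt normrM ger0_norm ?divr_ge0// ler_wpM2l ?divr_ge0//.
  rewrite (le_trans (ler_normB _ _))// !ger0_norm ?expR_ge0//.
apply: le_trans gw.
have m1 a b : a <= b -> g a - h a <= g b - h b.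
  move=> ab; apply: (@isd_ge0_le _ (fun t => g t - h t) (fun t => K * A * wt K t0 t - dh t)) => //.
  by move=> x _; have := dhA x; rewrite ler_norml => /andP[]; lra.
have m2 a b : a <= b -> g a + h a <= g b + h b.
  move=> ab; apply: (@isd_ge0_le _ (fun t => g t + h t) (fun t => K * A * wt K t0 t + dh t)) => //.
  by move=> x _; have := dhA x; rewrite ler_norml => /andP[]; lra.
have [tt|/ltW tt] := leP t0 t.
  have := m1 _ _ tt; have := m2 _ _ tt; rewrite g0 h0 => a1 a2.
  by rewrite ler_norml; have := ler_norm (g t); lra.
have := m1 _ _ tt; have := m2 _ _ tt; rewrite g0 h0 => a1 a2.
by rewrite ler_norml; have := ler_norm (- g t); rewrite normrN; lra.
Qed.

(* Weighting distances by [wt] makes the Picard operator a contraction with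
   ratio 1/2 on the whole line, so that no continuation is needed. *)
Lemma picard_lindelof (F : R -> R -> R) (B K : R) :
  (forall y : R -> R, continuous y -> continuous (fun t => F t (y t))) ->
  (forall t y, `|F t y| <= B) ->
  (forall t y z, `|F t y - F t z| <= K * `|y - z|) ->
  forall t0 y0, exists2 y : R -> R, y t0 = y0 &
    forall t, is_derive t 1 y (F t (y t)).
Proof.
(* With [1 <= K] the plain bound [B] on the field is below [K * B * wt], which starts the induction
   in [ustep]. *)
move=> Fc FB; wlog K1 : K / 1 <= K.
  move=> wl FK; apply: (wl (Num.max 1 K)); first by rewrite le_max lexx.
  move=> t y z; apply: le_trans (FK t y z) _.
  by rewrite ler_wpM2r// le_max lexx orbT.
move=> FK t0 y0; have B0 : 0 <= B by apply: le_trans (FB 0 0).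
have K0 : 0 <= K by apply: le_trans K1.
have wt0 t : 0 <= wt K t0 t by apply: le_trans (wt_ge1 _ _ K0).
(* The Picard operator is obtained by choice, hence needs a value at every function; off the
   continuous ones it is arbitrary. *)
have exT (y : R -> R) : exists Y : R -> R, continuous y ->
    Y t0 = y0 /\ forall t, is_derive t 1 Y (F t (y t)).
  have [yc|ync] := pselect (continuous y); last by exists id.
  have [Y dY] := primitive (Fc _ yc).
  exists (fun t => Y t - Y t0 + y0) => _; split; first by rewrite subrr add0r.
  by move=> t; der; rewrite /=; ring.
have [T hT] := choice exT.
have Tc (y : R -> R) : continuous y -> continuous (T y).
  by move=> yc t; apply: isd_cont; apply: (hT y yc).2.
pose u n := iter n T (fun=> y0).
have uc n : continuous (u n).
  by elim: n => [|n IH]; [move=> t; exact: cvg_cst|exact: Tc].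
have Tdiff (y z : R -> R) A : 0 <= A -> continuous y -> continuous z ->
    (forall t, `|y t - z t| <= A * wt K t0 t) ->
    forall t, `|T y t - T z t| <= A / 2 * wt K t0 t.
  move=> A0 yc zc yz.
  apply: (@wt_comparison (fun t => T y t - T z t) (fun t => F t (y t) - F t (z t))) => //.
  - by move=> t; have h1 := (hT y yc).2 t; have h2 := (hT z zc).2 t; der.
  - by rewrite (hT y yc).1 (hT z zc).1 subrr.
  - by move=> t; apply: le_trans (FK _ _ _) _; rewrite -mulrA ler_wpM2l.
have ustep n : forall t, `|u n.+1 t - u n t| <= B / 2 ^+ n * wt K t0 t.
  elim: n => [|n IH] t.
    rewrite expr0 divr1; have [h1 h2] := hT (u 0%N) (uc 0%N).
    apply: (@le_trans _ _ (B / 2 * wt K t0 t)); last first.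
      by rewrite ler_wpM2r//; lra.
    apply: (@wt_comparison (fun t => u 1%N t - y0) (fun t => F t y0)) => //.
    - by move=> s; have := h2 s => ?; der; rewrite ?oppr0 ?addr0.
    - by rewrite [u 1%N t0]h1 subrr.
    - move=> s; apply: le_trans (FB _ _) _; rewrite mulrAC ler_peMl//.
      by rewrite -[1]mulr1 ler_pM//; exact: wt_ge1.
  have -> : B / 2 ^+ n.+1 = B / 2 ^+ n / 2.
    by rewrite exprS; field; exact: expf_neq0.
  by apply: (Tdiff (u n.+1) (u n)); [rewrite divr_ge0// exprn_ge0|exact: uc|exact: uc|exact: IH].
have lim t : exists s, forall n, `|u n t - s| <= 2 * (B * wt K t0 t) / 2 ^+ n.
  by apply: geometric_limit => n; have := ustep n t; rewrite mulrAC.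
have [y yl] := choice lim.
(* Every iterate after the initial constant has derivative bounded by [B], and the Lipschitz
   constant [B] passes to the limit. *)
have yc : continuous y.
  have ylip a b : `|y a - y b| <= B * `|a - b|.
    apply: (@le_half_pow _ (2 * (B * wt K t0 a) + 2 * (B * wt K t0 b))) => n.
    have h : `|u n.+1 a - u n.+1 b| <= B * `|a - b|.
      by apply: isd_lip; [exact: (hT _ (uc n)).2|move=> t; exact: FB].
    have half (c : R) : 0 <= c -> c / 2 ^+ n.+1 <= c / 2 ^+ n.
      move=> c0; rewrite ler_wpM2l// lef_pV2 ?posrE ?exprn_gt0//.
      by rewrite exprS ler_peMl ?exprn_ge0// ler1n.
    have ha := le_trans (yl a n.+1) (half _ _).
    have hb := le_trans (yl b n.+1) (half _ _).
    have {}ha := ha (mulr_ge0 _ (mulr_ge0 B0 (wt0 a))).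
    have {}hb := hb (mulr_ge0 _ (mulr_ge0 B0 (wt0 b))).
    have -> : y a - y b = (u n.+1 a - u n.+1 b) - (u n.+1 a - y a) + (u n.+1 b - y b) by ring.
    apply: le_trans (ler_normD _ _) _; rewrite mulrDl.
    have := ler_normB (u n.+1 a - u n.+1 b) (u n.+1 a - y a).
    have := ha (ler0n _ _); have := hb (ler0n _ _); lra.
  exact: lip_cont ylip.
have yT : T y = y.
  apply/funext => t; apply/eqP; rewrite -subr_eq0 -normr_le0.
  apply: (@le_half_pow _ (2 * (B * wt K t0 t))) => n; rewrite addr0.
  have h1 : `|T y t - u n.+1 t| <= (B / 2 ^+ n) * wt K t0 t.
    have -> : B / 2 ^+ n = (2 * B / 2 ^+ n) / 2 by field; exact: expf_neq0.
    apply: Tdiff => //; first by rewrite divr_ge0 ?mulr_ge0// exprn_ge0.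
    move=> s; rewrite distrC; apply: le_trans (yl s n) _.
    by rewrite le_eqVlt; apply/orP; left; apply/eqP; ring.
  have h2 : `|u n.+1 t - y t| <= (B / 2 ^+ n) * wt K t0 t.
    apply: le_trans (yl t n.+1) _; rewrite le_eqVlt; apply/orP; left; apply/eqP.
    by rewrite exprS; field; exact: expf_neq0.
  have -> : T y t - y t = (T y t - u n.+1 t) + (u n.+1 t - y t) by ring.
  apply: le_trans (ler_normD _ _) _; apply: le_trans (lerD h1 h2) _.
  by rewrite le_eqVlt; apply/orP; left; apply/eqP; ring.
exists y; first by rewrite -[in LHS]yT; exact: (hT y yc).1.
by move=> t; have := (hT y yc).2 t; rewrite yT.
Qed.

End Picard.

(** * Polar coordinates *)

Section PolarDef.
Variable R : realType.

(* [e] and [s] are the signs of [psi] and of S; the point [polar_pt th u] below has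
   angle [th] and u-coordinate [u]. *)
Record polar_system (n : nat) (a e s : R) (phi psi dpsi : R -> R)
    (X : R * R -> R * R) : Prop := PolarSystem {
  ps_n : (0 < n)%N;
  ps_e : e = 1 \/ e = -1;
  ps_s : s = 1 \/ s = -1;
  ps_psi : forall th : R, 0 < e * psi th;
  ps_S : forall th : R, 0 < s * (n%:R * a + dpsi th / psi th);
  ps_dpsi : forall th : R, is_derive th 1 psi (dpsi th);
  ps_phic : continuous phi;
  ps_dpsic : continuous dpsi;
  ps_phiT : forall th : R, phi (th + 2 * pi) = phi th;
  ps_psiT : forall th : R, psi (th + 2 * pi) = psi th;
  ps_dpsiT : forall th : R, dpsi (th + 2 * pi) = dpsi th;
  ps_X0 : X (0, 0) = (0, 0);
  ps_polar : forall r th : R, 0 < r ->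
    X (r * cos th, r * sin th) =
    (r * ((a + phi th * r ^+ n) * cos th - (1 + psi th * r ^+ n) * sin th),
     r * ((a + phi th * r ^+ n) * sin th + (1 + psi th * r ^+ n) * cos th));
  ps_lip : forall M : R, exists K : R, forall p q : R * R,
    `|p.1| <= M -> `|p.2| <= M -> `|q.1| <= M -> `|q.2| <= M ->
    `|(X p).1 - (X q).1| <= K * (`|p.1 - q.1| + `|p.2 - q.2|) /\
    `|(X p).2 - (X q).2| <= K * (`|p.1 - q.1| + `|p.2 - q.2|);
  ps_curve : forall x y dx dy : R -> R,
    (forall t : R, is_derive t 1 x (dx t)) ->
    (forall t : R, is_derive t 1 y (dy t)) ->
    continuous (fun t => (X (x t, y t)).1) /\
    continuous (fun t => (X (x t, y t)).2) }.

End PolarDef.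

Section Polar.
Variables (R : realType) (n : nat) (a e s : R) (phi psi dpsi : R -> R).
Variable X : R * R -> R * R.
Hypothesis H : polar_system n a e s phi psi dpsi X.
Implicit Types (t th u x y r : R).

(** [lin_coef] and [cst_coef] are the S and D of the overview; for n = m - 1 the former is the
    stability index. *)
Definition lin_coef th : R := n%:R * a + dpsi th / psi th.
Definition cst_coef th : R := dpsi th / psi th + n%:R * phi th / psi th.

Lemma psi_neq0 th : psi th != 0.
Proof. by have := ps_psi H th; apply: contraTneq => ->; rewrite mulr0 ltxx. Qed.

Lemma e_neq0 : e != 0.
Proof. by case: (ps_e H) => ->; rewrite ?oppr_eq0 oner_neq0. Qed.

Lemma n_neq0 : n%:R != 0 :> R.
Proof. by rewrite pnatr_eq0 -lt0n (ps_n H). Qed.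

Lemma psiu_gt0 th u : (0 < psi th * u) = (0 < e * u).
Proof.
have ee := sqr_sign (ps_e H); have h := ps_psi H th.
have -> : psi th * u = (e * psi th) * (e * u) by rewrite mulrACA ee mul1r.
by rewrite pmulr_rgt0.
Qed.

Lemma Sf_cont : continuous lin_coef.
Proof.
move=> th; apply: cvgD; first exact: cvg_cst.
apply: cvgM; first exact: (ps_dpsic H).
by apply: cvgV; [exact: psi_neq0|exact: isd_cont (ps_dpsi H th)].
Qed.

Lemma Df_cont : continuous cst_coef.
Proof.
have ic : continuous (fun th => (psi th)^-1).
  by move=> th; apply: cvgV; [exact: psi_neq0|exact: isd_cont (ps_dpsi H th)].
move=> th; apply: cvgD; first by apply: cvgM; [exact: (ps_dpsic H)|exact: ic].
apply: cvgM; last exact: ic.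
by apply: cvgM; [exact: cvg_cst|exact: (ps_phic H)].
Qed.

Lemma Sf_per th : lin_coef (th + 2 * pi) = lin_coef th.
Proof. by rewrite /lin_coef (ps_dpsiT H) (ps_psiT H). Qed.

Lemma Df_per th : cst_coef (th + 2 * pi) = cst_coef th.
Proof. by rewrite /cst_coef (ps_dpsiT H) (ps_psiT H) (ps_phiT H). Qed.

(** The positive solution r of psi * u * r^n = 1, that is (psi u)^(-1/n). It has this meaning only
    if [psi th * u] is positive, equivalently if [0 < e * u]. *)
Definition rad th u : R := expR (- (ln (psi th * u) / n%:R)).
Definition polar_pt th u : R * R := (rad th u * cos th, rad th u * sin th).

Lemma rad_gt0 th u : 0 < rad th u.
Proof. exact: expR_gt0. Qed.

Lemma radX th u : 0 < e * u -> psi th * u * rad th u ^+ n = 1.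
Proof.
rewrite -(psiu_gt0 th) => h; rewrite /rad -expRM_natl mulrN (mulrC n%:R) divfK ?n_neq0//.
by rewrite expRN lnK ?posrE// mulfV// gt_eqF.
Qed.

Lemma rad_unique th u r : 0 < r -> psi th * u * r ^+ n = 1 -> rad th u = r.
Proof.
move=> r0 hr; have h : 0 < e * u.
  have : 0 < psi th * u * r ^+ n by rewrite hr ltr01.
  by rewrite pmulr_lgt0 ?exprn_gt0// psiu_gt0.
have hn := radX th h; have pu : psi th * u != 0.
  by apply: contra_eq_neq hr => ->; rewrite mul0r eq_sym oner_neq0.
apply/eqP; rewrite -(@eqrXn2 _ n) ?(ps_n H) ?(ltW r0) ?(ltW (rad_gt0 _ _))//.
by apply/eqP/(mulfI pu); rewrite hr hn.
Qed.

Lemma polar_inj r r' th th' : 0 < r -> 0 < r' ->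
  r * cos th = r' * cos th' -> r * sin th = r' * sin th' ->
  r = r' /\ exists k : int, th = th' + k%:~R * (2 * pi).
Proof.
move=> r0 r'0 hc hs.
have rr : r = r'.
  apply/eqP; rewrite -(@eqrXn2 _ 2) ?(ltW r0) ?(ltW r'0)//; apply/eqP.
  rewrite -[LHS]mulr1 -[RHS]mulr1 -{1}(cos2Dsin2 th) -(cos2Dsin2 th').
  by rewrite !mulrDr -!exprMn hc hs.
split => //; apply: cos_sin_eq; apply: (mulfI (lt0r_neq0 r0)).
  by rewrite hc rr.
by rewrite hs rr.
Qed.

Lemma cos_2pi_int (k : int) th : cos (th + k%:~R * (2 * pi)) = cos th.
Proof. by apply: per_int => x; rewrite mulr_natl; exact: cosD2pi. Qed.

Lemma sin_2pi_int (k : int) th : sin (th + k%:~R * (2 * pi)) = sin th.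
Proof. by apply: per_int => x; rewrite mulr_natl; exact: sinD2pi. Qed.

Lemma E_per (k : int) th u : polar_pt (th + k%:~R * (2 * pi)) u = polar_pt th u.
Proof. by rewrite /polar_pt /rad cos_2pi_int sin_2pi_int (per_int (ps_psiT H)). Qed.

Lemma E_inj th u th' u' : 0 < e * u -> 0 < e * u' -> polar_pt th u = polar_pt th' u' ->
  u = u' /\ exists k : int, th = th' + k%:~R * (2 * pi).
Proof.
move=> hu hu' [hc hs]; have [hr [k hk]] := polar_inj (rad_gt0 _ _) (rad_gt0 _ _) hc hs.
split; last by exists k.
have h1 := radX th hu; have h2 := radX th' hu'.
rewrite hr hk (per_int (ps_psiT H)) in h1.
have pr : psi th' * rad th' u' ^+ n != 0.
  by rewrite mulf_neq0 ?psi_neq0 ?expf_neq0 ?lt0r_neq0 ?rad_gt0.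
apply: (mulIf pr); move: h1; rewrite -h2; lra.
Qed.

(** The system in the coordinates u and th with its speed multiplied by [tau]; [tau = -1] reverses
    time. *)
Definition polar_flow (tau : R) (u th : R -> R) t : Prop :=
  is_derive t 1 th (tau * (1 + (u t)^-1)) /\
  is_derive t 1 u (- tau * (lin_coef (th t) * u t + cst_coef (th t))).

Lemma polar_flow_solution tau (u th : R -> R) t :
  0 < e * u t -> polar_flow tau u th t ->
  is_derive t 1 (fun x => (polar_pt (th x) (u x)).1) (tau * (X (polar_pt (th t) (u t))).1) /\
  is_derive t 1 (fun x => (polar_pt (th x) (u x)).2) (tau * (X (polar_pt (th t) (u t))).2).
Proof.
move=> hu [dth du]; have pu : 0 < psi (th t) * u t by rewrite psiu_gt0.
have u0 : u t != 0 by apply: contraTneq hu => ->; rewrite mulr0 ltxx.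
have p0 := psi_neq0 (th t); have n0 := n_neq0.
have hr := radX (th t) hu.
have rn : rad (th t) (u t) ^+ n = (psi (th t) * u t)^-1.
  by apply: (mulfI (lt0r_neq0 pu)); rewrite hr mulfV// gt_eqF.
have dr : is_derive t 1 (fun x => rad (th x) (u x))
    (tau * (rad (th t) (u t) * (a + phi (th t) * rad (th t) (u t) ^+ n))).
  rewrite rn /rad; have hp := ps_dpsi H (th t).
  der; rewrite /= /lin_coef /cst_coef; field; exact/and3P.
rewrite (ps_polar H _ (rad_gt0 _ _)) rn /polar_pt /=; rewrite rn in dr.
split; der; rewrite /=; field; exact/andP.
Qed.

Lemma planar_cont (z : R -> R * R) (dx dy : R -> R) :
  (forall t : R, is_derive t 1 (fun x => (z x).1) (dx t)) ->
  (forall t : R, is_derive t 1 (fun x => (z x).2) (dy t)) ->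
  continuous (fun t => (X (z t)).1) /\ continuous (fun t => (X (z t)).2).
Proof.
move=> h1 h2; have := ps_curve H h1 h2.
by rewrite (_ : (fun t => (X ((z t).1, (z t).2)).1) = fun t => (X (z t)).1)
  1?(_ : (fun t => (X ((z t).1, (z t).2)).2) = fun t => (X (z t)).2) //;
  apply/funext => t; rewrite -surjective_pairing.
Qed.

Definition planar_solution tau (z : R -> R * R) : Prop := forall t,
  is_derive t 1 (fun x => (z x).1) (tau * (X (z t)).1) /\
  is_derive t 1 (fun x => (z x).2) (tau * (X (z t)).2).

(** A continuous angle along the trajectory is the primitive of the angular velocity (x y' - y x') /
    (x^2 + y^2), started at a polar angle of the initial point. *)
Lemma polar_lift tau (z : R -> R * R) : planar_solution tau z ->
  (forall t, z t <> (0, 0)) ->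
  exists u th : R -> R, forall t,
    [/\ z t = polar_pt (th t) (u t), 0 < e * u t & polar_flow tau u th t].
Proof.
move=> hz z0.
pose x t := (z t).1; pose y t := (z t).2.
have zE t : z t = (x t, y t) by rewrite /x /y -surjective_pairing.
pose dx t := tau * (X (z t)).1; pose dy t := tau * (X (z t)).2.
have xd t : is_derive t 1 x (dx t) by exact: (hz t).1.
have yd t : is_derive t 1 y (dy t) by exact: (hz t).2.
pose q t := x t ^+ 2 + y t ^+ 2.
have q0 t : 0 < q t.
  rewrite lt_neqAle addr_ge0 ?sqr_ge0// andbT eq_sym paddr_eq0 ?sqr_ge0//.
  apply/negP => /andP[]; rewrite !sqrf_eq0 => /eqP h1 /eqP h2.
  by apply: (z0 t); rewrite zE h1 h2.
have [Xc1 Xc2] := planar_cont xd yd.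
have wc : continuous (fun t => (x t * dy t - y t * dx t) / q t).
  move=> t; apply: cvgM.
    apply: cvgB; (apply: cvgM; first by [exact: isd_cont (xd t)|exact: isd_cont (yd t)]);
    by apply: cvgM; [exact: cvg_cst|by [exact: Xc1|exact: Xc2]].
  apply: cvgV; first by rewrite gt_eqF.
  by apply: cvgD; rewrite /=; (apply: isd_cont (isd_pow 2 _); by [exact: xd|exact: yd]).
have [th0 dth0] := primitive wc.
have [r0 [al [r00 x0 y0]]] : exists r th, [/\ 0 < r, x 0 = r * cos th & y 0 = r * sin th].
  by apply: polar_ex; exact: lt0r_neq0 (q0 0).
pose th t := th0 t - th0 0 + al.
have dth t : is_derive t 1 th ((x t * dy t - y t * dx t) / q t).
  by rewrite /th; have := dth0 t => ?; der; rewrite /=; ring.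
pose r t := Num.sqrt (q t).
have rr t : r t ^+ 2 = q t by rewrite sqr_sqrtr// ltW.
have rpos t : 0 < r t by rewrite sqrtr_gt0.
have dr t : is_derive t 1 r ((x t * dx t + y t * dy t) / r t).
  have dq : is_derive t 1 q (2 * (x t * dx t + y t * dy t)).
    by rewrite /q; have := xd t => ?; have := yd t => ?; der; rewrite /=; ring.
  apply: isd_eq (isd_sqrt (q0 t) dq) _; rewrite -/(r t); field; exact: lt0r_neq0.
have r0E : r 0 = r0.
  rewrite /r /q x0 y0 !exprMn -mulrDr cos2Dsin2 mulr1 sqrtr_sqr gtr0_norm//.
have th00 : th 0 = al by rewrite /th subrr add0r.
(* This quotient is the cosine of the error between [th t] and the true angle. Its derivative
   vanishes, and it equals 1 at time 0. *)
have c1 t : (x t * cos (th t) + y t * sin (th t)) / r t = 1.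
  rewrite [LHS](@der0_cst _ (fun t => (x t * cos (th t) + y t * sin (th t)) / r t) _ t 0).
    rewrite x0 y0 th00 r0E; have cs := cos2Dsin2 al.
    apply: (mulIf (lt0r_neq0 r00)); rewrite divfK ?lt0r_neq0// mul1r -[RHS]mulr1 -cs.
    by ring.
  move=> v; have := xd v => ?; have := yd v => ?; have := dth v => ?; have := dr v => ?.
  der; first exact: lt0r_neq0.
  have : r v ^+ 2 = x v ^+ 2 + y v ^+ 2 by exact: rr.
  have q00 : q v != 0 by exact: lt0r_neq0.
  have r00' : r v != 0 by exact: lt0r_neq0.
  move=> e1; rewrite /= -rr.
  transitivity (((dx v * cos (th v) + dy v * sin (th v)) * r v ^+ 2 +
    (x v * dy v - y v * dx v) * (y v * cos (th v) - x v * sin (th v)) -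
    (x v * cos (th v) + y v * sin (th v)) * (x v * dx v + y v * dy v)) / r v ^+ 3).
    by field.
  by rewrite e1 [X in X / _](_ : _ = 0) ?mul0r//; ring.
have zr t : x t = r t * cos (th t) /\ y t = r t * sin (th t).
  have cs := cos2Dsin2 (th t); have h1 := c1 t.
  have {}h1 : x t * cos (th t) + y t * sin (th t) = r t.
    by rewrite -[RHS]mul1r -h1 divfK// lt0r_neq0.
  (* The component along [th t] already has the full length [r t], so by Pythagoras the orthogonal
     one is zero. *)
  have h2 : y t * cos (th t) - x t * sin (th t) = 0.
    apply/eqP; rewrite -sqrf_eq0; apply/eqP.
    transitivity ((x t ^+ 2 + y t ^+ 2) * (cos (th t) ^+ 2 + sin (th t) ^+ 2) -
      (x t * cos (th t) + y t * sin (th t)) ^+ 2); first by ring.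
    by rewrite h1 rr cs mulr1 subrr.
  split.
    transitivity ((x t * cos (th t) + y t * sin (th t)) * cos (th t) -
      (y t * cos (th t) - x t * sin (th t)) * sin (th t) +
      x t * (1 - (cos (th t) ^+ 2 + sin (th t) ^+ 2))); first by ring.
    by rewrite h1 h2 cs subrr mulr0 mul0r subr0 addr0.
  transitivity ((x t * cos (th t) + y t * sin (th t)) * sin (th t) +
      (y t * cos (th t) - x t * sin (th t)) * cos (th t) +
      y t * (1 - (cos (th t) ^+ 2 + sin (th t) ^+ 2))); first by ring.
  by rewrite h1 h2 cs subrr mulr0 mul0r !addr0.
pose u t := (psi (th t) * r t ^+ n)^-1.
have pr t : psi (th t) * r t ^+ n != 0.
  by rewrite mulf_neq0 ?psi_neq0 ?expf_neq0 ?lt0r_neq0.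
have ur t : psi (th t) * u t * r t ^+ n = 1.
  by rewrite /u mulrAC mulfV.
have zr' t : z t = (r t * cos (th t), r t * sin (th t)).
  by rewrite zE (zr t).1 (zr t).2.
have Xz t := ps_polar H (th t) (rpos t).
have eqw t : (x t * dy t - y t * dx t) / q t = tau * (1 + psi (th t) * r t ^+ n).
  have cs := cos2Dsin2 (th t); rewrite /dx /dy zr' Xz /= -rr (zr t).1 (zr t).2.
  apply: (mulIf (expf_neq0 2 (lt0r_neq0 (rpos t)))); rewrite divfK ?expf_neq0 ?lt0r_neq0//.
  by rewrite -[RHS]mulr1 -cs; ring.
have eqr t : (x t * dx t + y t * dy t) / r t = tau * (r t * (a + phi (th t) * r t ^+ n)).
  have cs := cos2Dsin2 (th t); rewrite /dx /dy zr' Xz /= (zr t).1 (zr t).2.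
  apply: (mulIf (lt0r_neq0 (rpos t))); rewrite divfK ?lt0r_neq0//.
  by rewrite -[RHS]mulr1 -cs; ring.
exists u, th => t; have eu : 0 < e * u t.
  rewrite -(psiu_gt0 (th t)); have : 0 < psi (th t) * u t * r t ^+ n by rewrite ur.
  by rewrite pmulr_lgt0// exprn_gt0.
split => //; first by rewrite zr' /polar_pt (rad_unique (rpos t) (ur t)).
split; first by rewrite /u invrK -eqw.
have dth' := dth t; rewrite eqw in dth'.
have dr' := dr t; rewrite eqr in dr'.
have dp := ps_dpsi H (th t); have p0 := psi_neq0 (th t).
have r0' := lt0r_neq0 (rpos t); have rn : r t ^+ n != 0 by exact: expf_neq0.
rewrite /u; der.
rewrite /= /lin_coef /cst_coef -[X in _ * r t ^+ X.-1]prednK ?(ps_n H)//=.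
have -> : r t ^+ n.-1 = r t ^+ n / r t.
  by rewrite -[in RHS](prednK (ps_n H)) exprS mulrAC mulfV// mul1r.
field; exact/and3P.
Qed.

End Polar.

(** * Periodic orbits are graphs over the angle *)

Section Crossing.
Variable R : realType.
Implicit Types (t x y : R).

Lemma monotone_periodic (f df : R -> R) (P : R) : 0 < P ->
  (forall t, is_derive t 1 f (df t)) -> (forall t, 0 <= df t) ->
  (forall t, f (t + P) = f t) -> forall t, df t = 0.
Proof.
move=> P0 fd df0 fP t; apply/eqP; rewrite eq_le df0 andbT leNgt; apply/negP => dt.
have [d d0 hd] := isd_sign_pos (fd t) dt.
pose v := t + Num.min (d / 2) (P / 2).
have v0 : 0 < Num.min (d / 2) (P / 2) by rewrite lt_min !divr_gt0.
have h : f t < f v.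
  apply: (hd v _).1; last by rewrite /v ltrDl.
  by rewrite /v addrC addKr gtr0_norm// gt_min; apply/orP; left; lra.
have : f v <= f (t + P).
  apply: (@isd_ge0_le _ f df) => //; rewrite /v lerD2l ge_min.
  by apply/orP; right; lra.
by rewrite fP leNgt h.
Qed.

Lemma ln_sub1 x : 0 < x -> ln x <= x - 1.
Proof. by move=> x0; have := expR_ge1Dx (ln x); rewrite lnK ?posrE//; lra. Qed.

(* [v] is the angle.  The last hypothesis comes from a strict Lyapunov function
   which is maximal on the ray through a point exactly when [u = -1]. *)
Lemma no_turning (u v du : R -> R) (T c : R) : 0 < T ->
  (forall t, u t < 0) ->
  (forall t, is_derive t 1 u (du t)) ->
  (forall t, is_derive t 1 v (1 + (u t)^-1)) ->
  (forall t, u (t + T) = u t) -> (forall t, v (t + T) = v t + c) ->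
  (forall t, u t = -1 -> du t != 0) ->
  (forall t0 t, u t0 = -1 -> t0 < t -> v t != v t0) ->
  forall t, u t != -1.
Proof.
move=> T0 un ud vd uT vT du0 vne t0; apply/negP => /eqP ut0.
have vc : continuous v by move=> t; exact: isd_cont (vd t).
have uc : continuous u by move=> t; exact: isd_cont (ud t).
have c0 : c != 0.
  by have := vne t0 (t0 + T) ut0; rewrite ltrDl vT -subr_eq0 addrC addKr => /(_ T0).
have [s s1 sc] : exists2 s : R, s = 1 \/ s = -1 & 0 < s * c.
  have := c0; rewrite neq_lt => /orP[?|?]; [exists (-1); [by right|lra]|exists 1; [by left|lra]].
(* After a time with u = -1 the angle never comes back to its value; as it drifts by [c] per period,
   it stays on the side of [c] for ever. *)
have vlarge t1 t : u t1 = -1 -> t1 < t -> 0 < s * (v t - v t1).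
  move=> ut1 tt; rewrite ltNge; apply/negP => hle.
  have vk (k : nat) : v (t1 + k%:R * T) = v t1 + k%:R * c.
    elim: k => [|k IH]; first by rewrite !mul0r !addr0.
    by rewrite -natr1 !mulrDl !mul1r !addrA vT IH.
  pose k := (Num.truncn (`|t - t1| / T)).+1.
  have hk : `|t - t1| < k%:R * T by rewrite -ltr_pdivrMr//; exact: truncnS_gt.
  have tk : t <= t1 + k%:R * T by have := ler_norm (t - t1); lra.
  have [||w /andP[w1 w2] e0] := @ivt _ (fun x => s * (v x - v t1)) t (t1 + k%:R * T) tk.
  - move=> x _; apply: cvgM; first exact: cvg_cst.
    by apply: cvgB; [exact: vc|exact: cvg_cst].
  - rewrite vk addrAC subrr add0r mulr_le0_ge0// mulrCA mulr_ge0// ltW//.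
  have := vne t1 w ut1 (lt_le_trans tt w1).
  by move: e0 => /eqP; rewrite mulf_eq0 subr_eq0; case: s1 sc => -> _; rewrite ?oppr_eq0 oner_eq0 /= => ->.
(* Were u to cross -1 in the direction of [s], then v' = (u + 1)/u, with u negative, would have the
   sign opposite to [s] just afterwards, against [vlarge]. *)
have down t1 : u t1 = -1 -> s * du t1 < 0.
  move=> ut1; rewrite ltNge; apply/negP; rewrite le_eqVlt => /orP[/eqP/esym/eqP|].
    rewrite mulf_eq0 (negbTE (du0 _ ut1)) orbF.
    by case: s1 => ->; rewrite ?oppr_eq0 oner_eq0.
  move=> sd; have dsu : is_derive t1 1 (fun t => s * u t) (s * du t1).
    by have := ud t1 => ?; der; rewrite mul0r add0r.
  have [d d0 hd] := isd_sign_pos dsu sd.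
  have tt : t1 < t1 + d / 2 by rewrite ltrDl divr_gt0.
  have := vlarge t1 _ ut1 tt.
  have [w /andP[w1 w2] ->] := mean_value tt (fun x _ => vd x).
  have h : s * u t1 < s * u w.
    by apply: (hd w _).1 => //; rewrite gtr0_norm ?subr_gt0//; lra.
  have -> : s * ((1 + (u w)^-1) * (t1 + d / 2 - t1)) = - (s * (u w + 1)) * (d / 2 / - u w).
    by field; have := un w; rewrite lt_neqAle => /andP[].
  rewrite pmulr_lgt0; last by rewrite divr_gt0 ?divr_gt0// oppr_gt0.
  by move: h; rewrite ut1; lra.
pose g t := s * (u t + 1).
have gd t : is_derive t 1 g (s * du t).
  by rewrite /g; have := ud t => ?; der; rewrite mul0r add0r addr0.
have gc : continuous g by move=> t; exact: isd_cont (gd t).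
have g0 t : g t = 0 -> u t = -1.
  rewrite /g => /eqP; rewrite mulf_eq0 addr_eq0 => /orP[|/eqP//].
  by case: s1 => ->; rewrite ?oppr_eq0 oner_eq0.
have near0 t1 : u t1 = -1 -> exists2 d : R, 0 < d & forall t, `|t - t1| < d ->
    (t1 < t -> g t < 0) /\ (t < t1 -> 0 < g t).
  move=> ut1; have gt1 : g t1 = 0 by rewrite /g ut1 addNr mulr0.
  have [|d d0 hd] := isd_sign_pos (isd_opp (gd t1)); first by rewrite oppr_gt0 down.
  exists d => // t /hd; rewrite gt1 oppr0 oppr_gt0 oppr_lt0 //.
(* All zeros of [g] are crossed downwards. But [g] is negative just after [t0] and positive just
   before [t0 + T], so a crossing in the other direction would be needed in between. The margins T/2
   and T/4 keep the two test points in order. *)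
have [d d0 hd] := near0 _ ut0.
have utT : u (t0 + T) = -1 by rewrite uT.
have [d' d'0 hd'] := near0 _ utT.
pose m := Num.min (d / 2) (T / 2); pose m' := Num.min (d' / 2) (T / 4).
have m0 : 0 < m by rewrite lt_min !divr_gt0.
have m'0 : 0 < m' by rewrite lt_min !divr_gt0.
have gm : g (t0 + m) < 0.
  apply: (hd _ _).1; rewrite ?ltrDl// addrC addKr gtr0_norm//.
  by rewrite gt_min; apply/orP; left; lra.
have gm' : 0 < g (t0 + T - m').
  apply: (hd' _ _).2; last by rewrite ltrBlDr ltrDl.
  rewrite [t0 + T - m' - _](_ : _ = - m'); last by ring.
  rewrite normrN gtr0_norm//.
  by rewrite gt_min; apply/orP; left; lra.
have mm : t0 + m <= t0 + T - m'.
  have : m <= T / 2 by rewrite ge_min lexx orbT.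
  have : m' <= T / 4 by rewrite ge_min lexx orbT.
  lra.
have := continuation gc gm _ mm; apply/not_implyP; split; last by apply/negP; rewrite -leNgt ltW.
move=> x hx hle; have := hle x; rewrite hx lexx => /(_ isT).
rewrite le_eqVlt => /predU1P[gx|//].
have [d2 d20 hd2] := near0 x (g0 _ gx).
have xm : t0 + m < x.
  rewrite lt_neqAle hx andbT; apply/eqP => e; move: gm; rewrite e gx ltxx//.
pose w := Num.max (t0 + m) (x - d2 / 2).
have wx : w < x by rewrite gt_max xm /=; lra.
have : g w <= 0 by apply: hle; rewrite le_max lexx /= ltW.
rewrite leNgt (hd2 w _).2//.
rewrite distrC gtr0_norm ?subr_gt0//.
have : x - d2 / 2 <= w by rewrite le_max lexx orbT.
lra.
Qed.

End Crossing.

Section Orbits.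
Variables (R : realType) (n : nat) (a e s : R) (phi psi dpsi : R -> R).
Variable X : R * R -> R * R.
Hypothesis H : polar_system n a e s phi psi dpsi X.
Implicit Types (t th x y r : R).

Notation Sf := (lin_coef n a psi dpsi).
Notation Df := (cst_coef n phi psi dpsi).
Notation E := (polar_pt n psi).

(** Uniqueness at an equilibrium, by Gronwall's inequality for the squared distance to it;
    boundedness of the trajectory provides one Lipschitz constant for all times. *)
Lemma equilibrium_cst (tau M : R) (z : R -> R * R) t0 : tau = 1 \/ tau = -1 ->
  planar_solution X tau z -> (forall t, `|(z t).1| <= M /\ `|(z t).2| <= M) ->
  X (z t0) = (0, 0) -> forall t, z t = z t0.
Proof.
move=> tau1 hz zM X0 t; have [K hK] := ps_lip H M.
pose x u := (z u).1 - (z t0).1; pose y u := (z u).2 - (z t0).2.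
pose N u := x u ^+ 2 + y u ^+ 2.
have xd (u : R) : is_derive u 1 x (tau * (X (z u)).1).
  by rewrite /x; have := (hz u).1 => ?; der; rewrite addr0.
have yd (u : R) : is_derive u 1 y (tau * (X (z u)).2).
  by rewrite /y; have := (hz u).2 => ?; der; rewrite addr0.
pose dN u := 2 * tau * (x u * (X (z u)).1 + y u * (X (z u)).2).
have Nd (u : R) : is_derive u 1 N (dN u).
  by rewrite /N /dN; have := xd u => ?; have := yd u => ?; der; rewrite /=; ring.
have NK u : `|dN u| <= (4 * `|K|) * `|N u|.
  have N0 : 0 <= N u by rewrite addr_ge0 ?sqr_ge0.
  rewrite (ger0_norm N0) /dN !normrM.
  have -> : `|tau| = 1 by case: tau1 => ->; rewrite ?normrN normr1.
  rewrite mulr1 ger0_norm//.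
  have [h1 h2] := hK (z u) (z t0) (zM u).1 (zM u).2 (zM t0).1 (zM t0).2.
  rewrite X0 /= !subr0 -/(x u) -/(y u) in h1 h2.
  have p0 : 0 <= `|x u| + `|y u| by rewrite addr_ge0.
  have hb w : w <= K * (`|x u| + `|y u|) -> w <= `|K| * (`|x u| + `|y u|).
    by move=> h; apply: le_trans h _; rewrite ler_wpM2r// ler_norm.
  move/hb: h1 => h1; move/hb: h2 => h2.
  have h3 : `|x u * (X (z u)).1 + y u * (X (z u)).2| <= `|K| * (`|x u| + `|y u|) ^+ 2.
    apply: le_trans (ler_normD _ _) _; rewrite !normrM.
    have -> : `|K| * (`|x u| + `|y u|) ^+ 2 = `|x u| * (`|K| * (`|x u| + `|y u|)) +
      `|y u| * (`|K| * (`|x u| + `|y u|)) by ring.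
    by rewrite lerD// ler_wpM2l.
  have h4 : (`|x u| + `|y u|) ^+ 2 <= 2 * N u.
    rewrite /N -(real_normK (num_real (x u))) -(real_normK (num_real (y u))).
    have := sqr_ge0 (`|x u| - `|y u|); rewrite sqrrB sqrrD; lra.
  have h5 : `|K| * (`|x u| + `|y u|) ^+ 2 <= `|K| * (2 * N u) by rewrite ler_wpM2l.
  lra.
have Nt0 : N t0 = 0 by rewrite /N /x /y !subrr expr0n /= addr0.
have Nt : N t = 0.
  apply/eqP; rewrite -normr_le0.
  have [tt|/ltW tt] := leP t0 t.
    have [+ _] := gronwall tt (fun u _ => Nd u) (fun u _ => NK u).
    by rewrite Nt0 normr0 mul0r.
  have [_ +] := gronwall tt (fun u _ => Nd u) (fun u _ => NK u).
  by rewrite Nt0 normr0 mul0r.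
move: Nt => /eqP; rewrite /N paddr_eq0 ?sqr_ge0// !sqrf_eq0 !subr_eq0 => /andP[/eqP h1 /eqP h2].
by rewrite (surjective_pairing (z t)) h1 h2 -surjective_pairing.
Qed.

(** The last hypothesis says that a point of the orbit with u = -1 is not an equilibrium. Where S is
    negative, time has to be reversed, whence [0 < tau * s]. *)
Lemma orbit_no_turning (tau : R) (u th : R -> R) (T c : R) : tau * tau = 1 ->
  0 < tau * s -> 0 < T ->
  (forall t, u t < 0) -> (forall t, polar_flow n a phi psi dpsi tau u th t) ->
  (forall t, u (t + T) = u t) -> (forall t, th (t + T) = th t + c) ->
  (forall t, u t = -1 -> Sf (th t) - Df (th t) != 0) ->
  forall t, u t != -1.
Proof.
move=> tau2 ts T0 un hf uT thT neq.
have tau0 : tau != 0 by apply: contra_eq_neq tau2 => ->; rewrite mul0r eq_sym oner_neq0.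
pose du t := - tau * (Sf (th t) * u t + Df (th t)).
have ud t : is_derive t 1 u (du t) by exact: (hf t).2.
have thd t : is_derive t 1 th (tau * (1 + (u t)^-1)) by exact: (hf t).1.
have du0 t : u t = -1 -> du t != 0.
  move=> ut; rewrite /du ut mulrN1 mulf_neq0 ?oppr_eq0//.
  by have := neq t ut; rewrite -oppr_eq0 opprB addrC.
have [SP dSP] := primitive (Sf_cont H); have [DP dDP] := primitive (Df_cont H).
(* Along the flow u + ln(-u) + DP has derivative -tau S (1 + u). Subtracting the primitive of S
   completes this to -tau S (1 + u)^2 / u, which has a sign because u is negative. *)
pose N t := u t + ln (- u t) + DP (th t) - SP (th t).
have Nd t : is_derive t 1 N (- (tau * Sf (th t) * ((1 + u t) ^+ 2 / u t))).
  have u0 : u t != 0 by rewrite lt_eqF.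
  have h0 : 0 < - u t by rewrite oppr_gt0.
  rewrite /N; have := ud t => ?; have := thd t => ?; have := dSP (th t) => ?; have := dDP (th t) => ?.
  by der; rewrite /du /=; field.
have Spos t : 0 < tau * Sf (th t).
  have h := ps_S H (th t); rewrite -/(Sf (th t)) in h.
  have -> : tau * Sf (th t) = (tau * s) * (s * Sf (th t)).
    by rewrite -mulrA (mulrA s s) (sqr_sign (ps_s H)) mul1r.
  exact: mulr_gt0.
have N'0 t : 0 <= - (tau * Sf (th t) * ((1 + u t) ^+ 2 / u t)).
  rewrite -mulrN mulr_ge0 ?(ltW (Spos t))// -mulrN -invrN mulr_ge0 ?sqr_ge0// invr_ge0 oppr_ge0 ltW//.
have N'pos t : u t != -1 -> 0 < - (tau * Sf (th t) * ((1 + u t) ^+ 2 / u t)).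
  move=> ut; rewrite -mulrN mulr_gt0// -mulrN -invrN mulr_gt0 ?invr_gt0 ?oppr_gt0//.
  by rewrite lt_neqAle sqr_ge0 andbT eq_sym sqrf_eq0 addrC addr_eq0.
have Nle x y : x <= y -> N x <= N y.
  by move=> xy; apply: (isd_ge0_le xy (fun t _ => Nd t)) => t _; exact: N'0.
(* The derivative of [N] vanishes only where u = -1, and there u' is nonzero, so such times are
   isolated and the growth is strict. *)
have Nlt x y : x < y -> N x < N y.
  move=> xy; have [w /andP[xw wy] uw] : exists2 w, x < w < y & u w != -1.
    pose m := (x + y) / 2.
    have xm : x < m by rewrite /m; lra.
    have my : m < y by rewrite /m; lra.
    have [um|um] := eqVneq (u m) (-1); last by exists m => //; rewrite xm.
    have [d d0 hd] : exists2 d : R, 0 < d & forall t, `|t - m| < d -> m < t -> u t != -1.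
      have := du0 m um; rewrite neq_lt => /orP[h|h].
        have [|d d0 hd] := isd_sign_pos (isd_opp (ud m)); first by rewrite oppr_gt0.
        exists d => // t /hd[+ _] => /[apply]; rewrite ltrN2 um => h1.
        by rewrite lt_eqF.
      have [d d0 hd] := isd_sign_pos (ud m) h.
      exists d => // t /hd[+ _] => /[apply]; rewrite um => h1.
      by rewrite gt_eqF.
    exists (m + Num.min (d / 2) ((y - m) / 2)).
      have : 0 < Num.min (d / 2) ((y - m) / 2) by rewrite lt_min !divr_gt0// subr_gt0.
      have : Num.min (d / 2) ((y - m) / 2) <= (y - m) / 2 by rewrite ge_min lexx orbT.
      by move=> ? ?; apply/andP; split; lra.
    have p0 : 0 < Num.min (d / 2) ((y - m) / 2) by rewrite lt_min !divr_gt0// subr_gt0.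
    apply: hd; last by rewrite ltrDl.
    rewrite addrC addKr gtr0_norm//.
    have : Num.min (d / 2) ((y - m) / 2) <= d / 2 by rewrite ge_min lexx.
    by move=> h; apply: le_lt_trans h _; lra.
  have [d d0 hd] := isd_sign_pos (Nd w) (N'pos w uw).
  pose v := w + Num.min (d / 2) (y - w).
  have p0 : 0 < Num.min (d / 2) (y - w) by rewrite lt_min divr_gt0// subr_gt0.
  have vy : v <= y by rewrite /v -lerBrDl ge_min lexx orbT.
  have : N w < N v.
    apply: (hd v _).1; last by rewrite /v ltrDl.
    rewrite /v addrC addKr gtr0_norm// gt_min; apply/orP; left; lra.
  by have := Nle _ _ (ltW xw); have := Nle _ _ vy; lra.
apply: (@no_turning _ u (fun t => tau * th t) du T (tau * c)) => //.
- move=> t; have := thd t => ?; der; rewrite /=; rewrite mul0r add0r mulrA tau2 mul1r//.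
- by move=> t; rewrite thT mulrDr.
(* At equal angles the primitives cancel, and u + ln(-u) is at most -1, its value at u = -1; so
   [N t <= N t0], against strict growth. *)
move=> t0 t ut0 tt; apply/eqP => /(mulfI tau0) eth.
have := Nlt _ _ tt; rewrite /N eth ut0 opprK ln1 addr0.
have h0 : 0 < - u t by rewrite oppr_gt0.
have := ln_sub1 h0; lra.
Qed.

End Orbits.

(** * Graphs over the angle: uniqueness, and reduction of periodic orbits to graphs *)

Section Graphs.
Variables (R : realType) (n : nat) (a e s : R) (phi psi dpsi : R -> R).
Variable X : R * R -> R * R.
Hypothesis H : polar_system n a e s phi psi dpsi X.
Implicit Types (t th x r : R).

Notation Sf := (lin_coef n a psi dpsi).
Notation Df := (cst_coef n phi psi dpsi).
Notation E := (polar_pt n psi).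

(** A component of the u-axis without 0 and -1. On it the angular velocity 1 + 1/u has the sign
    [e * kap]. *)
Definition region_of (kap u : R) : Prop := 0 < e * u /\ 0 < kap * (1 + u).

Definition scalar_field th (u : R) : R := - (Sf th * u + Df th) * (u / (1 + u)).

Definition graph_solution (kap : R) (y : R -> R) : Prop := forall th,
  region_of kap (y th) /\ is_derive th 1 y (scalar_field th (y th)).

Lemma region_neq0 kap u : region_of kap u -> u != 0 /\ 1 + u != 0.
Proof.
by move=> [h1 h2]; split; [apply: contraTneq h1|apply: contraTneq h2] => ->; rewrite mulr0 ltxx.
Qed.

Lemma region_convex kap u v w : region_of kap u -> region_of kap v -> u <= w <= v -> region_of kap w.
Proof. by move=> [h1 h2] [h3 h4] /andP[uw wv]; split; [case: (ps_e H) => he|have [k|k] := leP 0 kap]; nra. Qed.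

(** The function L of the overview: [e * u] is the absolute value of u on the region. *)
Definition first_integral (u : R) : R := u + ln (e * u).

Lemma Lf_der (u : R) : 0 < e * u -> is_derive u 1 first_integral (1 + u^-1).
Proof.
move=> eu; rewrite /first_integral; have u0 : u != 0 by apply: contraTneq eu => ->; rewrite mulr0 ltxx.
by der; rewrite mul0r add0r mulr1; field; rewrite u0 (e_neq0 H).
Qed.

(** The derivative 1 + 1/u of L has the sign [e * kap] throughout a region. *)
Lemma Lf_mono kap u v : region_of kap u -> region_of kap v -> u != v ->
  0 < e * kap * (first_integral u - first_integral v) * (u - v).
Proof.
wlog uv : u v / v < u => [wl hu hv uv|hu hv _].
  have [h|h|h] := ltgtP u v; last by rewrite h eqxx in uv.
    by have := wl _ _ h hv hu; rewrite eq_sym uv => /(_ isT); lra.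
  exact: wl.
have [w|w /andP[w1 w2] ->] := @mean_value _ first_integral (fun w => 1 + w^-1) _ _ uv.
  by move=> hw; apply: Lf_der; have [] := region_convex hv hu hw.
have hw : region_of kap w by apply: region_convex hv hu _; rewrite !ltW.
have [w0 _] := region_neq0 hw; have [h1 h2] := hw.
have -> : e * kap * ((1 + w^-1) * (u - v)) * (u - v) =
  (e * w) * (kap * (1 + w)) * ((u - v) / w) ^+ 2 by field.
apply: mulr_gt0; first exact: mulr_gt0.
by apply: sqr_pos; rewrite mulf_neq0 ?invr_neq0// subr_eq0 gt_eqF.
Qed.

Lemma Lf_graph kap (y : R -> R) : graph_solution kap y -> forall th,
  is_derive th 1 (fun x => first_integral (y x)) (- (Sf th * y th + Df th)).
Proof.
move=> hy th; have [hr hd] := hy th; have [y0 y1] := region_neq0 hr.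
apply: isd_eq (isd_comp (Lf_der hr.1) hd) _.
by rewrite /scalar_field; field; rewrite y1 y0.
Qed.

(** The common period [P] is left free: it is 2 pi for two cycles, but the whole winding of one
    orbit when its graph is compared with its own rotation. *)
Lemma graph_unique kap1 kap2 (y1 y2 : R -> R) P :
  kap1 = 1 \/ kap1 = -1 -> kap2 = 1 \/ kap2 = -1 -> 0 < P ->
  graph_solution kap1 y1 -> graph_solution kap2 y2 ->
  (forall th, y1 (th + P) = y1 th) -> (forall th, y2 (th + P) = y2 th) ->
  y1 = y2.
Proof.
move=> k1 k2 P0 h1 h2 p1 p2.
pose W th := first_integral (y1 th) - first_integral (y2 th).
have Wd th : is_derive th 1 W (- (Sf th * (y1 th - y2 th))).
  by apply: isd_eq (isd_add (Lf_graph h1 th) (isd_opp (Lf_graph h2 th))) _; ring.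
have WP th : W (th + P) = W th by rewrite /W p1 p2.
have [kk|kk] : kap1 = kap2 \/ kap2 = - kap1.
  by case: k1 => ->; case: k2 => ->; rewrite ?opprK; by [left|right].
- apply/funext => th; apply/eqP; apply: contraT => yne.
  have Vd x : is_derive x 1 (fun x => - (s * e * kap1) * W x ^+ 2)
      (2 * (s * Sf x) * (e * kap1 * W x * (y1 x - y2 x))).
    by have := Wd x => ?; der; rewrite /=; ring.
  have pos x : y1 x != y2 x -> 0 < 2 * (s * Sf x) * (e * kap1 * W x * (y1 x - y2 x)).
    move=> yx; apply: mulr_gt0; first by apply: mulr_gt0 => //; exact: (ps_S H).
    by apply: Lf_mono => //; [exact: (h1 x).1|rewrite kk; exact: (h2 x).1].
  have : 2 * (s * Sf th) * (e * kap1 * W th * (y1 th - y2 th)) = 0.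
    apply: (monotone_periodic P0 Vd) => x; last by rewrite WP.
    have [->|/pos/ltW//] := eqVneq (y1 x) (y2 x); by rewrite subrr !mulr0.
  by move/eqP; rewrite gt_eqF// pos.
(* Here the two graphs are separated by the level u = -1, so [y1 - y2] has a constant sign and [W]
   itself is monotone. *)
- have Vd x : is_derive x 1 (fun x => - (s * kap1) * W x)
      ((s * Sf x) * (kap1 * (y1 x - y2 x))).
    by have := Wd x => ?; der; rewrite /=; ring.
  have pos x : 0 < (s * Sf x) * (kap1 * (y1 x - y2 x)).
    apply: mulr_gt0; first exact: (ps_S H).
    by have := (h1 x).1.2; have := (h2 x).1.2; rewrite kk; lra.
  have : (s * Sf 0) * (kap1 * (y1 0 - y2 0)) = 0.
    by apply: (monotone_periodic P0 Vd) => x; [rewrite ltW|rewrite WP].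
  by move/eqP; rewrite gt_eqF.
Qed.

Lemma X_E th (u : R) : 0 < e * u ->
  X (E th u) = (rad n psi th u * ((a + phi th / (psi th * u)) * cos th - (1 + u^-1) * sin th),
                rad n psi th u * ((a + phi th / (psi th * u)) * sin th + (1 + u^-1) * cos th)).
Proof.
move=> eu; have pu : psi th * u != 0 by rewrite lt0r_neq0// (psiu_gt0 H).
have u0 : u != 0 by apply: contraNneq pu => ->; rewrite mulr0.
have rn : rad n psi th u ^+ n = (psi th * u)^-1.
  by apply: (mulfI pu); rewrite (radX H)// mulfV.
rewrite (ps_polar H _ (rad_gt0 _ _ _ _)) rn.
have -> // : psi th * (psi th * u)^-1 = u^-1.
by field; rewrite u0 (psi_neq0 H).
Qed.

(** Once u = -1 is excluded the angle is a strictly monotone function of time, and y is u composed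
    with its inverse. The period found in this way is the total winding; it has to be cut down to 2
    pi. *)
Lemma cycle_graph (g : set (R * R)) : periodic_orbit X g ->
  exists kap y, [/\ kap = 1 \/ kap = -1, graph_solution kap y,
    (forall th, y (th + 2 * pi) = y th) & g = range (fun th => E th (y th))].
Proof.
move=> [z [T [hz [T0 zT] [tn ztn] ->]]].
have zd t := hz t I.
have zc1 : continuous (fun t => (z t).1) by move=> t; exact: isd_cont (zd t).1.
have zc2 : continuous (fun t => (z t).2) by move=> t; exact: isd_cont (zd t).2.
have sol : planar_solution X 1 z by move=> t; rewrite !mul1r; exact: zd.
have [M1 M10 hM1] := per_bounded T0 zc1 (fun t => congr1 fst (zT t)).
have [M2 M20 hM2] := per_bounded T0 zc2 (fun t => congr1 snd (zT t)).
(* A non-constant orbit contains no equilibrium. In particular it avoids the origin, so that polar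
   coordinates can be lifted. *)
have noeq t0 : X (z t0) <> (0, 0).
  move=> X0; have zM t : `|(z t).1| <= M1 + M2 /\ `|(z t).2| <= M1 + M2.
    by have := hM1 t; have := hM2 t; split; lra.
  have hc := equilibrium_cst H (or_introl erefl) sol zM X0.
  by move/eqP: ztn; apply; rewrite (hc tn) (hc 0).
have [|u [th hut]] := polar_lift H sol.
  by move=> t zt; apply: (noeq t); rewrite zt (ps_X0 H).
have zE t : z t = E (th t) (u t) by have [] := hut t.
have eu t : 0 < e * u t by have [] := hut t.
have fl t : polar_flow n a phi psi dpsi 1 u th t by have [] := hut t.
have u0 t : u t != 0 by apply: contraTneq (eu t) => ->; rewrite mulr0 ltxx.
have thd t : is_derive t 1 th (1 + (u t)^-1) by have := (fl t).1; rewrite mul1r.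
have ud t : is_derive t 1 u (- (Sf (th t) * u t + Df (th t))).
  by have := (fl t).2; rewrite mulN1r.
have per t : u (t + T) = u t /\ exists k : int, th (t + T) = th t + k%:~R * (2 * pi).
  by apply: (E_inj H) => //; rewrite -!zE zT.
have uT t := (per t).1.
pose c := th T - th 0.
have thT t : th (t + T) = th t + c.
  have hd x : is_derive x 1 (fun x => th (x + T) - th x) 0.
    have := thd x => ?; have := thd (x + T) => ?.
    by der; rewrite uT; ring.
  have e0 := der0_cst hd t 0; rewrite add0r -/c in e0.
  by rewrite -e0; ring.
have [k ck] : exists k : int, c = k%:~R * (2 * pi).
  by have [_ [k]] := per 0; rewrite add0r => e0; exists k; rewrite /c e0; ring.
have u1 t : u t != -1.
  (* At u = -1 the angular velocity vanishes, and S = D would make the radial velocity vanish as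
     well. *)
  have neq t0 : u t0 = -1 -> Sf (th t0) - Df (th t0) != 0.
    move=> ut; apply/eqP => hSD; apply: (noeq t0).
    rewrite zE (X_E _ (eu t0)) ut invrN invr1 subrr.
    have -> : a + phi (th t0) / (psi (th t0) * -1) = 0.
      apply: (mulfI (n_neq0 H)); rewrite mulr0 -hSD /lin_coef /cst_coef.
      by field; exact: psi_neq0 H _.
    by rewrite !mul0r subr0 addr0 mulr0.
  (* If psi is positive, so is u, and -1 is out of reach. *)
  case: (ps_e H) => he.
    by have := eu t; rewrite he mul1r => h; rewrite gt_eqF//; lra.
  have un x : u x < 0 by have := eu x; rewrite he; lra.
  case: (ps_s H) => hs.
    apply: (@orbit_no_turning _ _ _ _ _ _ _ _ _ H 1 u th T c) => //.
    - by rewrite mulr1.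
    - by rewrite hs mulr1.
  rewrite -(opprK t).
  apply: (@orbit_no_turning _ _ _ _ _ _ _ _ _ H (-1) (fun x => u (- x)) (fun x => th (- x)) T (- c)) => //.
  - by rewrite mulrNN mulr1.
  - by rewrite hs mulrNN mulr1.
  - move=> x; split; have := thd (- x) => ?; have := ud (- x) => ?; by der; ring.
  - by move=> x; rewrite opprD -[in RHS](subrK T (- x)) uT.
  - by move=> x; rewrite opprD -[in RHS](subrK T (- x)) thT; ring.
  - by move=> x; exact: neq.
have uc : continuous u by move=> t; exact: isd_cont (ud t).
have u1' t : 1 + u t != 0 by rewrite addrC addr_eq0.
have [kap kap1 hk] : exists2 kap, kap = 1 \/ kap = -1 & forall t, 0 < kap * (1 + u t).
  by apply: const_sign => // t; apply: cvgD; [exact: cvg_cst|exact: uc].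
have reg t : region_of kap (u t) by split.
have [b b0 hb] : exists2 b, 0 < b & forall t, b <= `|1 + (u t)^-1|.
  apply: (@per_lbound _ (fun t => 1 + (u t)^-1) T) => //.
  - by move=> t; apply: cvgD; [exact: cvg_cst|apply: cvgV; [exact: u0|exact: uc]].
  - by move=> t; rewrite uT.
  - move=> t; rewrite (_ : 1 + _ = (1 + u t) / u t) ?mulf_neq0 ?invr_neq0//.
    by field.
have ek : e * kap = 1 \/ e * kap = -1.
  by case: (ps_e H) => ->; case: kap1 => ->; rewrite ?mul1r ?mulrN ?mulr1 ?mulNr ?opprK ?mulr1; by [left|right].
have hb' t : b <= e * kap * (1 + (u t)^-1).
  have h0 : 0 < e * kap * (1 + (u t)^-1).
    have -> : e * kap * (1 + (u t)^-1) = (e * u t) * (kap * (1 + u t)) / u t ^+ 2 by field.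
    by apply: divr_gt0; [exact: mulr_gt0|exact: sqr_pos].
  rewrite -(gtr0_norm h0) normrM; have := hb t.
  by case: ek => ->; rewrite ?normrN normr1 mul1r.
have [h [thK hK hd]] := inverse_fun ek thd b0 hb'.
pose y x := u (h x).
have yth t : y (th t) = u t by rewrite /y thK.
have ygs : graph_solution kap y.
  move=> x; split; first exact: reg.
  apply: isd_eq (@isd_comp _ u h x _ _ (ud _) (hd x)) _.
  rewrite hK /scalar_field /y; field.
  by rewrite u1' u0.
have yc x : y (x + c) = y x by rewrite -(hK x) -thT !yth uT.
have c0 : c != 0.
  apply/eqP => c0; have := thT 0; rewrite c0 addr0 add0r => /(can_inj thK) e0.
  by move: T0; rewrite e0 ltxx.
have yP x : y (x + `|c|) = y x.
  have [cp|cn] := leP 0 c; first by rewrite ger0_norm.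
  by rewrite ltr0_norm// -[LHS]yc subrK.
have y2gs : graph_solution kap (fun x => y (x + 2 * pi)).
  move=> x; split; first exact: (ygs _).1.
  have := (ygs (x + 2 * pi)).2; rewrite /scalar_field (Sf_per H) (Df_per H) => ?.
  by der; ring.
(* The rotated graph is a solution with the same period [|c|], so it coincides with y. *)
have y2 : (fun x => y (x + 2 * pi)) = y.
  apply: (@graph_unique kap kap _ _ `|c|) => //; first by rewrite normr_gt0.
  by move=> x; rewrite addrAC yP.
exists kap, y; split => //; first by move=> x; rewrite -{2}y2.
apply/seteqP; split => [_ [t _ <-]|_ [x _ <-]].
  by exists (th t) => //; rewrite yth zE.
by exists (h x) => //; rewrite zE hK.
Qed.

Lemma periodic_orbit_unique (g g' : set (R * R)) :
  periodic_orbit X g -> periodic_orbit X g' -> g = g'.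
Proof.
move=> /cycle_graph[kap [y [k1 hy py ->]]] /cycle_graph[kap' [y' [k1' hy' py' ->]]].
have pi0 : 0 < 2 * pi :> R by rewrite mulr_gt0 ?pi_gt0.
by rewrite (graph_unique k1 k1' pi0 hy hy' py py').
Qed.

End Graphs.

(** * Functions of the angle on the punctured plane, and tubes around compact sets *)

Section Angular.
Variable R : realType.
Implicit Types (t th r x y : R) (q : R * R).

Lemma cvg_comp_cont (T : Type) (G : set_system T) {FG : Filter G}
    (f : T -> R) (h : R -> R) (l : R) :
  f x @[x --> G] --> l -> {for l, continuous h} -> h (f x) @[x --> G] --> h l.
Proof. by move=> fl hl; apply: continuous_cvg; [exact: hl|exact: fl]. Qed.

Lemma local_angle (A B : R) : 0 < A ->
  exists rho, [/\ 0 < rho, rho ^+ 2 = A ^+ 2 + B ^+ 2,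
    A = rho * cos (atan (B / A)) & B = rho * sin (atan (B / A))].
Proof.
move=> A0; pose t := B / A; pose w := Num.sqrt (1 + t ^+ 2).
have t0 : 0 < 1 + t ^+ 2 by rewrite ltr_pwDl// sqr_ge0.
have w0 : 0 < w by rewrite sqrtr_gt0.
have w2 : w ^+ 2 = 1 + t ^+ 2 by rewrite sqr_sqrtr// ltW.
have c : cos (atan t) = w^-1 by rewrite cos_atan.
have s : sin (atan t) = t * w^-1.
  have h := atanK t; rewrite /tan c invrK in h.
  by rewrite -{2}h mulfK// lt0r_neq0.
exists (A * w); rewrite -/t c s; split.
- exact: mulr_gt0.
- by rewrite exprMn w2 /t; field; exact: lt0r_neq0.
- by rewrite mulfK// lt0r_neq0.
- by rewrite /t; field; rewrite !lt0r_neq0.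
Qed.

Lemma rotated_angle (x y th : R) : 0 < x * cos th + y * sin th ->
  exists2 rho : R, 0 < rho &
  let al := th + atan ((y * cos th - x * sin th) / (x * cos th + y * sin th)) in
  [/\ x = rho * cos al, y = rho * sin al & rho ^+ 2 = x ^+ 2 + y ^+ 2].
Proof.
move=> A0; have [rho [rho0 rho2 hA hB]] := local_angle (y * cos th - x * sin th) A0.
exists rho => //=; set at_ := atan _ in hA hB *; have cs := cos2Dsin2 th; split.
- rewrite cosD mulrBr mulrCA -hA (mulrCA rho) -hB -[LHS]mulr1 -cs; ring.
- rewrite sinD mulrDr mulrCA -hA (mulrCA rho) -hB -[LHS]mulr1 -cs; ring.
- by rewrite rho2 -[RHS]mulr1 -cs; ring.
Qed.

(** A periodic function of the angle descends to the plane. For continuity at q the angle of nearby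
    points is measured from that of q, as the arctangent of the quotient of the coordinates in the
    frame rotated by [th0]. At the origin the value carries no information. *)
Lemma angular_function (f : R -> R) : continuous f ->
  (forall th, f (th + 2 * pi) = f th) ->
  exists F : R * R -> R,
    (forall r th, 0 < r -> F (r * cos th, r * sin th) = f th) /\
    (forall q, q <> (0, 0) -> F x @[x --> q] --> F q).
Proof.
move=> fc fT.
have exv q : exists v, forall r th, 0 < r -> q = (r * cos th, r * sin th) -> v = f th.
  have [h0|h0] := eqVneq (q.1 ^+ 2 + q.2 ^+ 2) 0.
    exists 0 => r th r0 qE; move: h0; rewrite qE /= !exprMn -mulrDr cos2Dsin2 mulr1.
    by move=> /eqP; rewrite sqrf_eq0 gt_eqF.
  have [r0 [th0 [r00 h1 h2]]] := polar_ex h0.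
  exists (f th0) => r th rpos qE; rewrite qE /= in h1 h2.
  have [_ [k ->]] := polar_inj rpos r00 h1 h2.
  by rewrite (per_int fT).
have [F hF] := choice exv.
have FE r th : 0 < r -> F (r * cos th, r * sin th) = f th by move=> r0; apply: hF erefl.
exists F; split => // q q0.
have h0 : q.1 ^+ 2 + q.2 ^+ 2 != 0.
  rewrite paddr_eq0 ?sqr_ge0// !sqrf_eq0; apply/negP => /andP[/eqP h1 /eqP h2].
  by apply: q0; rewrite (surjective_pairing q) h1 h2.
have [r0 [th0 [r00 h1 h2]]] := polar_ex h0.
have qE : q = (r0 * cos th0, r0 * sin th0) by rewrite (surjective_pairing q) h1 h2.
pose A (p : R * R) := p.1 * cos th0 + p.2 * sin th0.
pose B (p : R * R) := p.2 * cos th0 - p.1 * sin th0.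
have Ac : A p @[p --> q] --> A q.
  by apply: cvgD; (apply: cvgM; last exact: cvg_cst); [exact: cvg_fst|exact: cvg_snd].
have Bc : B p @[p --> q] --> B q.
  by apply: cvgB; (apply: cvgM; last exact: cvg_cst); [exact: cvg_snd|exact: cvg_fst].
have Aq : A q = r0.
  by rewrite qE /A /= -[RHS]mulr1 -(cos2Dsin2 th0); ring.
have Bq : B q = 0 by rewrite qE /B /=; ring.
have cont : f (th0 + atan (B p / A p)) @[p --> q] --> F q.
  rewrite qE FE// -[X in _ --> f X]addr0 -atan0 -[X in atan X](mul0r (A q)^-1) -Bq -qE.
  have h : th0 + atan (B p / A p) @[p --> q] --> th0 + atan (B q / A q).
    apply: cvgD; first exact: cvg_cst.
    have hBA : B p / A p @[p --> q] --> B q / A q.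
      by apply: cvgM => //; apply: cvgV => //; rewrite Aq gt_eqF.
    by apply: (cvg_comp_cont hBA); exact: continuous_atan.
  by apply: (cvg_comp_cont (h := f) h); exact: fc.
have Apos : \forall p \near q, 0 < A p by apply: (cvgr_gt _ Ac); rewrite Aq.
apply: cvg_trans cont; apply: near_eq_cvg; near=> p.
have Ap : 0 < A p by near: p.
have [rho rho0] := rotated_angle Ap; set al := th0 + _ => -[p1 p2 _].
transitivity (F (rho * cos al, rho * sin al)); first by rewrite FE.
by congr F; rewrite -p1 -p2 -surjective_pairing.
Unshelve. all: by end_near. Qed.

(** A Lebesgue number: compactness makes the radii of the balls inside [O] uniform along [g]. *)
Lemma tube_sub (g O : set (R * R)) : compact g -> open O -> g `<=` O ->
  exists2 d : R, 0 < d & tube g d `<=` O.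
Proof.
move=> gcpt Oo gO.
have := (compact_near_coveringP g).1 gcpt R ((0:R)^'+) (fun d p => ball p d `<=` O) _.
move=> /(_ _)[].
  move=> p gp; have := open_nbhs_nbhs (conj Oo (gO _ gp)) => /nbhs_ballP[r /= r0 hr].
  exists (ball p (r / 2), [set d | d < r / 2]) => /=.
    split; first by apply: nbhsx_ballx; rewrite divr_gt0.
    by apply: nbhs_right_lt; rewrite divr_gt0.
  move=> [p' d] [/= pp' dr] x hx; apply: hr.
  rewrite [r]splitr; apply: ball_triangle pp' _.
  by apply: le_ball hx; exact: ltW.
move=> e /= e0 he; exists (e / 2); first by rewrite divr_gt0.
move=> q [p gp pq]; apply: (he (e / 2)) pq => //; rewrite ?divr_gt0//.
by rewrite /ball_ /= sub0r normrN gtr0_norm ?divr_gt0//; lra.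
Qed.

End Angular.

(** * The geometry of the curve u = y th: it surrounds the origin, and its tubes are narrow in u *)

Section Surround.
Variables (R : realType) (n : nat) (a e s : R) (phi psi dpsi : R -> R).
Variable X : R * R -> R * R.
Hypothesis H : polar_system n a e s phi psi dpsi X.
Implicit Types (t th x r : R) (q : R * R).

Notation Sf := (lin_coef n a psi dpsi).
Notation Df := (cst_coef n phi psi dpsi).
Notation E := (polar_pt n psi).

Lemma rad_cont (y : R -> R) : (forall th, 0 < e * y th) -> continuous y ->
  continuous (fun th => rad n psi th (y th)).
Proof.
move=> hy yc th.
have pu : 0 < psi th * y th by rewrite (psiu_gt0 H).
have h1 : - (ln (psi x * y x) / n%:R) @[x --> th] --> - (ln (psi th * y th) / n%:R).
  apply: cvgN; apply: cvgM; last exact: cvg_cst.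
  have h2 : psi x * y x @[x --> th] --> psi th * y th.
    by apply: cvgM; [exact: isd_cont (ps_dpsi H th)|exact: yc].
  by apply: (cvg_comp_cont h2); exact: (continuous_ln pu).
by apply: (cvg_comp_cont h1); exact: continuous_expR.
Qed.

Lemma curve_cont (y : R -> R) : (forall th, 0 < e * y th) -> continuous y ->
  continuous (fun th => E th (y th)).
Proof.
move=> hy yc th.
have h1 : rad n psi x (y x) * cos x @[x --> th] --> rad n psi th (y th) * cos th.
  by apply: cvgM; [exact: rad_cont|exact: continuous_cos].
have h2 : rad n psi x (y x) * sin x @[x --> th] --> rad n psi th (y th) * sin th.
  by apply: cvgM; [exact: rad_cont|exact: continuous_sin].
exact: (cvg_pair h1 h2).
Qed.

Lemma curve_compact (y : R -> R) : (forall th, 0 < e * y th) -> continuous y ->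
  (forall th, y (th + 2 * pi) = y th) -> compact (range (fun th => E th (y th))).
Proof.
move=> hy yc yT.
have pi0 : 0 < 2 * pi :> R by rewrite mulr_gt0 ?pi_gt0.
have -> : range (fun th => E th (y th)) = (fun th => E th (y th)) @` `[0, 2 * pi]%classic.
  apply/seteqP; split => [_ [th _ <-]|_ [th _ <-]]; last by exists th.
  have [k /andP[k0 k1]] := per_red th pi0.
  exists (th + k%:~R * (2 * pi)); first by rewrite /= in_itv /= k0 ltW.
  by rewrite (per_int yT) (E_per H).
apply: continuous_compact; last exact: segment_compact.
by apply: continuous_subspaceT => th; exact: curve_cont.
Qed.

Lemma E_neq0 th (u : R) : E th u <> (0, 0).
Proof.
move=> [h1 h2]; have r0 := rad_gt0 n psi th u.
have := cos2Dsin2 th; move/eqP: h1; move/eqP: h2.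
rewrite !mulf_eq0 !(gt_eqF r0) /= => /eqP -> /eqP ->.
by rewrite expr0n /= addr0 => /eqP; rewrite eq_sym oner_eq0.
Qed.

Lemma polar_point q : q <> (0, 0) -> exists th u, 0 < e * u /\ q = E th u.
Proof.
move=> q0; have [h0|h0] := eqVneq (q.1 ^+ 2 + q.2 ^+ 2) 0.
  move/eqP: h0; rewrite paddr_eq0 ?sqr_ge0// !sqrf_eq0 => /andP[/eqP h1 /eqP h2].
  by case: q0; rewrite (surjective_pairing q) h1 h2.
have [r [th [r0 h1 h2]]] := polar_ex h0.
have rn : 0 < r ^+ n by rewrite exprn_gt0.
have hr : psi th * (psi th * r ^+ n)^-1 * r ^+ n = 1.
  by field; rewrite (psi_neq0 H) lt0r_neq0.
exists th, (psi th * r ^+ n)^-1; split.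
  rewrite -(psiu_gt0 H th); have : 0 < psi th * (psi th * r ^+ n)^-1 * r ^+ n by rewrite hr.
  by rewrite pmulr_lgt0.
by rewrite /E (rad_unique H r0 hr) (surjective_pairing q) h1 h2.
Qed.

(** The curve is star-shaped about the origin, which replaces the Jordan curve theorem. With F the
    radius of the curve in the direction of a point, the sets below and above F are open, disjoint,
    and cover the complement of the curve; the component of the origin stays below F, hence is
    bounded. *)
Lemma graph_surrounds (y : R -> R) : (forall th, 0 < e * y th) -> continuous y ->
  (forall th, y (th + 2 * pi) = y th) ->
  surrounds (range (fun th => E th (y th))) 0.
Proof.
move=> hy yc yT; set g := range _; pose rho th := rad n psi th (y th).
have pi0 : 0 < 2 * pi :> R by rewrite mulr_gt0 ?pi_gt0.
have rho0 th : 0 < rho th by exact: rad_gt0.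
have rhoc : continuous rho by exact: rad_cont.
have rhoT th : rho (th + 2 * pi) = rho th.
  by rewrite /rho yT /rad (ps_psiT H).
have [F [FE Fc]] := angular_function rhoc rhoT.
have [M M0 hM] := per_bounded pi0 rhoc rhoT.
have [m m0 hm] := per_lbound pi0 rhoc rhoT (fun th => lt0r_neq0 (rho0 th)).
pose nr q := Num.sqrt (q.1 ^+ 2 + q.2 ^+ 2).
have nrE r th : 0 < r -> nr (r * cos th, r * sin th) = r.
  move=> r0; rewrite /nr /= !exprMn -mulrDr cos2Dsin2 mulr1 sqrtr_sqr gtr0_norm//.
have nrc q : nr p @[p --> q] --> nr q.
  have h : p.1 ^+ 2 + p.2 ^+ 2 @[p --> q] --> q.1 ^+ 2 + q.2 ^+ 2.
    apply: cvgD; rewrite !expr2; apply: cvgM; by [exact: cvg_fst|exact: cvg_snd].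
  by apply: (cvg_comp_cont h); exact: sqrt_continuous.
have pol q : q <> (0, 0) -> exists r th, 0 < r /\ q = (r * cos th, r * sin th).
  by move=> /polar_point[th [u [_ ->]]]; exists (rad n psi th u), th; split => //; exact: rad_gt0.
have g_not0 : ~ g (0, 0) by move=> [th _] /E_neq0.
have gP q : q <> (0, 0) -> nr q = F q -> g q.
  move=> /pol[r [th [r0 ->]]]; rewrite nrE// FE// => ->.
  by exists th.
have gQ q : g q -> nr q = F q.
  by move=> [th _ <-]; rewrite nrE ?rad_gt0// FE ?rad_gt0.
pose inside := [set q | q = (0, 0) \/ nr q < F q].
pose outside := [set q | q <> (0, 0) /\ F q < nr q].
have near_ne0 q : q <> (0, 0) -> \forall p \near q, p <> (0, 0).
  move=> q0; have q1 : 0 < nr q by have [r [th [r0 ->]]] := pol _ q0; rewrite nrE.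
  near=> p => p0; have : 0 < nr p by near: p; exact: (cvgr_gt _ (nrc q)).
  by rewrite p0 /nr /= expr0n /= addr0 sqrtr0 ltxx.
(* F need not be continuous at the origin; there the positive lower bound [m] of the radius of the
   curve is used. *)
have oin : open inside.
  rewrite openE => q; have [->|q0] := pselect (q = (0, 0)).
    move=> _; near=> p; have [->|p0] := pselect (p = (0, 0)); first by left.
    right; apply: (@lt_le_trans _ _ m).
      near: p; apply: (cvgr_lt _ (nrc _)); by rewrite /nr /= expr0n /= addr0 sqrtr0.
    have [r [th [r0 ->]]] := pol _ p0; rewrite FE//.
    by have := hm th; rewrite gtr0_norm.
  move=> [//|hq]; near=> p; right; rewrite -subr_lt0.
  near: p; apply: (cvgr_lt _ (cvgB (nrc q) (Fc _ q0))); by rewrite subr_lt0.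
have oout : open outside.
  rewrite openE => q [q0 hq]; near=> p; split; first by near: p; exact: near_ne0.
  rewrite -subr_gt0.
  near: p; apply: (cvgr_gt _ (cvgB (nrc q) (Fc _ q0))); by rewrite subr_gt0.
split=> //.
pose K := connected_component (~` g) (0, 0).
have Kin : K `<=` inside.
  have Kc : connected K by exact: component_connected.
  have K0 : K (0, 0) by apply: connected_component_refl; exact: g_not0.
  have Kg : K `<=` ~` g by exact: connected_component_sub.
  have dec q : (~` g) q -> inside q \/ outside q.
    move=> ng; have [->|q0] := pselect (q = (0, 0)); first by left; left.
    have [h|h|h] := ltgtP (nr q) (F q); [by left; right|by right|].
    by case: ng; apply: gP.
  have disj q : inside q -> ~ outside q.
    by move=> [->|h] [h1 h2] //; move: (lt_trans h h2); rewrite ltxx.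
  have <- : K `&` inside = K; last by move=> q [].
  apply: Kc.
  - by exists (0, 0); split => //; left.
  - by exists inside.
  - exists (~` outside); first exact: open_closedC.
    apply/seteqP; split => q [Kq h]; split => //; first exact: disj.
    by have [] := dec q (Kg _ Kq).
exists M; split; first exact: num_real.
move=> N MN q /Kin hq.
have nM : nr q <= M.
  case: hq => [->|]; first by rewrite /nr /= expr0n /= addr0 sqrtr0 ltW.
  have [->|/pol[r [th [r0 ->]]]] := pselect (q = (0, 0)).
    by move=> _; rewrite /nr /= expr0n /= addr0 sqrtr0 ltW.
  by rewrite FE// => /ltW/le_trans -> //; apply: le_trans (hM th); exact: ler_norm.
have c1 x y0 : `|x| <= Num.sqrt (x ^+ 2 + y0 ^+ 2).
  by rewrite -sqrtr_sqr ler_wsqrtr// lerDl sqr_ge0.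
rewrite /= prod_normE ge_max; apply/andP; split.
  by apply: le_trans (c1 _ q.2) _; apply: le_trans nM _; exact: ltW.
by apply: le_trans (c1 _ q.1) _; rewrite addrC; apply: le_trans nM _; exact: ltW.
Unshelve. all: by end_near. Qed.

(** Translates closeness to the curve in the plane into closeness of u to y at the same angle. *)
Lemma tube_graph (y : R -> R) : (forall th, 0 < e * y th) -> continuous y ->
  (forall th, y (th + 2 * pi) = y th) -> forall eta : R, 0 < eta ->
  exists2 d : R, 0 < d & forall q, tube (range (fun th => E th (y th))) d q ->
    exists th u, [/\ q = E th u, 0 < e * u & `|u - y th| < eta].
Proof.
move=> hy yc yT eta eta0.
have psic : continuous psi by move=> th; exact: isd_cont (ps_dpsi H th).
have [Fp [FpE Fpc]] := angular_function psic (ps_psiT H).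
have [Fy [FyE Fyc]] := angular_function yc yT.
pose nr q := Num.sqrt (q.1 ^+ 2 + q.2 ^+ 2).
have nrE r th : 0 < r -> nr (r * cos th, r * sin th) = r.
  move=> r0; rewrite /nr /= !exprMn -mulrDr cos2Dsin2 mulr1 sqrtr_sqr gtr0_norm//.
have nrc q : nr p @[p --> q] --> nr q.
  have h : p.1 ^+ 2 + p.2 ^+ 2 @[p --> q] --> q.1 ^+ 2 + q.2 ^+ 2.
    apply: cvgD; rewrite !expr2; apply: cvgM; by [exact: cvg_fst|exact: cvg_snd].
  by apply: (cvg_comp_cont h); exact: sqrt_continuous.
(* The deviation u - y as a function on the punctured plane: it is continuous and vanishes on the
   curve, so the points where it is below [eta] form a neighbourhood that contains a tube. *)
pose Phi q := (Fp q * nr q ^+ n)^-1 - Fy q.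
have PhiE th u : 0 < e * u -> Phi (E th u) = u - y th.
  move=> eu; rewrite /Phi /E FpE ?rad_gt0// FyE ?rad_gt0// nrE ?rad_gt0//; congr (_ - _).
  have h := radX H th eu; have r0 := rad_gt0 n psi th u.
  have rn : rad n psi th u ^+ n != 0 by rewrite expf_neq0// lt0r_neq0.
  apply: (mulIf (psi_neq0 H th)); apply: (mulIf rn).
  by rewrite -mulrA mulVf ?mulf_neq0 ?(psi_neq0 H)// -h; ring.
have nz q : q <> (0, 0) -> Fp q * nr q ^+ n != 0.
  move=> /polar_point[th [u [eu ->]]].
  rewrite /E FpE ?rad_gt0// nrE ?rad_gt0// mulf_neq0 ?(psi_neq0 H)//.
  by rewrite expf_neq0// lt0r_neq0// rad_gt0.
have Phic q : q <> (0, 0) -> Phi p @[p --> q] --> Phi q.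
  move=> q0; apply: cvgB; last exact: Fyc.
  apply: cvgV; first exact: nz.
  apply: cvgM; first exact: Fpc.
  by apply: (cvg_comp_cont (h := fun t => t ^+ n) (nrc q)); exact: exprn_continuous.
pose O := [set q | q <> (0, 0) /\ `|Phi q| < eta].
have near_ne0 q : q <> (0, 0) -> \forall p \near q, p <> (0, 0).
  move=> q0; have q1 : 0 < nr q.
    by have [th [u [_ ->]]] := polar_point q0; rewrite nrE// rad_gt0.
  near=> p => p0; have : 0 < nr p by near: p; exact: (cvgr_gt _ (nrc q)).
  by rewrite p0 /nr /= expr0n /= addr0 sqrtr0 ltxx.
have Oo : open O.
  rewrite openE => q [q0 hq]; near=> p; split; first by near: p; exact: near_ne0.
  near: p; apply: (cvgr_lt `|Phi q|) => //.
  by apply: (cvg_comp_cont (h := fun t => `|t|) (Phic q q0)); exact: norm_continuous.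
have [|d d0 hd] := tube_sub (curve_compact hy yc yT) Oo.
  move=> _ [th _ <-]; split; first exact: E_neq0.
  by rewrite PhiE// subrr normr0.
exists d => // q /hd[/polar_point[th [u [eu ->]]]]; rewrite PhiE// => h.
by exists th, u.
Unshelve. all: by end_near. Qed.

End Surround.

(** * Trajectories near a periodic orbit *)

Section Clip.
Variable R : realType.
Implicit Types (eta x y : R).

Definition clip eta x : R := Num.max (- eta) (Num.min eta x).

Lemma clip_le eta x : 0 < eta -> `|clip eta x| <= eta.
Proof.
move=> e0; rewrite /clip ler_norml le_max lexx /= ge_max ge_min lexx /= andbT.
by lra.
Qed.

Lemma clip_id eta x : `|x| <= eta -> clip eta x = x.
Proof. by rewrite ler_norml /clip => /andP[h1 h2]; rewrite min_r// max_r. Qed.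

Lemma clip_cases eta x : 0 < eta ->
  x <= - eta /\ clip eta x = - eta \/ - eta <= x <= eta /\ clip eta x = x \/
  eta <= x /\ clip eta x = eta.
Proof.
move=> e0; rewrite /clip; have [h|h] := leP eta x.
  by right; right; rewrite max_r//; lra.
have [h'|h'] := leP (- eta) x; first by right; left; rewrite (ltW h).
by left; split => //; exact: ltW.
Qed.

Lemma clip_lip eta x y : 0 < eta -> `|clip eta x - clip eta y| <= `|x - y|.
Proof.
wlog xy : x y / y <= x.
  by move=> wl e0; have [/wl|/ltW/wl] := leP y x; [exact|rewrite distrC [leRHS]distrC; exact].
move=> e0; rewrite (ger0_norm (_ : 0 <= x - y)) ?subr_ge0// ler_norml.
by apply/andP; split; case: (clip_cases x e0) => [[h1 ->]|[[h1 ->]|[h1 ->]]];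
  case: (clip_cases y e0) => [[h2 ->]|[[h2 ->]|[h2 ->]]]; lra.
Qed.

End Clip.

Section Near.
Variables (R : realType) (n : nat) (a e s : R) (phi psi dpsi : R -> R).
Variable X : R * R -> R * R.
Hypothesis H : polar_system n a e s phi psi dpsi X.
Variables (kap : R) (y0 : R -> R) (eta B : R).
Notation Sf := (lin_coef n a psi dpsi).
Notation Df := (cst_coef n phi psi dpsi).
Notation E := (polar_pt n psi).
Notation region := (region_of e kap).
Notation Lf := (first_integral e).
Notation graph_field := (scalar_field n a phi psi dpsi).
Hypothesis kap1 : kap = 1 \/ kap = -1.
Hypothesis y0gs : graph_solution n a e phi psi dpsi kap y0.
Hypothesis y0T : forall th : R, y0 (th + 2 * pi) = y0 th.
Hypothesis eta0 : 0 < eta.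
Hypothesis y0eta : forall th : R, 2 * eta <= `|y0 th| /\ 2 * eta <= `|1 + y0 th|.
Hypothesis y0B : forall th : R, `|y0 th| + eta + 1 <= B.
Implicit Types (t th u v w x eps tau : R).

Lemma y0_cont : continuous y0.
Proof. by move=> th; exact: isd_cont (y0gs th).2. Qed.

Lemma near_region th v : `|v - y0 th| <= eta ->
  [/\ region v, eta <= e * v, eta <= kap * (1 + v), `|v| <= B & `|1 + v| <= B].
Proof.
move=> hv; have [h1 h2] := y0eta th; have [[h3 h4] _] := y0gs th.
have h5 : e * y0 th = `|y0 th|.
  by rewrite -(gtr0_norm h3) normrM; case: (ps_e H) => ->; rewrite ?normrN normr1 mul1r.
have h6 : kap * (1 + y0 th) = `|1 + y0 th|.
  by rewrite -(gtr0_norm h4) normrM; case: kap1 => ->; rewrite ?normrN normr1 mul1r.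
have h7 : eta <= e * v.
  have -> : e * v = e * y0 th + e * (v - y0 th) by ring.
  rewrite h5; move: hv; rewrite ler_norml => /andP[].
  by case: (ps_e H) => ->; lra.
have h8 : eta <= kap * (1 + v).
  have -> : kap * (1 + v) = kap * (1 + y0 th) + kap * (v - y0 th) by ring.
  rewrite h6; move: hv; rewrite ler_norml => /andP[].
  by case: kap1 => ->; lra.
have h9 : `|v| <= `|y0 th| + eta.
  by rewrite -[v](subrK (y0 th)) addrC; apply: le_trans (ler_normD _ _) _; lra.
have h10 := y0B th; split => //; try lra.
  by split; apply: lt_le_trans eta0 _.
by apply: le_trans (ler_normD _ _) _; rewrite normr1; lra.
Qed.

(** Projection of u to the band of half-width [eta] around the cycle, which avoids the singular
    levels 0 and -1. Composed with it, [scalar_field] is bounded and globally Lipschitz, and it is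
    unchanged inside the band. *)
Definition cl th u : R := y0 th + clip eta (u - y0 th).

Lemma cl_near th u : `|cl th u - y0 th| <= eta.
Proof. by rewrite /cl addrAC subrr add0r clip_le. Qed.

Lemma cl_id th u : `|u - y0 th| <= eta -> cl th u = u.
Proof. by move=> h; rewrite /cl clip_id// addrC subrK. Qed.

Lemma cl_lip th u v : `|cl th u - cl th v| <= `|u - v|.
Proof.
rewrite /cl opprD addrACA subrr add0r; apply: le_trans (clip_lip _ _ eta0) _.
by rewrite opprB addrA subrK.
Qed.

Lemma clip_cont : continuous (clip eta).
Proof. by apply: (@lip_cont _ _ 1) => x y; rewrite mul1r; exact: clip_lip. Qed.

Lemma cl_cont (y : R -> R) : continuous y -> continuous (fun th => cl th (y th)).
Proof.
move=> yc th; apply: cvgD; first exact: y0_cont.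
apply: (cvg_comp_cont (h := clip eta) (l := y th - y0 th)); last exact: clip_cont.
by apply: cvgB; [exact: yc|exact: y0_cont].
Qed.

Lemma near_neq0 th v : `|v - y0 th| <= eta -> v != 0 /\ 1 + v != 0.
Proof. by move=> /near_region[hr _ _ _ _]; exact: region_neq0 hr. Qed.

Lemma near_inv th v w : `|v - y0 th| <= eta -> `|w - y0 th| <= eta ->
  `|(1 + v)^-1 - (1 + w)^-1| <= `|v - w| / eta ^+ 2.
Proof.
move=> hv hw; have [_ _ h1 _ _] := near_region hv; have [_ _ h2 _ _] := near_region hw.
have [_ v1] := near_neq0 hv; have [_ w1] := near_neq0 hw.
have -> : (1 + v)^-1 - (1 + w)^-1 = (w - v) / ((1 + v) * (1 + w)).
  by field; rewrite v1 w1.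
rewrite normrM distrC ler_wpM2l// normfV lef_pV2 ?posrE ?exprn_gt0 ?normr_gt0 ?mulf_neq0//.
have hk x : eta <= kap * x -> eta <= `|x|.
  move=> h; apply: le_trans h _; apply: le_trans (ler_norm _) _.
  by rewrite normrM; case: kap1 => ->; rewrite ?normrN normr1 mul1r.
by rewrite normrM expr2 ler_pM ?hk// ltW.
Qed.

(** Confines the nonlinearity to 1/(1 + v). Both the Lipschitz bound and the exact remainder in the
    linearisation along the cycle are read off from this form. *)
Lemma field_split th v : 1 + v != 0 ->
  graph_field th v = - Sf th * v + (Sf th - Df th) * (1 - (1 + v)^-1).
Proof. by move=> v1; rewrite /scalar_field; field. Qed.

Lemma field_lip : exists2 K : R, 0 <= K & forall th v w,
  `|v - y0 th| <= eta -> `|w - y0 th| <= eta ->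
  `|graph_field th v - graph_field th w| <= K * `|v - w|.
Proof.
have pi0 : 0 < 2 * pi :> R by rewrite mulr_gt0 ?pi_gt0.
have [BS BS0 hS] := per_bounded pi0 (Sf_cont H) (Sf_per H).
have [BD BD0 hD] := per_bounded pi0 (Df_cont H) (Df_per H).
exists (BS + (BS + BD) / eta ^+ 2).
  by rewrite addr_ge0 ?(ltW BS0)// divr_ge0 ?exprn_ge0 ?(ltW eta0)//; lra.
move=> th v w hv hw; have [_ v1] := near_neq0 hv; have [_ w1] := near_neq0 hw.
rewrite !field_split//.
have -> : - Sf th * v + (Sf th - Df th) * (1 - (1 + v)^-1) -
    (- Sf th * w + (Sf th - Df th) * (1 - (1 + w)^-1)) =
  - (Sf th * (v - w)) - (Sf th - Df th) * ((1 + v)^-1 - (1 + w)^-1) by ring.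
apply: le_trans (ler_normB _ _) _; rewrite normrN !normrM mulrDl lerD ?ler_wpM2r//.
apply: (@le_trans _ _ ((BS + BD) * (`|v - w| / eta ^+ 2))); last first.
  by rewrite mulrAC mulrA.
apply: ler_pM => //; last exact: near_inv hv hw.
by apply: le_trans (ler_normB _ _) _; rewrite lerD.
Qed.

(** The solution of the clipped equation is a true one wherever it lies in the band. As [y0] solves
    the clipped equation too, Gronwall's inequality bounds the deviation for every starting
    point. *)
Lemma near_flow : exists2 K : R, 0 <= K & forall th1 u1, exists y : R -> R,
  [/\ y th1 = u1, continuous y,
      forall th, `|y th - y0 th| <= eta -> is_derive th 1 y (graph_field th (y th))
    & forall th, `|y th - y0 th| <= `|u1 - y0 th1| * expR (K * `|th - th1|)].
Proof.
have pi0 : 0 < 2 * pi :> R by rewrite mulr_gt0 ?pi_gt0.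
have [BS BS0 hS] := per_bounded pi0 (Sf_cont H) (Sf_per H).
have [BD BD0 hD] := per_bounded pi0 (Df_cont H) (Df_per H).
have [K K0 hK] := field_lip; exists K => // th1 u1.
pose F th u := graph_field th (cl th u).
have Fc (y : R -> R) : continuous y -> continuous (fun th => F th (y th)).
  move=> /cl_cont cc th; rewrite /F /scalar_field.
  have [_ c1] := near_neq0 (cl_near th (y th)).
  apply: cvgM.
    apply: cvgN; apply: cvgD; last exact: (Df_cont H).
    by apply: cvgM; [exact: (Sf_cont H)|exact: cc].
  apply: cvgM; first exact: cc.
  by apply: cvgV => //; apply: cvgD; [exact: cvg_cst|exact: cc].
have B0 : 0 <= B by apply: le_trans (y0B 0); rewrite addr_ge0 ?addr_ge0 ?(ltW eta0).
have FB th u : `|F th u| <= (BS * B + BD) * (B / eta).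
  have hc := cl_near th u; have [_ _ h1 h2 _] := near_region hc.
  have [c0 c1] := near_neq0 hc.
  rewrite /F /scalar_field normrM normrN; apply: ler_pM => //.
    by apply: le_trans (ler_normD _ _) _; rewrite normrM lerD// ler_pM.
  rewrite normrM ler_pM// normfV lef_pV2 ?posrE ?normr_gt0//.
  apply: le_trans h1 _; apply: le_trans (ler_norm _) _.
  by rewrite normrM; case: kap1 => ->; rewrite ?normrN normr1 mul1r.
have FK th u v : `|F th u - F th v| <= K * `|u - v|.
  apply: le_trans (hK _ _ _ (cl_near _ _) (cl_near _ _)) _.
  by rewrite ler_wpM2l// cl_lip.
have [y yth1 yd] := picard_lindelof Fc FB FK th1 u1.
have y0d th : is_derive th 1 y0 (F th (y0 th)).
  by rewrite /F cl_id ?subrr ?normr0 ?(ltW eta0)//; exact: (y0gs th).2.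
exists y; split => //.
- by move=> th; exact: isd_cont (yd th).
- by move=> th hth; have := yd th; rewrite /F cl_id.
move=> th.
have hd x : is_derive x 1 (fun x => y x - y0 x) (F x (y x) - F x (y0 x)).
  exact: isd_add (yd x) (isd_opp (y0d x)).
rewrite -yth1; have [tt|/ltW tt] := leP th1 th.
  have [+ _] := gronwall tt (fun x _ => hd x) (fun x _ => FK x (y x) (y0 x)).
  by rewrite (ger0_norm (_ : 0 <= th - th1)) ?subr_ge0.
have [_ +] := gronwall tt (fun x _ => hd x) (fun x _ => FK x (y x) (y0 x)).
by rewrite (distrC th) (ger0_norm (_ : 0 <= th1 - th)) ?subr_ge0.
Qed.

(* [Th] is the angle as a function of time, and [T] its inverse. *)
Lemma near_time tau (y : R -> R) th1 : tau = 1 \/ tau = -1 -> continuous y ->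
  exists Th T : R -> R, [/\ Th 0 = th1, cancel Th T, cancel T Th,
    forall t1 t2, t1 < t2 -> 0 < tau * (e * kap) * (Th t2 - Th t1)
    & forall t, is_derive t 1 Th (tau * (1 + (cl (Th t) (y (Th t)))^-1))].
Proof.
move=> tau1 yc; have B0 : 0 < B.
  by apply: lt_le_trans (y0B 0); rewrite ltr_wpDl// addr_ge0 ?(ltW eta0).
pose c th := cl th (y th); have cc : continuous c by exact: cl_cont.
have c01 th := near_neq0 (cl_near th (y th)).
have fc : continuous (fun th => tau * (c th / (1 + c th))).
  move=> th; apply: cvgM; first exact: cvg_cst.
  apply: cvgM; first exact: cc.
  by apply: cvgV; [exact: (c01 th).2|apply: cvgD; [exact: cvg_cst|exact: cc]].
have [T0 dT0] := primitive fc.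
pose T th := T0 th - T0 th1.
have dT th : is_derive th 1 T (tau * (c th / (1 + c th))).
  by rewrite /T; have := dT0 th => ?; der; ring.
have ek : e * kap = 1 \/ e * kap = -1.
  by case: (ps_e H) => ->; case: kap1 => ->; rewrite ?mul1r ?mulrN ?mulr1 ?mulNr ?opprK ?mulr1; by [left|right].
have tek : tau * (e * kap) = 1 \/ tau * (e * kap) = -1.
  by case: tau1 => ->; case: ek => ->; rewrite ?mulN1r ?mul1r ?opprK; by [left|right].
(* The derivative of time with respect to the angle is u/(1 + u), of modulus at least [eta / B] in
   the band; this makes time invertible. *)
have low th : eta / B <= tau * (e * kap) * (tau * (c th / (1 + c th))).
  rewrite mulrACA (sqr_sign tau1) mul1r.
  have [_ h1 h2 _ h3] := near_region (cl_near th (y th)); rewrite -/(c th) in h1 h2 h3.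
  have [_ n1] := c01 th; rewrite -/(c th) in n1.
  have kn : kap * (1 + c th) = `|1 + c th|.
    rewrite -(@ger0_norm _ (kap * _)); last by apply: le_trans h2; exact: ltW.
    by rewrite normrM; case: kap1 => ->; rewrite ?normrN normr1 mul1r.
  have -> : e * kap * (c th / (1 + c th)) = (e * c th) / (kap * (1 + c th)).
    have kk := sqr_sign kap1.
    have k0 : kap != 0 by apply: contra_eq_neq kk => ->; rewrite mul0r eq_sym oner_neq0.
    transitivity ((e * c th) / (kap * (1 + c th)) * (kap * kap)); first by field; rewrite n1 k0.
    by rewrite kk mulr1.
  rewrite kn ler_pM ?(ltW eta0) ?invr_ge0 ?(ltW B0)//.
  by rewrite lef_pV2 ?posrE ?normr_gt0.
have [|Th [TK ThK dTh]] := inverse_fun tek dT _ low; first by rewrite divr_gt0.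
have Th0 : Th 0 = th1 by rewrite -(TK th1) /T subrr.
have dTh' t : is_derive t 1 Th (tau * (1 + (cl (Th t) (y (Th t)))^-1)).
  apply: isd_eq (dTh t) _; have [h1 h2] := c01 (Th t); rewrite /c.
  by case: tau1 => ->; field; rewrite h1 h2 ?oppr_eq0 ?oner_neq0.
exists Th, T; split => // t1 t2 t12.
rewrite mulrBr subr_gt0.
apply: (@isd_gt0_lt _ (fun t => tau * (e * kap) * Th t)
  (fun t => tau * (e * kap) * (tau * (1 + (cl (Th t) (y (Th t)))^-1)))) => // t _.
rewrite mulrACA (sqr_sign tau1) mul1r.
have [_ h1 h2 _ h3] := near_region (cl_near (Th t) (y (Th t))).
have [n0 n1] := c01 (Th t); set v := cl _ _ in h1 h2 h3 n0 n1 *.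
have -> : e * kap * (1 + v^-1) = (e * v) * (kap * (1 + v)) / v ^+ 2 by field.
apply: divr_gt0; last exact: sqr_pos.
by apply: mulr_gt0; [exact: lt_le_trans h1|exact: lt_le_trans h2].
Qed.

Lemma near_solution tau (y Th : R -> R) t :
  `|y (Th t) - y0 (Th t)| <= eta ->
  is_derive (Th t) 1 y (graph_field (Th t) (y (Th t))) ->
  is_derive t 1 Th (tau * (1 + (cl (Th t) (y (Th t)))^-1)) ->
  polar_flow n a phi psi dpsi tau (fun x => y (Th x)) Th t.
Proof.
move=> hn yd; rewrite cl_id// => dTh; split => //.
have [n0 n1] := near_neq0 hn.
apply: isd_eq (isd_comp yd dTh) _.
by rewrite /scalar_field; field; rewrite n0 n1.
Qed.

Lemma near_Lf th v : `|v - y0 th| <= eta ->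
  eta / B * `|v - y0 th| <= `|Lf v - Lf (y0 th)| <= B / eta * `|v - y0 th|.
Proof.
move=> hv; have B0 : 0 < B.
  by apply: lt_le_trans (y0B 0); rewrite ltr_wpDl// addr_ge0 ?(ltW eta0).
have [->|vy] := eqVneq v (y0 th); first by rewrite !subrr normr0 !mulr0 lexx.
have h0 : `|y0 th - y0 th| <= eta by rewrite subrr normr0 ltW.
have [w [hw ->]] : exists w, `|w - y0 th| <= eta /\
    Lf v - Lf (y0 th) = (1 + w^-1) * (v - y0 th).
  have [hr _ _ _ _] := near_region hv; have [hr0 _ _ _ _] := near_region h0.
  move: hv; rewrite ler_norml => /andP[hv1 hv2].
  have [vy'|vy'|vy'] := ltgtP v (y0 th); last by rewrite vy' eqxx in vy.
    have [x hx|w /andP[w1 w2] ew] := @mean_value _ Lf (fun w => 1 + w^-1) _ _ vy'.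
      by apply: (Lf_der H); have [] := region_convex H hr hr0 hx.
    exists w; split; first by rewrite ler_norml; lra.
    by rewrite -opprB ew; ring.
  have [x hx|w /andP[w1 w2] ew] := @mean_value _ Lf (fun w => 1 + w^-1) _ _ vy'.
    by apply: (Lf_der H); have [] := region_convex H hr0 hr hx.
  by exists w; split; first by rewrite ler_norml; lra.
have [_ h1 h2 h3 h4] := near_region hw; have [w0 w1] := near_neq0 hw.
have -> : 1 + w^-1 = (1 + w) / w by field.
have ew : eta <= `|w|.
  apply: le_trans h1 _; apply: le_trans (ler_norm _) _.
  by rewrite normrM; case: (ps_e H) => ->; rewrite ?normrN normr1 mul1r.
have kw : eta <= `|1 + w|.
  apply: le_trans h2 _; apply: le_trans (ler_norm _) _.
  by rewrite normrM; case: kap1 => ->; rewrite ?normrN normr1 mul1r.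
rewrite normrM (normrM (1 + w)) normfV; apply/andP; split; apply: ler_wpM2r => //;
  apply: ler_pM; rewrite ?invr_ge0 ?(ltW eta0) ?(ltW B0)//.
  by rewrite lef_pV2 ?posrE ?normr_gt0.
by rewrite lef_pV2 ?posrE ?normr_gt0.
Qed.

(** At a fixed angle the ratio of the radii is (v / y0)^(-1/n). It depends on the quotient alone, so
    continuity at 1 gives a bound uniform in the angle. *)
Lemma near_point eps : 0 < eps -> exists2 r : R, 0 < r <= eta &
  forall th v, `|v - y0 th| < r -> ball (E th (y0 th)) eps (E th v).
Proof.
move=> eps0; have pi0 : 0 < 2 * pi :> R by rewrite mulr_gt0 ?pi_gt0.
have ey0 th : 0 < e * y0 th by exact: (y0gs th).1.1.
have [M M0 hM] : exists2 M : R, 0 < M & forall th, `|rad n psi th (y0 th)| <= M.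
  apply: (per_bounded pi0 (rad_cont H ey0 y0_cont)).
  by move=> th; rewrite /rad y0T (ps_psiT H).
have kc : expR (- (ln x / n%:R)) @[x --> (1 : R)] --> expR (- (ln (1 : R) / n%:R)).
  apply: (isd_cont (f := fun x => expR (- (ln x / n%:R)))).
  exact: (isd_exp (isd_opp (isd_mul (isd_ln (f := fun x => x) ltr01 (isd_id 1)) (isd_cst _ _)))).
rewrite ln1 mul0r oppr0 expR0 in kc.
have [d d0 hd] := (eps_delta _ _ _).1 kc _ (divr_gt0 eps0 M0).
have ed0 : 0 < Num.min eta (d * eta) by rewrite lt_min eta0 mulr_gt0.
exists (Num.min eta (d * eta)); first by rewrite ed0 ge_min lexx.
move=> th v; rewrite lt_min => /andP[v1 v2].
have [[ev _] _ _ _ _] := near_region (ltW v1).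
have y00 : y0 th != 0 by have [] := near_neq0 (_ : `|y0 th - y0 th| <= eta); rewrite ?subrr ?normr0 ?ltW.
have q0 : 0 < v / y0 th.
  have -> : v / y0 th = (e * v) * (e * y0 th) / (e * y0 th) ^+ 2.
    by field; rewrite y00 (e_neq0 H).
  by apply: divr_gt0; [exact: mulr_gt0|rewrite exprn_gt0].
have q1 : `|v / y0 th - 1| < d.
  have -> : v / y0 th - 1 = (v - y0 th) / y0 th by field.
  rewrite normrM normfV ltr_pdivrMr ?normr_gt0//; apply: lt_le_trans v2 _.
  apply: ler_wpM2l; first exact: ltW.
  by apply: le_trans (y0eta th).1; rewrite ler_peMl ?ler1n ?(ltW eta0).
have rE : rad n psi th v = rad n psi th (y0 th) * expR (- (ln (v / y0 th) / n%:R)).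
  rewrite /rad -expRD; congr expR.
  have -> : psi th * v = (psi th * y0 th) * (v / y0 th) by field.
  rewrite lnM ?posrE ?(psiu_gt0 H)//; by field; exact: n_neq0 H.
have dr : `|rad n psi th (y0 th) - rad n psi th v| < eps.
  rewrite rE -[X in X - _]mulr1 -mulrBr normrM distrC.
  apply: (@le_lt_trans _ _ (M * `|expR (- (ln (v / y0 th) / n%:R)) - 1|)).
    by rewrite ler_wpM2r.
  by have := hd _ q1; rewrite ltr_pdivlMr// mulrC.
split; rewrite /ball /= -mulrBl normrM.
  by apply: le_lt_trans dr; rewrite ler_piMr// cos_max.
by apply: le_lt_trans dr; rewrite ler_piMr// sin_max.
Qed.

Lemma near_attraction tau : tau = 1 \/ tau = -1 -> 0 < tau * s ->
  exists2 c : R, 0 < c & forall (u Th : R -> R) t,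
    (forall x, 0 <= x <= t -> `|u x - y0 (Th x)| <= eta) -> 0 <= t ->
    (forall x, 0 <= x <= t -> polar_flow n a phi psi dpsi tau u Th x) ->
    `|Lf (u t) - Lf (y0 (Th t))| <= `|Lf (u 0) - Lf (y0 (Th 0))| * expR (- (c * t)).
Proof.
move=> tau1 ts; have pi0 : 0 < 2 * pi :> R by rewrite mulr_gt0 ?pi_gt0.
have B0 : 0 < B.
  by apply: lt_le_trans (y0B 0); rewrite ltr_wpDl// addr_ge0 ?(ltW eta0).
have S0 th : Sf th != 0 by apply: contraTneq (ps_S H th) => h; rewrite -/(Sf th) h mulr0 ltxx.
have [m m0 hm] := per_lbound pi0 (Sf_cont H) (Sf_per H) S0.
(* [m] bounds S from below in modulus; one factor [eta / B] bounds the angular velocity, the other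
   compares u - y0 with the difference of the values of L. *)
pose c := m * (eta / B) * (eta / B); have c0 : 0 < c by rewrite !mulr_gt0 ?invr_gt0.
exists c => // u Th t hn t0 hf.
pose W x := Lf (u x) - Lf (y0 (Th x)).
pose dW x := - (tau * Sf (Th x)) * (u x - y0 (Th x)) * (1 + (u x)^-1).
have Wd x : 0 <= x <= t -> is_derive x 1 W (dW x).
  move=> hx; have [dTh du] := hf x hx; have hnx := hn x hx.
  have [[eu _] _ _ _ _] := near_region hnx; have [u0 u1] := near_neq0 hnx.
  have d1 := isd_comp (f := Lf) (Lf_der H eu) du.
  have d2 := isd_comp (f := fun x => Lf (y0 x)) (Lf_graph H y0gs (Th x)) dTh.
  apply: isd_eq (isd_add d1 (isd_opp d2)) _; rewrite /dW; field; exact: u0.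
have key x : 0 <= x <= t -> W x * dW x <= - c * W x ^+ 2.
  move=> hx; have hnx := hn x hx.
  have [hr h1 h2 h3 h4] := near_region hnx; have [u0 u1] := near_neq0 hnx.
  have [e0|ne] := eqVneq (u x) (y0 (Th x)).
    by rewrite /dW /W e0 !subrr mul0r expr0n /= mulr0.
  have hr0 := (y0gs (Th x)).1.
  have Lm := Lf_mono H hr hr0 ne; rewrite -/(W x) in Lm.
  have [_ Lb] := andP (near_Lf hnx); rewrite -/(W x) in Lb.
  have tS : m <= tau * Sf (Th x).
    have h0 : 0 < tau * Sf (Th x).
      have -> : tau * Sf (Th x) = (tau * s) * (s * Sf (Th x)).
        by rewrite -mulrA (mulrA s s) (sqr_sign (ps_s H)) mul1r.
      by apply: mulr_gt0 => //; exact: (ps_S H).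
    rewrite -(gtr0_norm h0) normrM; case: tau1 => ->; rewrite ?normrN normr1 mul1r; exact: hm.
  have ek1 : eta / B <= e * kap * (1 + (u x)^-1).
    have ee := sqr_sign (ps_e H).
    have -> : e * kap * (1 + (u x)^-1) = (kap * (1 + u x)) / (e * u x).
      transitivity (kap * (1 + u x) / (e * u x) * (e * e)); last by rewrite ee mulr1.
      by field; rewrite u0 (e_neq0 H).
    have eu : 0 < e * u x by exact: lt_le_trans h1.
    apply: ler_pM; rewrite ?invr_ge0 ?(ltW eta0) ?(ltW B0)//.
    rewrite lef_pV2 ?posrE//; apply: le_trans (ler_norm _) _.
    by rewrite normrM; case: (ps_e H) => ->; rewrite ?normrN normr1 mul1r.
  have Wu : eta / B * W x ^+ 2 <= e * kap * W x * (u x - y0 (Th x)).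
    rewrite -(gtr0_norm Lm) -[W x ^+ 2]ger0_norm ?sqr_ge0// expr2 !normrM.
    have -> : `|e| = 1 by case: (ps_e H) => ->; rewrite ?normrN normr1.
    have -> : `|kap| = 1 by case: kap1 => ->; rewrite ?normrN normr1.
    rewrite !mul1r mulrCA ler_wpM2l//.
    have -> : `|u x - y0 (Th x)| = eta / B * (B / eta * `|u x - y0 (Th x)|).
      by field; rewrite !lt0r_neq0.
    by rewrite ler_wpM2l// divr_ge0// ltW.
  have ee : (e * kap) * (e * kap) = 1.
    by rewrite mulrACA (sqr_sign (ps_e H)) (sqr_sign kap1) mulr1.
  have -> : W x * dW x = - ((tau * Sf (Th x)) * (e * kap * (1 + (u x)^-1)) *
      (e * kap * W x * (u x - y0 (Th x)))).
    rewrite /dW -[LHS]mulr1 -ee; ring.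
  have eB : 0 <= eta / B by rewrite divr_ge0 ?(ltW eta0) ?(ltW B0).
  rewrite mulNr lerN2 (_ : c * W x ^+ 2 = m * (eta / B) * (eta / B * W x ^+ 2)); last by rewrite /c; ring.
  apply: ler_pM => //.
  - by apply: mulr_ge0 => //; exact: ltW.
  - by apply: mulr_ge0 => //; exact: sqr_ge0.
  - by apply: ler_pM => //; exact: ltW.
have sq : W t ^+ 2 * expR (2 * c * t) <= W 0 ^+ 2 * expR (2 * c * 0).
  rewrite -lerN2.
  apply: (@isd_ge0_le _ (fun x => - (W x ^+ 2 * expR (2 * c * x)))
    (fun x => - (2 * (W x * dW x + c * W x ^+ 2) * expR (2 * c * x)))) => // x hx.
    by have := Wd x hx => ?; der; rewrite /=; ring.
  rewrite -mulNr mulr_ge0 ?expR_ge0//; have := key x hx; lra.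
rewrite -/(W t) -/(W 0) -(@ler_pXn2r _ 2) ?nnegrE ?mulr_ge0 ?expR_ge0//.
rewrite exprMn !real_normK ?num_real//.
rewrite -(@ler_pM2r _ (expR (2 * c * t))) ?expR_gt0//.
apply: le_trans sq _; rewrite mulr0 expR0 mulr1 -[leRHS]mulrA -expRM_natl -expRD.
by rewrite (_ : _ + _ = 0) ?expR0 ?mulr1//; ring.
Qed.

End Near.

(** * Orbital stability of a cycle *)

Section Stability.
Variables (R : realType) (n : nat) (a e s : R) (phi psi dpsi : R -> R).
Variable X : R * R -> R * R.
Hypothesis H : polar_system n a e s phi psi dpsi X.
Variables (kap : R) (y0 : R -> R).
Notation Sf := (lin_coef n a psi dpsi).
Notation Df := (cst_coef n phi psi dpsi).
Notation E := (polar_pt n psi).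
Notation Lf := (first_integral e).
Hypothesis kap1 : kap = 1 \/ kap = -1.
Hypothesis y0gs : graph_solution n a e phi psi dpsi kap y0.
Hypothesis y0T : forall th : R, y0 (th + 2 * pi) = y0 th.
Implicit Types (t th u v w x eps tau : R).

Lemma near_constants : exists eta B : R, [/\ 0 < eta,
  forall th, 2 * eta <= `|y0 th| /\ 2 * eta <= `|1 + y0 th|
  & forall th, `|y0 th| + eta + 1 <= B].
Proof.
have pi0 : 0 < 2 * pi :> R by rewrite mulr_gt0 ?pi_gt0.
have yc : continuous y0 by exact: y0_cont y0gs.
have [B B0 hB] := per_bounded pi0 yc y0T.
have [|m m0 hm] := per_lbound pi0 yc y0T.
  by move=> th; have [] := region_neq0 (y0gs th).1.
have [|||m' m'0 hm'] := @per_lbound _ (fun th => 1 + y0 th) (2 * pi) pi0.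
- by move=> th; apply: cvgD; [exact: cvg_cst|exact: yc].
- by move=> th; rewrite y0T.
- by move=> th; have [] := region_neq0 (y0gs th).1.
have mm : 0 < Num.min m m' by rewrite lt_min m0.
exists (Num.min m m' / 2), (B + Num.min m m' / 2 + 1); split.
- by rewrite divr_gt0.
- move=> th; rewrite mulrC divfK//; split.
    by apply: le_trans (hm th); rewrite ge_min lexx.
  by apply: le_trans (hm' th); rewrite ge_min lexx orbT.
- by move=> th; rewrite !lerD2r.
Qed.

Lemma graph_stable tau : tau = 1 \/ tau = -1 -> 0 < tau * s ->
  stable_cycle (fun q => (tau * (X q).1, tau * (X q).2))
    (range (fun th => E th (y0 th))).
Proof.
move=> tau1 ts; have [eta [B [eta0 y0eta y0B]]] := near_constants.
have yc : continuous y0 by exact: y0_cont y0gs.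
have ey0 th : 0 < e * y0 th by exact: (y0gs th).1.1.
have B0 : 0 < B.
  by apply: lt_le_trans (y0B 0); rewrite ltr_wpDl// addr_ge0 ?(ltW eta0).
have eB : eta <= B by have := y0B 0; have := normr_ge0 (y0 0); lra.
have ep : 0 < eta / B by rewrite divr_gt0.
have [K K0 flow] := near_flow H kap1 y0gs eta0 y0eta y0B.
have [c c0 attr] := near_attraction H kap1 y0gs eta0 y0eta y0B tau1 ts.
have nLf := near_Lf H kap1 y0gs eta0 y0eta y0B.
pose g := range (fun th => E th (y0 th)).
have traj r : 0 < r -> r <= eta -> exists2 d : R, 0 < d & forall q, tube g d q ->
    exists u Th : R -> R, [/\ E (Th 0) (u 0) = q,
      solution (fun q => (tau * (X q).1, tau * (X q).2)) `[0, +oo[ (fun t => E (Th t) (u t)),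
      forall t, 0 <= t -> `|u t - y0 (Th t)| < r
    & forall rho, 0 < rho -> exists t0, forall t, t0 < t -> `|u t - y0 (Th t)| < rho].
  (* Passing from u to L and back costs a factor [B / eta] each way; [r1] compensates for both. *)
  move=> r0 re; pose r1 := r * (eta / B) * (eta / B).
  have r10 : 0 < r1 by apply: mulr_gt0 => //; exact: mulr_gt0.
  have [d d0 hd] := tube_graph H ey0 yc y0T r10.
  exists d => // q /hd[th1 [u1 [qE eu1 hu1]]].
  have [y [yth1 ycont yd _]] := flow th1 u1.
  have [Th [T [Th0 _ _ _ dTh]]] := near_time H kap1 y0gs eta0 y0eta y0B th1 tau1 ycont.
  pose u t := y (Th t).
  have Thc : continuous Th by move=> t; exact: isd_cont (dTh t).
  have uc : continuous u.
    by move=> t; apply: (cvg_comp_cont (h := y) (Thc t)); exact: ycont.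
  pose f t := `|u t - y0 (Th t)|.
  have fc : continuous f.
    move=> t; apply: (cvg_comp_cont (h := fun x => `|x|) (l := u t - y0 (Th t))); last exact: norm_continuous.
    by apply: cvgB; [exact: uc|apply: (cvg_comp_cont (h := y0) (Thc t)); exact: yc].
  have u0 : u 0 = u1 by rewrite /u Th0.
  have f0 : f 0 < r1 by rewrite /f u0 Th0.
  have r1r : r1 <= r.
    rewrite /r1 -mulrA ler_piMr ?(ltW r0)// mulr_ile1 ?(ltW ep)// ler_pdivrMr// mul1r//.
  have pf t : f t <= eta -> polar_flow n a phi psi dpsi tau u Th t.
    move=> ft; exact: (near_solution (y := y) (Th := Th) (t := t) H kap1 y0gs eta0 y0eta y0B ft (yd _ ft) (dTh t)).
  have W0 : `|Lf (u 0) - Lf (y0 (Th 0))| < eta / B * r.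
    have [_ h] := andP (nLf (Th 0) (u 0) (ltW (lt_le_trans f0 (le_trans r1r re)))).
    apply: le_lt_trans h _; rewrite -/(f 0).
    have -> : eta / B * r = B / eta * r1 by rewrite /r1; field; rewrite !lt0r_neq0.
    by rewrite ltr_pM2l// divr_gt0.
  have decay t : (forall x, 0 <= x <= t -> f x <= eta) -> 0 <= t ->
      eta / B * f t <= `|Lf (u 0) - Lf (y0 (Th 0))| * expR (- (c * t)).
    move=> hf t0; have ft0 : f t <= eta by apply: hf; rewrite t0 lexx.
    have [h _] := andP (nLf (Th t) (u t) ft0); apply: le_trans h _.
    by apply: attr => // x hx; apply: pf; exact: hf.
  (* The decay estimate presupposes that the trajectory stays in the band, and the band estimate
     rests on the decay; continuation resolves the circle. *)
  have ft t : 0 <= t -> f t < r.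
    move: t; apply: (continuation fc); first exact: lt_le_trans f0 r1r.
    move=> t t0 hf; have := decay t (fun x hx => le_trans (hf x hx) re) t0.
    have e1 : expR (- (c * t)) <= 1.
      by rewrite -expR0 ler_expR oppr_le0 mulr_ge0// ltW.
    move=> h; rewrite -(ltr_pM2l ep); apply: le_lt_trans h _.
    by apply: le_lt_trans W0; rewrite ler_piMr.
  exists u, Th; split => //.
  - by rewrite u0 Th0 qE.
  - move=> t; rewrite /= in_itv /= andbT => t0.
    have hft : f t <= eta by apply: le_trans re; exact: ltW (ft t t0).
    have [[eu _] _ _ _ _] := near_region H kap1 y0gs eta0 y0eta y0B hft.
    exact: (polar_flow_solution H eu (pf t hft)).
  - move=> rho rho0.
    pose w := `|Lf (u 0) - Lf (y0 (Th 0))|.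
    have w0 : 0 <= w by exact: normr_ge0.
    (* Beyond this time 1 + c t, which is at most exp(c t), already exceeds w / (eta / B * rho). *)
    exists (w / (eta / B * rho) / c) => t ht.
    have er : 0 < eta / B * rho by rewrite mulr_gt0.
    have t0 : 0 <= t by apply: ltW; apply: le_lt_trans ht; rewrite !divr_ge0 ?(ltW c0) ?(ltW er).
    have h := decay t (fun x hx => le_trans (ltW (ft x (andP hx).1)) re) t0.
    rewrite -(ltr_pM2l ep); apply: le_lt_trans h _; rewrite -/w.
    rewrite expRN ltr_pdivrMr ?expR_gt0//.
    apply: (@lt_le_trans _ _ (eta / B * rho * (1 + c * t))); last first.
      by rewrite ler_wpM2l ?(ltW er)// expR_ge1Dx.
    rewrite ltr_pdivrMr// ltr_pdivrMr// in ht.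
    rewrite mulrDr mulr1; apply: lt_trans (_ : w < eta / B * rho * (c * t)) _.
      by rewrite mulrC (mulrC c).
    by rewrite ltrDr.
split.
- move=> eps eps0; have [r /andP[r0 re] hr] := near_point H kap1 y0gs y0T eta0 y0eta y0B eps0.
  have [d d0 hd] := traj r r0 re; exists d => // q /hd[u [Th [q0 sol hu _]]].
  exists (fun t => E (Th t) (u t)); split => // t t0.
  by exists (E (Th t) (y0 (Th t))); [exists (Th t)|apply: hr; exact: hu].
- have [d d0 hd] := traj eta eta0 (lexx eta); exists d => // q /hd[u [Th [q0 sol _ hu]]].
  exists (fun t => E (Th t) (u t)); split => // eps eps0.
  have [r /andP[r0 re] hr] := near_point H kap1 y0gs y0T eta0 y0eta y0B eps0.
  have [t0 ht0] := hu r r0; exists t0; split; first exact: num_real.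
  move=> t tt; exists (E (Th t) (y0 (Th t))); first by exists (Th t).
  by apply: hr; exact: ht0.
Qed.

End Stability.

(** * The return map *)

Section ReturnTools.
Variable R : realType.
Implicit Types (f g h : R -> R) (t x y a b c mu : R).

(** The function may vanish, so no logarithm is taken: Gronwall's inequality bounds it by its
    initial value, and the mean value theorem then bounds its change. Either order of [a] and [b] is
    allowed, since the cycle may turn in either sense. *)
Lemma small_log_derivative h dh (k a b : R) : 0 <= k ->
  (forall t, Num.min a b <= t <= Num.max a b -> is_derive t 1 h (dh t)) ->
  (forall t, Num.min a b <= t <= Num.max a b -> `|dh t| <= k * `|h t|) ->
  `|h b - h a| <= k * `|b - a| * expR (k * `|b - a|) * `|h a|.
Proof.
move=> k0 hd hk.
have bnd t : Num.min a b <= t <= Num.max a b -> `|h t| <= expR (k * `|b - a|) * `|h a|.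
  move=> ht; rewrite mulrC.
  have [ab|/ltW ab] := leP a b.
    rewrite min_l// max_r// in ht hd hk; have /andP[at_ tb] := ht.
    have hsub x : a <= x <= t -> a <= x <= b by move=> /andP[-> /le_trans]; apply.
    have [h1 _] := gronwall at_ (fun x hx => hd x (hsub x hx)) (fun x hx => hk x (hsub x hx)).
    apply: le_trans h1 _; rewrite ler_wpM2l// ler_expR ler_wpM2l//.
    by rewrite (ger0_norm (_ : 0 <= b - a)) ?subr_ge0// lerD2r.
  rewrite min_r// max_l// in ht hd hk; have /andP[bt ta] := ht.
  have hsub x : t <= x <= a -> b <= x <= a by move=> /andP[/(le_trans bt) -> ->].
  have [_ h1] := gronwall ta (fun x hx => hd x (hsub x hx)) (fun x hx => hk x (hsub x hx)).
  apply: le_trans h1 _; rewrite ler_wpM2l// ler_expR ler_wpM2l//.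
  by rewrite distrC (ger0_norm (_ : 0 <= a - b)) ?subr_ge0// lerD2l lerN2.
have fin c : Num.min a b <= c <= Num.max a b -> h b - h a = dh c * (b - a) ->
    `|h b - h a| <= k * `|b - a| * expR (k * `|b - a|) * `|h a|.
  move=> hc ->; rewrite normrM.
  have -> : k * `|b - a| * expR (k * `|b - a|) * `|h a| =
    k * (expR (k * `|b - a|) * `|h a|) * `|b - a| by ring.
  rewrite ler_wpM2r//; apply: le_trans (hk c hc) _; rewrite ler_wpM2l//; exact: bnd.
have [ab|ab|ab] := ltgtP a b.
- have e1 : Num.min a b = a by rewrite min_l// ltW.
  have e2 : Num.max a b = b by rewrite max_r// ltW.
  rewrite e1 e2 in hd fin.
  have [c /andP[c1 c2] hc] := mean_value ab hd.
  by apply: (fin c) => //; rewrite !ltW.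
- have e1 : Num.min a b = b by rewrite min_r// ltW.
  have e2 : Num.max a b = a by rewrite max_l// ltW.
  rewrite e1 e2 in hd fin.
  have [c /andP[c1 c2] hc] := mean_value ab hd.
  apply: (fin c); first by rewrite !ltW.
  by rewrite -opprB hc; ring.
- by rewrite ab !subrr normr0 mulr0 !mul0r.
Qed.

(** [W] conjugates [Pi] to multiplication by [mu] up to a relative error of order x. If h is the
    Caratheodory slope of [W] at 0, then Pi x / x = (mu h(x) + o(1)) / h(Pi x), which tends to
    [mu]. *)
Lemma conjugate_derivative (W Pi : R -> R) (c mu C C' d : R) : c != 0 ->
  is_derive (0 : R) 1 W c -> W 0 = 0 -> Pi 0 = 0 -> 0 < d ->
  (forall x, `|x| < d -> `|Pi x| <= C * `|x|) ->
  (forall x, `|x| < d -> `|W (Pi x) - mu * W x| <= C' * `|x| * `|W x|) ->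
  is_derive (0 : R) 1 Pi mu.
Proof.
move=> c0 dW W0 Pi0 d0 hPi hW.
have [h [hE hc h0]] := (is_derive1_caratheodory W 0 c).1 dW.
have Wh x : W x = h x * x by have := hE x; rewrite W0 !subr0.
pose k x := if x == 0 then mu else Pi x / x.
pose ep x := if x == 0 then 0 else (W (Pi x) - mu * W x) / x.
have C1 (B : R) : 0 < `|B| + 1 by have := normr_ge0 B; lra.
have Wc : W x @[x --> (0 : R)] --> (0 : R) by rewrite -[X in _ --> X]W0; exact: isd_cont dW.
have epc : ep x @[x --> (0 : R)] --> (0 : R).
  apply/eps_delta => e e0.
  have [d1 d10 hd1] := (eps_delta _ _ _).1 Wc _ (divr_gt0 e0 (C1 C')).
  exists (Num.min d d1); first by rewrite lt_min d0.
  move=> x; rewrite !subr0 lt_min /ep => /andP[xd xd1].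
  case: eqP => [_|/eqP x0]; first by rewrite normr0.
  have := hd1 x; rewrite !subr0 => /(_ xd1); rewrite ltr_pdivlMr// => h1.
  rewrite normrM normfV ltr_pdivrMr ?normr_gt0//.
  apply: le_lt_trans (hW x xd) _; rewrite mulrAC ltr_pM2r ?normr_gt0//.
  apply: le_lt_trans h1; rewrite mulrC ler_wpM2l//; have := ler_norm C'; lra.
have Pic : Pi x @[x --> (0 : R)] --> (0 : R).
  apply/eps_delta => e e0; exists (Num.min d (e / (`|C| + 1))).
    by rewrite lt_min d0 divr_gt0.
  move=> x; rewrite !subr0 lt_min => /andP[xd]; rewrite ltr_pdivlMr// => h1.
  apply: le_lt_trans (hPi x xd) _; apply: le_lt_trans h1.
  by rewrite mulrC ler_wpM2l//; have := ler_norm C; lra.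
have hPc : h (Pi x) @[x --> (0 : R)] --> c.
  by rewrite -h0; apply: (cvg_comp_cont (h := h) Pic); exact: hc.
have hc' : h x @[x --> (0 : R)] --> c by rewrite -h0; exact: hc.
have kc : {for (0 : R), continuous k}.
  have Kc : (mu * h x + ep x) / h (Pi x) @[x --> (0 : R)] --> k 0.
    have -> : k 0 = (mu * c + 0) / c by rewrite /k eqxx addr0 mulfK.
    apply: cvgM; last by apply: cvgV.
    by apply: cvgD => //; apply: cvgM => //; exact: cvg_cst.
  have [r r0 hr] : exists2 r : R, 0 < r & forall x, `|x| < r -> h (Pi x) != 0.
    have cp : 0 < `|c| by rewrite normr_gt0.
    have [r r0 hr] := (eps_delta _ _ _).1 hPc _ cp; exists r => // x xr.
    have := hr x; rewrite subr0 => /(_ xr) hx; apply/eqP => h1.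
    by move: hx; rewrite h1 sub0r normrN ltxx.
  apply/eps_delta => e e0; have [d1 d10 hd1] := (eps_delta _ _ _).1 Kc _ e0.
  exists (Num.min d1 r); first by rewrite lt_min d10.
  move=> x; rewrite subr0 lt_min => /andP[xd xr].
  have := hd1 x; rewrite subr0 => /(_ xd).
  have hx := hr x xr; rewrite {1}/k /ep; case: (eqVneq x 0) hx => [->|x0] hx.
    by rewrite Pi0 addr0 h0 mulfK// /k eqxx.
  rewrite (_ : (mu * h x + _) / _ = Pi x / x)//.
  by rewrite !Wh; field; rewrite x0 hx.
apply/(is_derive1_caratheodory Pi 0 mu); exists k; split => //; last by rewrite /k eqxx.
by move=> x; rewrite Pi0 !subr0 /k; case: eqP => [->|/eqP x0]; rewrite ?Pi0 ?mulr0// divfK.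
Qed.

End ReturnTools.

Section SectionParam.
Variables (R : realType) (n : nat) (a e s : R) (phi psi dpsi : R -> R).
Variable X : R * R -> R * R.
Hypothesis H : polar_system n a e s phi psi dpsi X.
Variables (kap : R) (y0 : R -> R).
Notation Sf := (lin_coef n a psi dpsi).
Notation Df := (cst_coef n phi psi dpsi).
Notation E := (polar_pt n psi).
Notation graph_field := (scalar_field n a phi psi dpsi).
Hypothesis kap1 : kap = 1 \/ kap = -1.
Hypothesis y0gs : graph_solution n a e phi psi dpsi kap y0.
Implicit Types (t th u v w x r tau : R).

(* Polar coordinates [vt], [up] of the points of a segment transversal to the
   flow; [J] is the derivative of [up - y0 \o vt]. *)
Lemma section_param th0 (m : R * R) : Defs.transversal X (E th0 (y0 th0)) m ->
  exists (d : R) (vt up dvt dup : R -> R),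
  [/\ 0 < d, vt 0 = th0, up 0 = y0 th0,
    forall r, `|r| < d -> [/\ 0 < e * up r, E (vt r) (up r) = E th0 (y0 th0) + r *: m,
      is_derive r 1 vt (dvt r), is_derive r 1 up (dup r) & `|vt r - th0| < 1] &
    let J r := dup r - graph_field (vt r) (y0 (vt r)) * dvt r in
    [/\ dvt r @[r --> (0 : R)] --> dvt 0, J r @[r --> (0 : R)] --> J 0 & J 0 != 0]].
Proof.
move=> tr; pose u0 := y0 th0; pose rho0 := rad n psi th0 u0.
have [eu0 _] := (y0gs th0).1; have [u00 u01] := region_neq0 (y0gs th0).1.
have rho00 : 0 < rho0 by exact: rad_gt0.
(* Radial and angular components of the direction [m] at the base point. In the frame rotated by
   [th0], the point of parameter r has the coordinates [A r] and [r * be], and [q r] is its squared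
   radius. *)
pose al := m.1 * cos th0 + m.2 * sin th0.
pose be := m.2 * cos th0 - m.1 * sin th0.
pose A r := rho0 + r * al; pose q r := A r ^+ 2 + (r * be) ^+ 2.
pose vt r := th0 + atan (r * be / A r).
pose up r := (psi (vt r) * Num.sqrt (q r) ^+ n)^-1.
pose dvt r := be * rho0 / q r.
pose dup r := - up r * (dpsi (vt r) / psi (vt r) * dvt r + n%:R * (A r * al + r * be * be) / q r).
have Ad r : is_derive r 1 A al by rewrite /A; der; ring.
have Ac : A r @[r --> (0 : R)] --> A 0 by exact: isd_cont (Ad 0).
have A0 : A 0 = rho0 by rewrite /A mul0r addr0.
have qd r : is_derive r 1 q (2 * (A r * al + r * be * be)).
  by rewrite /q; have := Ad r => ?; der; rewrite /=; ring.
have qc : q r @[r --> (0 : R)] --> q 0 by exact: isd_cont (qd 0).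
have q0 : q 0 = rho0 ^+ 2 by rewrite /q A0 mul0r expr0n /= addr0.
have vt0 : vt 0 = th0 by rewrite /vt !mul0r atan0 addr0.
have up0 : up 0 = u0.
  rewrite /up vt0 q0 sqrtr_sqr gtr0_norm//.
  have h := radX H th0 eu0; rewrite -/u0 -/rho0 in h.
  have r0 : rho0 ^+ n != 0 by rewrite expf_neq0// lt0r_neq0.
  apply: (mulIf (psi_neq0 H th0)); apply: (mulIf r0).
  by rewrite -[LHS]mulrA mulVf ?mulf_neq0 ?(psi_neq0 H)// -h; ring.
have qpos r : 0 < A r -> 0 < q r by move=> Ar; rewrite /q ltr_pwDl ?sqr_ge0 ?exprn_gt0.
have vtd r : 0 < A r -> is_derive r 1 vt (dvt r).
  move=> Ar; have An : A r != 0 by rewrite gt_eqF.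
  have := qpos r Ar; rewrite /q => qr; have qn := lt0r_neq0 qr.
  rewrite /vt /dvt /q; have := Ad r => ?; der.
  rewrite /=; have -> : 1 + (r * be / A r) ^+ 2 = (A r ^+ 2 + (r * be) ^+ 2) / A r ^+ 2 by field.
  have rE : rho0 = A r - r * al by rewrite /A; ring.
  by rewrite rE; field; rewrite An qn.
have updr r : 0 < A r -> is_derive r 1 up (dup r).
  move=> Ar; have qr := qpos r Ar; have qn := lt0r_neq0 qr.
  have sq0 : 0 < Num.sqrt (q r) by rewrite sqrtr_gt0.
  have sqn := lt0r_neq0 sq0; have p0 := psi_neq0 H (vt r).
  have sqX : Num.sqrt (q r) ^+ n != 0 by exact: expf_neq0.
  have d1 := isd_sqrt qr (qd r).
  have d2 := isd_comp (ps_dpsi H (vt r)) (vtd r Ar).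
  have d3 := isd_mul d2 (isd_pow n d1).
  have pn : psi (vt r) * Num.sqrt (q r) ^+ n != 0 by rewrite mulf_neq0.
  have d4 := isd_inv (f := fun t => psi (vt t) * Num.sqrt (q t) ^+ n) pn d3.
  apply: isd_eq d4 _; rewrite /dup /up.
  have -> : Num.sqrt (q r) ^+ n.-1 = Num.sqrt (q r) ^+ n / Num.sqrt (q r).
    by rewrite -[in RHS](prednK (ps_n H)) exprS mulrAC mulfV// mul1r.
  have sq2 : q r = Num.sqrt (q r) ^+ 2 by rewrite sqr_sqrtr// ltW.
  rewrite [X in _ * _ / X]sq2; rewrite sq2 in qn; field; rewrite p0 sqX sqn//.
have pt r : 0 < A r -> 0 < e * up r /\ E (vt r) (up r) = E th0 (y0 th0) + r *: m.
  move=> Ar; pose x := rho0 * cos th0 + r * m.1; pose y := rho0 * sin th0 + r * m.2.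
  have cs := cos2Dsin2 th0.
  have hA : x * cos th0 + y * sin th0 = A r.
    by rewrite /x /y /A /al -[rho0 in RHS]mulr1 -cs; ring.
  have hB : y * cos th0 - x * sin th0 = r * be by rewrite /x /y /be; ring.
  have := @rotated_angle _ x y th0; rewrite hA hB -/(vt r) => /(_ Ar)[rho rhop [hx hy rho2]].
  have rq : rho = Num.sqrt (q r).
    have -> : q r = rho ^+ 2.
      rewrite rho2 /q -hA -hB -[RHS]mulr1 -cs; ring.
    by rewrite sqrtr_sqr gtr0_norm.
  have qr := qpos r Ar; have sq0 : 0 < Num.sqrt (q r) by rewrite sqrtr_gt0.
  have sqX : 0 < Num.sqrt (q r) ^+ n by exact: exprn_gt0.
  have hr : psi (vt r) * up r * Num.sqrt (q r) ^+ n = 1.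
    by rewrite /up; field; rewrite (psi_neq0 H) lt0r_neq0.
  split.
    rewrite -(psiu_gt0 H (vt r)).
    have : 0 < psi (vt r) * up r * Num.sqrt (q r) ^+ n by rewrite hr.
    by rewrite pmulr_lgt0.
  by rewrite /polar_pt (rad_unique H sq0 hr) -rq -hx -hy.
have vtc : vt r @[r --> (0 : R)] --> vt 0.
  by apply: (isd_cont (vtd 0 _)); rewrite A0.
have upc : up r @[r --> (0 : R)] --> up 0.
  by apply: (isd_cont (updr 0 _)); rewrite A0.
have [d1 d10 hd1] : exists2 d : R, 0 < d & forall r, `|r| < d -> 0 < A r.
  have [d d0 hd] := (eps_delta _ _ _).1 Ac _ rho00; exists d => // r hr.
  have := hd r; rewrite subr0 => /(_ hr); rewrite A0 ltr_norml => /andP[]; lra.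
have [d2 d20 hd2] := (eps_delta _ _ _).1 vtc _ ltr01.
have yc : continuous y0 by move=> th; exact: isd_cont (y0gs th).2.
have dvtc : dvt r @[r --> (0 : R)] --> dvt 0.
  apply: cvgM; first exact: cvg_cst.
  by apply: cvgV => //; rewrite q0 expf_neq0// lt0r_neq0.
have yvc : y0 (vt r) @[r --> (0 : R)] --> y0 (vt 0).
  by apply: (cvg_comp_cont (h := y0) vtc); exact: yc.
have psic : psi (vt r) @[r --> (0 : R)] --> psi (vt 0).
  by apply: (cvg_comp_cont (h := psi) vtc); exact: isd_cont (ps_dpsi H _).
have dpsic : dpsi (vt r) @[r --> (0 : R)] --> dpsi (vt 0).
  by apply: (cvg_comp_cont (h := dpsi) vtc); exact: ps_dpsic H _.
have Jc : dup r - graph_field (vt r) (y0 (vt r)) * dvt r @[r --> (0 : R)] -->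
    dup 0 - graph_field (vt 0) (y0 (vt 0)) * dvt 0.
  apply: cvgB.
    apply: cvgM; first by apply: cvgN.
    apply: cvgD.
      by apply: cvgM => //; apply: cvgM => //; apply: cvgV => //; exact: psi_neq0 H _.
    apply: cvgM; last by apply: cvgV => //; rewrite q0 expf_neq0// lt0r_neq0.
    apply: cvgM; first exact: cvg_cst.
    apply: cvgD; first by apply: cvgM => //; exact: cvg_cst.
    apply: cvgM; last exact: cvg_cst.
    by apply: cvgM; [exact: cvg_id|exact: cvg_cst].
  apply: cvgM => //; rewrite /scalar_field; apply: cvgM.
    apply: cvgN; apply: cvgD.
      by apply: cvgM => //; apply: (cvg_comp_cont (h := Sf) vtc); exact: Sf_cont H _.
    by apply: (cvg_comp_cont (h := Df) vtc); exact: Df_cont H _.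
  apply: cvgM => //; apply: cvgV; first by rewrite vt0.
  by apply: cvgD => //; exact: cvg_cst.
have dd : 0 < Num.min d1 d2 by rewrite lt_min d10.
have pts r : `|r| < Num.min d1 d2 ->
    [/\ 0 < e * up r, E (vt r) (up r) = E th0 (y0 th0) + r *: m,
      is_derive r 1 vt (dvt r), is_derive r 1 up (dup r) & `|vt r - th0| < 1].
  rewrite lt_min => /andP[r1 r2]; have Ar := hd1 r r1.
  have [h1 h2] := pt r Ar; split; [exact: h1|exact: h2|exact: vtd|exact: updr|].
  by have := hd2 r; rewrite subr0 vt0; apply.
exists (Num.min d1 d2), vt, up, dvt, dup.
split; [exact: dd|exact: vt0|exact: up0|exact: pts|].
split; [exact: dvtc|exact: Jc|].
rewrite /dup /dvt vt0 up0 -/u0 q0 A0 /scalar_field.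
move: tr; rewrite /Defs.transversal (X_E H _ eu0) -/u0 -/rho0 /=.
have p0 := psi_neq0 H th0; have rn := lt0r_neq0 rho00.
have -> : rho0 * ((a + phi th0 / (psi th0 * u0)) * cos th0 - (1 + u0^-1) * sin th0) * m.2 -
  rho0 * ((a + phi th0 / (psi th0 * u0)) * sin th0 + (1 + u0^-1) * cos th0) * m.1 =
  rho0 / u0 * ((a * u0 + phi th0 / psi th0) * be - (1 + u0) * al).
  by rewrite /al /be; field; rewrite p0 u00.
move=> tr.
(* [J 0] is a nonvanishing multiple of the determinant that expresses transversality. *)
have -> : - u0 * (dpsi th0 / psi th0 * (be * rho0 / rho0 ^+ 2) +
    n%:R * (rho0 * al + 0 * be * be) / rho0 ^+ 2) -
    - (Sf th0 * u0 + Df th0) * (u0 / (1 + u0)) * (be * rho0 / rho0 ^+ 2) =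
  n%:R * u0 ^+ 2 / (rho0 ^+ 2 * (1 + u0)) *
    (rho0 / u0 * ((a * u0 + phi th0 / psi th0) * be - (1 + u0) * al)).
  by rewrite /lin_coef /cst_coef; field; rewrite p0 u00 u01 rn.
apply: mulf_neq0 => //; apply: mulf_neq0.
  by rewrite mulf_neq0 ?(n_neq0 H) ?expf_neq0.
by rewrite invr_neq0// mulf_neq0// expf_neq0.
Qed.

End SectionParam.

(** * The linearised equation along the cycle *)

Section Multiplier.
Variables (R : realType) (n : nat) (a e s : R) (phi psi dpsi : R -> R).
Variable X : R * R -> R * R.
Hypothesis H : polar_system n a e s phi psi dpsi X.
Variables (kap : R) (y0 : R -> R) (eta B : R).
Notation Sf := (lin_coef n a psi dpsi).
Notation Df := (cst_coef n phi psi dpsi).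
Notation E := (polar_pt n psi).
Notation graph_field := (scalar_field n a phi psi dpsi).
Hypothesis kap1 : kap = 1 \/ kap = -1.
Hypothesis y0gs : graph_solution n a e phi psi dpsi kap y0.
Hypothesis y0T : forall th : R, y0 (th + 2 * pi) = y0 th.
Hypothesis eta0 : 0 < eta.
Hypothesis y0eta : forall th : R, 2 * eta <= `|y0 th| /\ 2 * eta <= `|1 + y0 th|.
Hypothesis y0B : forall th : R, `|y0 th| + eta + 1 <= B.
Implicit Types (t th u v w x r eps tau mu : R).

Lemma y0_near th : `|y0 th - y0 th| <= eta.
Proof. by rewrite subrr normr0 ltW. Qed.

Lemma y0_neq0 th : y0 th != 0 /\ 1 + y0 th != 0.
Proof. exact: region_neq0 (y0gs th).1. Qed.

(* [M] solves the linearised equation along the cycle. In the variable [Lf] that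
   equation is [W' = - (S / Lf' y0) W], whose coefficient has constant sign;
   hence the multiplier differs from 1. *)
Lemma multiplier (sg : R) : sg = 1 \/ sg = -1 -> exists (M : R -> R) (mu : R),
  [/\ mu != 1, forall th, M th != 0,
    forall th, is_derive th 1 M
      (M th * (- Sf th + (Sf th - Df th) / (1 + y0 th) ^+ 2))
    & forall th, M (th + sg * (2 * pi)) = mu * M th].
Proof.
move=> sg1; have pi0 : 0 < 2 * pi :> R by rewrite mulr_gt0 ?pi_gt0.
have yc : continuous y0 by move=> th; exact: isd_cont (y0gs th).2.
(* The coefficient -S / L'(y0) of the linearised equation for W, as L'(y0) = (1 + y0)/y0. Dividing
   its solution by L'(y0) returns to a deviation of u, whence the factor y0/(1 + y0) in [M]. *)
pose l th := - (Sf th * (y0 th / (1 + y0 th))).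
have lc : continuous l.
  move=> th; apply: cvgN; apply: cvgM; first exact: Sf_cont H _.
  apply: cvgM; first exact: yc.
  by apply: cvgV; [exact: (y0_neq0 th).2|apply: cvgD; [exact: cvg_cst|exact: yc]].
have [L dL] := primitive lc.
have lT th : l (th + sg * (2 * pi)) = l th.
  have lT1 x : l (x + 2 * pi) = l x by rewrite /l (Sf_per H) y0T.
  case: sg1 => ->; first by rewrite mul1r.
  by rewrite mulN1r -[LHS]lT1 subrK.
pose c := L (0 + sg * (2 * pi)) - L 0.
have LT th : L (th + sg * (2 * pi)) = L th + c.
  have hd x : is_derive x 1 (fun x => L (x + sg * (2 * pi)) - L x) 0.
    have := dL x => ?; have := dL (x + sg * (2 * pi)) => ?.
    by der; rewrite lT; ring.
  by have e0 := der0_cst hd th 0; rewrite /c -e0; ring.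
have c0 : c != 0.
  have key x y : x < y -> 0 < - (s * (e * kap)) * (L y - L x).
    move=> xy; have [w _ ->] := mean_value xy (fun t _ => dL t).
    have -> : - (s * (e * kap)) * (l w * (y - x)) =
      (s * Sf w) * ((e * y0 w) * (kap * (1 + y0 w)) / (1 + y0 w) ^+ 2) * (y - x).
      by rewrite /l; field; exact: (y0_neq0 w).2.
    have [[h1 h2] _] := y0gs w.
    apply: mulr_gt0; last by rewrite subr_gt0.
    apply: mulr_gt0; first exact: ps_S H _.
    apply: divr_gt0; first exact: mulr_gt0.
    by apply: sqr_pos; exact: (y0_neq0 w).2.
  rewrite /c add0r; case: sg1 => ->.
    by rewrite mul1r; have := key _ _ pi0; apply: contraTneq => ->; rewrite mulr0 ltxx.
  rewrite mulN1r; have := key (- (2 * pi)) 0; rewrite oppr_lt0 => /(_ pi0).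
  by apply: contraTneq => h; rewrite -opprB h oppr0 mulr0 ltxx.
exists (fun th => expR (L th) * (y0 th / (1 + y0 th))), (expR c); split.
- rewrite -[1]expR0; apply/eqP => /expR_inj/eqP; exact/negP.
- move=> th; have [h1 h2] := y0_neq0 th.
  by apply: mulf_neq0; [exact: lt0r_neq0 (expR_gt0 _)|rewrite mulf_neq0 ?invr_neq0].
- move=> th; have [h1 h2] := y0_neq0 th; have := (y0gs th).2 => ?; have := dL th => ?.
  by der; rewrite /scalar_field /l /=; field.
- move=> th; rewrite LT expRD.
  have -> : y0 (th + sg * (2 * pi)) = y0 th.
    case: sg1 => ->; first by rewrite mul1r y0T.
    by rewrite mulN1r -[LHS]y0T subrK.
  by ring.
Qed.

(** A linearisation with quadratic error: the deviation divided by [M] has a logarithmic derivative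
    of the order of the deviation itself. *)
Lemma transition (M : R -> R) (len : R) : 0 <= len ->
  (forall th, M th != 0) ->
  (forall th, is_derive th 1 M
      (M th * (- Sf th + (Sf th - Df th) / (1 + y0 th) ^+ 2))) ->
  exists2 C : R, 0 <= C & forall (y : R -> R) (x z del : R), 0 <= del <= eta ->
    `|z - x| <= len ->
    (forall th, Num.min x z <= th <= Num.max x z -> `|y th - y0 th| <= del) ->
    (forall th, Num.min x z <= th <= Num.max x z ->
      is_derive th 1 y (graph_field th (y th))) ->
    `|(y z - y0 z) / M z - (y x - y0 x) / M x| <= C * del * `|(y x - y0 x) / M x|.
Proof.
move=> len0 M0 dM; have pi0 : 0 < 2 * pi :> R by rewrite mulr_gt0 ?pi_gt0.
have [BS BS0 hS] := per_bounded pi0 (Sf_cont H) (Sf_per H).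
have [BD BD0 hD] := per_bounded pi0 (Df_cont H) (Df_per H).
pose C0 := (BS + BD) / eta / eta ^+ 2.
have C00 : 0 <= C0 by rewrite /C0 !divr_ge0 ?exprn_ge0 ?(ltW eta0)//; lra.
exists (C0 * len * expR (C0 * eta * len)).
  by apply: mulr_ge0; [exact: mulr_ge0|exact: expR_ge0].
move=> y x z del /andP[del0 deleta] xz hn hy.
have kd : 0 <= C0 * del by exact: mulr_ge0.
pose h th := (y th - y0 th) / M th.
(* The linear part of the field cancels against [M]; this is the exact remainder, not an
   estimate. *)
pose dh th := h th * ((Sf th - Df th) * (1 + y0 th)^-1 * ((1 + y th)^-1 - (1 + y0 th)^-1)).
have hd th : Num.min x z <= th <= Num.max x z -> is_derive th 1 h (dh th).
  move=> hth; have ny : `|y th - y0 th| <= eta by exact: le_trans (hn th hth) deleta.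
  have [_ y1] := near_neq0 H kap1 y0gs eta0 y0eta y0B ny; have [_ y01] := y0_neq0 th.
  have d1 := hy th hth; have d2 := (y0gs th).2; rewrite !field_split// in d1 d2.
  have d3 := isd_mul (isd_add d1 (isd_opp d2)) (isd_inv (M0 th) (dM th)).
  apply: isd_eq d3 _; rewrite /dh /h; field; rewrite y1 y01; exact: M0.
have hk th : Num.min x z <= th <= Num.max x z -> `|dh th| <= C0 * del * `|h th|.
  move=> hth; have ny : `|y th - y0 th| <= eta by exact: le_trans (hn th hth) deleta.
  rewrite /dh normrM mulrC ler_wpM2r// !normrM.
  have -> : C0 * del = (BS + BD) * eta^-1 * (del / eta ^+ 2) by rewrite /C0; ring.
  apply: ler_pM; rewrite ?mulr_ge0//.
    apply: ler_pM => //; first by apply: le_trans (ler_normB _ _) _; rewrite lerD.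
    rewrite normfV lef_pV2 ?posrE ?normr_gt0 ?(y0_neq0 th).2//.
    by apply: le_trans (y0eta th).2; rewrite ler_peMl ?ler1n ?(ltW eta0).
  apply: le_trans (near_inv H kap1 y0gs eta0 y0eta y0B ny (y0_near th)) _.
  by rewrite ler_wpM2r ?invr_ge0 ?exprn_ge0 ?(ltW eta0)// hn.
have := small_log_derivative kd hd hk; rewrite -/(h x) -/(h z) => /le_trans; apply.
rewrite ler_wpM2r//.
apply: (@le_trans _ _ (C0 * del * len * expR (C0 * eta * len))); last first.
  by rewrite le_eqVlt; apply/orP; left; apply/eqP; ring.
have kz : 0 <= C0 * del * `|z - x| by exact: mulr_ge0.
apply: ler_pM; [exact: kz|exact: expR_ge0|by rewrite ler_wpM2l|].
rewrite ler_expR; apply: ler_pM => //; by rewrite ler_wpM2l.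
Qed.

End Multiplier.

(** * The return map of a transversal segment and the multiplicity of the cycle *)

Section ReturnMap.
Variables (R : realType) (n : nat) (a e s : R) (phi psi dpsi : R -> R).
Variable X : R * R -> R * R.
Hypothesis H : polar_system n a e s phi psi dpsi X.
Variables (kap : R) (y0 : R -> R) (eta B : R).
Notation Sf := (lin_coef n a psi dpsi).
Notation Df := (cst_coef n phi psi dpsi).
Notation E := (polar_pt n psi).
Notation graph_field := (scalar_field n a phi psi dpsi).
Hypothesis kap1 : kap = 1 \/ kap = -1.
Hypothesis y0gs : graph_solution n a e phi psi dpsi kap y0.
Hypothesis y0T : forall th : R, y0 (th + 2 * pi) = y0 th.
Hypothesis eta0 : 0 < eta.
Hypothesis y0eta : forall th : R, 2 * eta <= `|y0 th| /\ 2 * eta <= `|1 + y0 th|.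
Hypothesis y0B : forall th : R, `|y0 th| + eta + 1 <= B.
Implicit Types (t th u v w x r eps tau mu : R).

(** [sg] is the sense of rotation and [om] a full turn in that sense. The crude bound pi < 4 gives 8
    for [om]; the angles on the segment lie within 1 of [th0], so those of one turn lie within 9 of
    [th0] and within 10 of the start. *)
Let sg := e * kap.
Let om := sg * (2 * pi).

Lemma sg_sign : sg = 1 \/ sg = -1.
Proof.
rewrite /sg; case: (ps_e H) => ->; case: kap1 => ->; rewrite ?mul1r ?mulrN ?mulr1 ?opprK;
  by [left|right].
Qed.

Lemma pi_lt4 : pi < 4 :> R.
Proof. by have := pihalf_lt2 R; rewrite ltr_pdivrMr//; lra. Qed.

Lemma om_bound : `|om| <= 8.
Proof.
rewrite /om normrM; have -> : `|sg| = 1 by case: sg_sign => ->; rewrite ?normrN normr1.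
rewrite mul1r ger0_norm ?mulr_ge0 ?pi_ge0//; have := pi_lt4; lra.
Qed.

Lemma int_between (k : int) : -1 < k -> k < 2 -> k = 0 \/ k = 1.
Proof. by case: k => [[|[|k]]|[|k]]// _ _; [left|right]. Qed.

(* The orbit of the graph of [y] makes one turn, from the point of parameter [x] of
   the segment to that of parameter [x']. *)
Lemma graph_first_return (p m : R * R) (vt up y : R -> R) (eps th0 x x' : R) :
  (forall r, `|r| < eps -> [/\ 0 < e * up r, E (vt r) (up r) = p + r *: m & `|vt r - th0| < 1]) ->
  continuous y ->
  (forall th, `|th - th0| <= 9 -> `|y th - y0 th| <= eta) ->
  (forall th, `|y th - y0 th| <= eta -> is_derive th 1 y (graph_field th (y th))) ->
  `|x| < eps -> `|x'| < eps -> y (vt x) = up x -> y (vt x' + om) = up x' ->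
  (forall r, `|r| < eps -> y (vt r) = up r -> r = x) ->
  (forall r, `|r| < eps -> y (vt r + om) = up r -> r = x') ->
  first_return X p m eps x x'.
Proof.
move=> pts yc yn yd xe x'e yx yx' inj inj'.
have pi2 := pi_ge2 R; have pi4 := pi_lt4; have ss := sqr_sign sg_sign.
have [Th [T [Th0 ThK TK mono dTh]]] :=
  near_time H kap1 y0gs eta0 y0eta y0B (vt x) (or_introl erefl) yc.
have {}mono t1 t2 : t1 < t2 -> 0 < sg * (Th t2 - Th t1) by move=> /mono; rewrite mul1r.
pose z t := E (Th t) (y (Th t)).
have [_ _ vx] := pts x xe; have [_ _ vx'] := pts x' x'e.
have sgb v : `|v| < 1 -> -1 < sg * v < 1.
  by rewrite ltr_norml => /andP[]; case: sg_sign => ->; rewrite ?mul1r ?mulN1r => ? ?; apply/andP; split; lra.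
have sgom : sg * om = 2 * pi by rewrite /om mulrA ss mul1r.
pose tau := T (vt x' + om).
have Thtau : Th tau = vt x' + om by rewrite /tau TK.
have tau0 : 0 < tau.
  rewrite ltNge; apply/negP; rewrite le_eqVlt => /orP[/eqP e0|/mono].
    have : sg * (vt x' + om - vt x) = 0 by rewrite -Thtau e0 Th0 subrr mulr0.
    have -> : sg * (vt x' + om - vt x) = sg * (vt x' - th0) + sg * om - sg * (vt x - th0) by ring.
    by rewrite sgom; have /andP[] := sgb _ vx; have /andP[] := sgb _ vx'; lra.
  rewrite Th0 Thtau.
  have -> : sg * (vt x - (vt x' + om)) = sg * (vt x - th0) - sg * om - sg * (vt x' - th0) by ring.
  by rewrite sgom; have /andP[] := sgb _ vx; have /andP[] := sgb _ vx'; lra.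
have between t : 0 <= t <= tau -> -1 <= sg * (Th t - th0) <= 9.
  move=> /andP[t0 tt].
  have h1 : 0 <= sg * (Th t - vt x).
    move: t0; rewrite le_eqVlt => /predU1P[<-|/mono]; first by rewrite Th0 subrr mulr0.
    by rewrite Th0 => /ltW.
  have h2 : 0 <= sg * (vt x' + om - Th t).
    move: tt; rewrite le_eqVlt => /predU1P[->|/mono]; first by rewrite Thtau subrr mulr0.
    by rewrite Thtau => /ltW.
  have -> : sg * (Th t - th0) = sg * (Th t - vt x) + sg * (vt x - th0) by ring.
  have e2 : sg * (vt x' + om - Th t) = sg * (vt x' - th0) + sg * om - sg * (Th t - vt x) - sg * (vt x - th0) by ring.
  rewrite e2 sgom in h2; have /andP[] := sgb _ vx; have /andP[] := sgb _ vx'; lra.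
have nr t : 0 <= t <= tau -> `|Th t - th0| <= 9.
  move=> /between /andP[]; rewrite ler_norml; case: sg_sign => ->; rewrite ?mul1r ?mulN1r; lra.
have close t : 0 <= t <= tau -> `|y (Th t) - y0 (Th t)| <= eta by move=> /nr; exact: yn.
have eu t : 0 <= t <= tau -> 0 < e * y (Th t).
  by move=> /close hc; have [[]] := near_region H kap1 y0gs eta0 y0eta y0B hc.
exists z, tau; split => //.
- move=> t; rewrite /= in_itv /= => ht.
  have fl := near_solution (y := y) (Th := Th) (t := t) H kap1 y0gs eta0 y0eta y0B
    (close t ht) (yd _ (close t ht)) (dTh t).
  have := polar_flow_solution H (eu t ht) fl; rewrite !mul1r => hs; exact: hs.
- split; first by have [_ <- _] := pts x xe; rewrite /z Th0 yx.
  rewrite /z Thtau yx'; have [_ <- _] := pts x' x'e.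
  rewrite /om; case: sg_sign => ->.
    by rewrite mul1r; have := E_per H 1 (vt x') (up x'); rewrite mulr1z mul1r.
  by have := E_per H (-1) (vt x') (up x'); rewrite mulrN1z.
move=> t r /andP[t0 tt] re; apply/eqP => hit.
have ht : 0 <= t <= tau by rewrite !ltW.
have [eur Er vr] := pts r re; rewrite -Er in hit.
have [yr [k hk]] := E_inj H (eu t ht) eur hit.
have h1 := mono _ _ t0; have h2 := mono _ _ tt; rewrite Th0 in h1; rewrite Thtau in h2.
have /andP[a1 a2] := sgb _ vx; have /andP[b1 b2] := sgb _ vx'; have /andP[c1 c2] := sgb _ vr.
rewrite hk in h1 h2.
have e1 : sg * (vt r + k%:~R * (2 * pi) - vt x) =
  sg * (vt r - th0) + sg * k%:~R * (2 * pi) - sg * (vt x - th0) by ring.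
have e2 : sg * (vt x' + om - (vt r + k%:~R * (2 * pi))) =
  sg * (vt x' - th0) + sg * om - sg * (vt r - th0) - sg * k%:~R * (2 * pi) by ring.
rewrite e1 in h1; rewrite e2 sgom in h2.
(* Between the two end times the angle lies strictly between its end values, which leaves only the
   starting copy of the segment and the one a full turn later. The graph meets each of them at one
   parameter only, attained at time 0 and at time tau respectively. *)
have kb : -1 < sg * k%:~R < 2.
  apply/andP; split; rewrite -(@ltr_pM2r _ (2 * pi)) ?mulr_gt0 ?pi_gt0//; lra.
have [k0|k1] : k = 0 \/ k%:~R * (2 * pi) = om.
  move: kb; rewrite /om; case: sg_sign => ->; rewrite ?mul1r ?mulN1r => /andP[].
    rewrite (_ : -1 = (-1)%:~R)// (_ : 2 = 2%:~R)// !ltr_int => k1 k2.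
    have [->|->] := int_between k1 k2.
      by left.
    by right; rewrite mulr1z mul1r.
  rewrite (_ : -1 = (-1)%:~R)// (_ : 2 = 2%:~R)// -mulrNz !ltr_int => k1 k2.
  have [/eqP|/eqP] := int_between k1 k2; rewrite eqr_oppLR => /eqP ->.
    by left; rewrite oppr0.
  by right; rewrite mulrN1z mulN1r.
- rewrite k0 mulr0z mul0r addr0 in hk; rewrite hk in yr.
  have rx := inj r re yr; move: t0; rewrite -[t]ThK hk rx -Th0 ThK ltxx//.
- rewrite k1 in hk; rewrite hk in yr.
  have rx := inj' r re yr; move: tt; rewrite -[t]ThK hk rx -/tau ltxx//.
Qed.

(** Along the segment, the gap between the segment and any graph close to the cycle has a slope
    close to [J0]. Hence such a graph meets the segment at most once, and the gap measures the
    parameter up to constants. *)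
Lemma section_slope (vt up dvt dup : R -> R) (eps J0 del : R) (y dy : R -> R) :
  0 <= del ->
  (forall r, `|r| < eps -> is_derive r 1 vt (dvt r)) ->
  (forall r, `|r| < eps -> is_derive r 1 up (dup r)) ->
  (forall r, `|r| < eps -> is_derive (vt r) 1 y (dy r)) ->
  (forall r, `|r| < eps -> `|dup r - dy r * dvt r - J0| <= del) ->
  forall r1 r2, `|r1| < eps -> `|r2| < eps -> exists2 v, `|v - J0| <= del &
  up r2 - y (vt r2) - (up r1 - y (vt r1)) = v * (r2 - r1).
Proof.
move=> del0 vd ud yd hJ; suff W r1 r2 : r1 < r2 -> `|r1| < eps -> `|r2| < eps ->
    exists2 v, `|v - J0| <= del &
    up r2 - y (vt r2) - (up r1 - y (vt r1)) = v * (r2 - r1).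
  move=> r1 r2 h1 h2; have [h|h|->] := ltgtP r1 r2; first exact: W.
    have [v v1 v2] := W _ _ h h2 h1; exists v => //.
    by rewrite -opprB v2; ring.
  by exists J0; rewrite ?subrr ?normr0// mulr0.
move=> r12 h1 h2.
have mid r : r1 <= r <= r2 -> `|r| < eps.
  move=> /andP[ra rb]; rewrite ltr_norml; move: h1 h2; rewrite !ltr_norml.
  by move=> /andP[? ?] /andP[? ?]; apply/andP; split; lra.
have wd r : r1 <= r <= r2 -> is_derive r 1 (fun r => up r - y (vt r)) (dup r - dy r * dvt r).
  by move=> /mid hr; exact: isd_add (ud r hr) (isd_opp (isd_comp (yd r hr) (vd r hr))).
have [w /andP[w1 w2] ->] := mean_value r12 wd.
by exists (dup w - dy w * dvt w) => //; apply: hJ; apply: mid; rewrite !ltW.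
Qed.

Lemma min_max_near (x z th c d : R) : `|x - c| <= d -> `|z - c| <= d ->
  Num.min x z <= th <= Num.max x z -> `|th - c| <= d.
Proof.
rewrite !ler_norml => /andP[h1 h2] /andP[h3 h4].
by have [h|h] := leP x z => /andP[h5 h6]; apply/andP; split; lra.
Qed.

Lemma half_lt eps : 0 < eps -> `|eps / 2| < eps.
Proof. by move=> h; rewrite gtr0_norm ?divr_gt0//; lra. Qed.

Lemma norm_le_half eps r : 0 < eps -> - (eps / 2) <= r <= eps / 2 -> `|r| < eps.
Proof. by move=> h /andP[h1 h2]; rewrite ltr_norml; apply/andP; split; lra. Qed.

Lemma norm_turn (x z c : R) : `|x - c| < 1 -> `|z - c| < 1 ->
  [/\ `|x - c| <= 9, `|x + om - c| <= 9 & `|z + om - x| <= 10].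
Proof.
have h := om_bound; rewrite !ltr_norml => /andP[h1 h2] /andP[h3 h4].
rewrite !ler_norml in h *; case/andP: h => h5 h6.
by split; apply/andP; split; lra.
Qed.

Lemma norm_turn_sub (th x c : R) : `|th - c| <= 9 -> `|x - c| < 1 -> `|th - x| <= 10.
Proof.
by rewrite ltr_norml !ler_norml => /andP[h1 h2] /andP[h3 h4]; apply/andP; split; lra.
Qed.

Lemma quarter_near (j J0 v : R) : 0 < j -> 4 * j = `|J0| -> `|v - J0| <= 2 * j ->
  [/\ 2 * j <= `|v|, `|v| <= 6 * j & 0 < v * J0].
Proof.
move=> j0; have [hJ|hJ] := ltP 0 J0.
  rewrite gtr0_norm// => <-; rewrite ler_norml => /andP[h1 h2]; rewrite gtr0_norm; last by lra.
  by split; [lra|lra|apply: mulr_gt0; lra].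
rewrite ler0_norm// => jJ; have -> : J0 = - (4 * j) by rewrite jJ opprK.
rewrite ler_norml => /andP[h1 h2]; rewrite ltr0_norm; last by lra.
by split; [lra|lra|rewrite nmulr_rgt0; lra].
Qed.

Lemma opposite_signs (j eps J0 d v w Gv Gw : R) : 0 < eps ->
  0 < v * J0 -> 0 < w * J0 -> 2 * j <= `|v| -> 2 * j <= `|w| -> d < j * eps ->
  `|Gv - v * (eps / 2)| <= d -> `|Gw - w * - (eps / 2)| <= d -> Gw * Gv <= 0.
Proof.
move=> eps0 vJ wJ jv jw dj; rewrite !ler_norml => /andP[v1 v2] /andP[w1 w2].
have bnd u : 2 * j <= u -> d <= u * (eps / 2).
  move=> ju; apply: le_trans (ltW dj) _.
  have -> : j * eps = 2 * j * (eps / 2) by field.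
  by rewrite ler_wpM2r// divr_ge0// ltW.
have [J0p|J0n] := ltP 0 J0.
  rewrite !pmulr_lgt0// in vJ wJ; rewrite !gtr0_norm// in jv jw.
  by apply: mulr_le0_ge0; have := bnd _ jv; have := bnd _ jw; lra.
have J0n' : J0 < 0.
  by rewrite lt_neqAle J0n andbT; apply: contraTneq vJ => ->; rewrite mulr0 ltxx.
rewrite !nmulr_lgt0// in vJ wJ; rewrite !ltr0_norm// in jv jw.
by apply: mulr_ge0_le0; have := bnd _ jv; have := bnd _ jw; lra.
Qed.

(** The graph through the point of parameter x is followed for one turn, and [Pi x] is the parameter
    at which it meets the segment again. With W the gap between segment and cycle divided by [M],
    the estimate of [transition] becomes W(Pi x) = mu W(x) up to a relative error of order x. Hence
    Pi has derivative [mu] at 0, which is not 1. *)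
Lemma graph_multiplicity : cycle_multiplicity X (range (fun th => E th (y0 th))) 1.
Proof.
move=> p m [th0 _ <-] tr.
have [d0 [vt [up [dvt [dup [d00 vt0 up0 pts [dvtc Jc J00]]]]]]] := section_param H y0gs tr.
set J := fun r => dup r - graph_field (vt r) (y0 (vt r)) * dvt r in Jc J00.
have pi0 : 0 < 2 * pi :> R by rewrite mulr_gt0 ?pi_gt0.
have yc : continuous y0 by move=> th; exact: isd_cont (y0gs th).2.
have y0om th : y0 (th + om) = y0 th.
  rewrite /om; case: sg_sign => ->; first by rewrite mul1r y0T.
  by rewrite mulN1r -[LHS]y0T subrK.
have gfom th v : graph_field (th + om) v = graph_field th v.
  have St x : Sf (x + om) = Sf x.
    rewrite /om; case: sg_sign => ->; first by rewrite mul1r (Sf_per H).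
    by rewrite mulN1r -[LHS](Sf_per H) subrK.
  have Dt x : Df (x + om) = Df x.
    rewrite /om; case: sg_sign => ->; first by rewrite mul1r (Df_per H).
    by rewrite mulN1r -[LHS](Df_per H) subrK.
  by rewrite /scalar_field St Dt.
have [K K0 flow] := near_flow H kap1 y0gs eta0 y0eta y0B.
have [K2 K20 flip] := field_lip H kap1 y0gs eta0 y0eta y0B.
have [M [mu [mu1 M0 dM MT]]] := multiplier H y0gs y0T sg_sign.
have [C C0 trans] := transition H kap1 y0gs eta0 y0eta y0B (ler0n _ 10) M0 dM.
pose G := expR (K * 10); have G0 : 0 < G by exact: expR_gt0.
pose j := `|J 0| / 4; have j0 : 0 < j by rewrite divr_gt0// normr_gt0.
have jE : 4 * j = `|J 0| by rewrite /j mulrC divfK.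
pose T := `|dvt 0| + 1; have T0 : 0 < T by rewrite /T; have := normr_ge0 (dvt 0); lra.
have K21 : 0 < K2 + 1 by lra.
(* For graphs within [eta2] of the cycle the slope changes by at most [j]; with another [j] from the
   variation of [J], it stays within half of [J 0]. *)
pose eta2 := Num.min eta (j / ((K2 + 1) * T)).
have eta20 : 0 < eta2 by rewrite lt_min eta0 divr_gt0// mulr_gt0.
have eta2K : K2 * eta2 * T <= j.
  have : eta2 <= j / ((K2 + 1) * T) by rewrite ge_min lexx orbT.
  rewrite ler_pdivlMr ?mulr_gt0// => h; apply: le_trans h.
  have -> : K2 * eta2 * T = eta2 * (K2 * T) by ring.
  by rewrite ler_wpM2l ?(ltW eta20)// ler_wpM2r ?(ltW T0)//; lra.
have eta2e : eta2 <= eta by rewrite ge_min lexx.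
have [e1 e10 he1] := (eps_delta _ _ _).1 Jc _ j0.
have [e2 e20 he2] := (eps_delta _ _ _).1 dvtc _ ltr01.
pose eps := Num.min d0 (Num.min e1 e2).
have eps0 : 0 < eps by rewrite !lt_min d00 e10.
have le1 r : `|r| < eps -> `|J r - J 0| <= j.
  by rewrite !lt_min => /and3P[_ h _]; have := he1 r; rewrite subr0 => /(_ h)/ltW.
have le2 r : `|r| < eps -> `|dvt r| <= T.
  rewrite !lt_min => /and3P[_ _ h]; have := he2 r; rewrite subr0 => /(_ h)/ltW hr.
  rewrite /T -[dvt r](subrK (dvt 0)); apply: le_trans (ler_normD _ _) _; lra.
have pts' r : `|r| < eps -> [/\ 0 < e * up r,
    E (vt r) (up r) = E th0 (y0 th0) + r *: m & `|vt r - th0| < 1].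
  by rewrite !lt_min => /andP[/pts[]].
have dv r : `|r| < eps -> is_derive r 1 vt (dvt r).
  by rewrite !lt_min => /andP[/pts[]].
have du r : `|r| < eps -> is_derive r 1 up (dup r).
  by rewrite !lt_min => /andP[/pts[]].
have slope (y : R -> R) : (forall r, `|r| < eps -> `|y (vt r) - y0 (vt r)| <= eta2) ->
    (forall r, `|r| < eps -> is_derive (vt r) 1 y (graph_field (vt r) (y (vt r)))) ->
    forall r1 r2, `|r1| < eps -> `|r2| < eps -> exists2 v, `|v - J 0| <= 2 * j &
    up r2 - y (vt r2) - (up r1 - y (vt r1)) = v * (r2 - r1).
  move=> yn yd.
  apply: (section_slope (y := y) (dy := fun r => graph_field (vt r) (y (vt r))) _ dv du yd).
    by rewrite mulr_ge0// ltW.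
  move=> r hr.
  have -> : dup r - graph_field (vt r) (y (vt r)) * dvt r - J 0 = (J r - J 0) +
    (graph_field (vt r) (y0 (vt r)) - graph_field (vt r) (y (vt r))) * dvt r.
    by rewrite [J r]/J; ring.
  apply: le_trans (ler_normD _ _) _; rewrite mulr_natl mulr2n lerD ?le1//.
  rewrite normrM; apply: le_trans eta2K; apply: ler_pM => //; last exact: le2.
  have hn := yn r hr.
  have hs : `|y0 (vt r) - y0 (vt r)| <= eta by rewrite subrr normr0 ltW.
  apply: le_trans (flip _ _ _ hs (le_trans hn eta2e)) _.
  by rewrite ler_wpM2l// distrC.
have bv v := @quarter_near j (J 0) v j0 jE.
have inj (y : R -> R) r x : (forall r, `|r| < eps -> `|y (vt r) - y0 (vt r)| <= eta2) ->
    (forall r, `|r| < eps -> is_derive (vt r) 1 y (graph_field (vt r) (y (vt r)))) ->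
    `|r| < eps -> `|x| < eps -> y (vt r) = up r -> y (vt x) = up x -> r = x.
  move=> yn yd hr hx er ex; have [v /bv[v1 _ _]] := slope y yn yd x r hx hr.
  rewrite er ex !subrr => /esym/eqP; rewrite mulf_eq0 subr_eq0 => /orP[/eqP v0|/eqP//].
  by move: v1; rewrite v0 normr0 leNgt mulr_gt0.
pose W0 r := up r - y0 (vt r).
have W00 : W0 0 = 0 by rewrite /W0 up0 vt0 subrr.
have y0_close th : `|y0 th - y0 th| <= eta2 by rewrite subrr normr0 ltW.
have slope0 := slope y0 (fun r _ => y0_close (vt r)) (fun r _ => (y0gs (vt r)).2).
have hW0 r : `|r| < eps -> 2 * j * `|r| <= `|W0 r| <= 6 * j * `|r|.
  move=> hr; have h0 : `|0 : R| < eps by rewrite normr0.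
  have [v /bv[v1 v2 _]] := slope0 0 r h0 hr.
  rewrite -/(W0 r) -/(W0 0) W00 !subr0 => ->; rewrite normrM.
  by rewrite !ler_wpM2r.
(* The gap at x is at most 6 j |x| and grows by at most [G] in one turn. The two quotients keep the
   result below [eta2], and below [j * eps], the size of the gap at the parameters eps/2 and
   -eps/2. *)
pose e3 := Num.min eps (Num.min (eta2 / (6 * j * G)) (eps / (6 * G))).
have jG : 0 < 6 * j * G by apply: mulr_gt0 => //; exact: mulr_gt0.
have e30 : 0 < e3 by rewrite lt_min eps0 lt_min !divr_gt0// mulr_gt0.
have e3eps r : `|r| < e3 -> `|r| < eps by rewrite !lt_min => /and3P[].
have e3W r : `|r| < e3 -> `|W0 r| * G <= 6 * j * G * `|r| /\ 6 * j * G * `|r| <= eta2 /\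
    6 * j * G * `|r| < j * eps.
  move=> hr; have /andP[_ h] := hW0 r (e3eps r hr).
  move: hr; rewrite !lt_min => /and3P[_ h1 h2]; split.
    have -> : 6 * j * G * `|r| = 6 * j * `|r| * G by ring.
    by rewrite ler_wpM2r// ltW.
  rewrite ltr_pdivlMr// in h1; rewrite ltr_pdivlMr ?mulr_gt0// in h2.
  split; first by rewrite mulrC ltW.
  have -> : 6 * j * G * `|r| = j * (`|r| * (6 * G)) by ring.
  by rewrite ltr_pM2l.
have half2 : `|eps / 2| < eps by exact: half_lt.
have half2' : `|- (eps / 2)| < eps by rewrite normrN.
pose P x x' (y : R -> R) := [/\ continuous y, y (vt x) = up x,
  forall th, `|th - th0| <= 9 -> `|y th - y0 th| <= `|W0 x| * G,
  forall th, `|y th - y0 th| <= eta -> is_derive th 1 y (graph_field th (y th))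
  & `|x'| < eps /\ y (vt x' + om) = up x'].
have fam x : exists x', `|x| < e3 -> exists y, P x x' y.
  have [hx|hx] := ltP `|x| e3; last by exists 0.
  have [y [yx ycont yd yn]] := flow (vt x) (up x).
  have [b1 [b2 b3]] := e3W x hx.
  have [_ _ vx] := pts' x (e3eps x hx).
  have yn' th : `|th - th0| <= 9 -> `|y th - y0 th| <= `|W0 x| * G.
    move=> hth; apply: le_trans (yn th) _; rewrite ler_wpM2l// ler_expR ler_wpM2l//.
    exact: norm_turn_sub hth vx.
  have vom r : `|r| < eps -> `|vt r + om - th0| <= 9.
    by move=> /pts'[_ _ hr]; have [_] := norm_turn hr hr.
  have Gd r : `|r| < eps -> `|up r - y (vt r + om) - W0 r| <= 6 * j * G * `|x|.
    move=> hr; have -> : up r - y (vt r + om) - W0 r = - (y (vt r + om) - y0 (vt r + om)).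
      by rewrite y0om /W0; ring.
    by rewrite normrN; apply: le_trans (yn' _ (vom r hr)) _.
  have cut : - (eps / 2) <= eps / 2 by rewrite ge0_cp// divr_ge0// ltW.
  have cont r : - (eps / 2) <= r <= eps / 2 ->
      up x - y (vt x + om) @[x --> r] --> up r - y (vt r + om).
    move=> hr2; have hr : `|r| < eps by exact: norm_le_half eps0 hr2.
    apply: cvgB; first exact: isd_cont (du r hr).
    apply: (cvg_comp_cont (h := y) (l := vt r + om)); last exact: ycont.
    by apply: cvgD; [exact: isd_cont (dv r hr)|exact: cvg_cst].
  (* The perturbation is too small to alter the signs of the gap at the two test parameters, so the
     graph crosses the segment again after one turn. *)
  have sgn : (up (- (eps / 2)) - y (vt (- (eps / 2)) + om)) *
      (up (eps / 2) - y (vt (eps / 2) + om)) <= 0.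
    have h0 : `|0 : R| < eps by rewrite normr0.
    have hp := Gd _ half2; have hm := Gd _ half2'.
    have [vp /bv[p1 _ p2]] := slope0 0 _ h0 half2.
    have [vm /bv[m1 _ m2]] := slope0 0 _ h0 half2'.
    rewrite -!/(W0 _) W00 !subr0 => Wm Wp; rewrite Wp in hp; rewrite Wm in hm.
    exact: opposite_signs eps0 p2 m2 p1 m1 b3 hp hm.
  have [x' hx2 hx'] := ivt cut cont sgn.
  exists x' => _; exists y; split => //; split.
    exact: norm_le_half eps0 hx2.
  by apply/eqP; rewrite eq_sym -subr_eq0 hx'.
have [Pi hPi] := choice fam.
have near9 r : `|vt r - th0| < 1 -> `|vt r - th0| <= 9 by move=> h; have [] := norm_turn h h.
have fam1 x y : `|x| < e3 -> P x (Pi x) y ->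
    [/\ forall th, `|th - th0| <= 9 -> `|y th - y0 th| <= 6 * j * G * `|x|,
      forall th, `|th - th0| <= 9 -> `|y th - y0 th| <= eta2
    & forall th, `|th - th0| <= 9 -> is_derive th 1 y (graph_field th (y th))].
  move=> hx [_ _ yn yd _]; have [b1 [b2 _]] := e3W x hx.
  have yn1 th : `|th - th0| <= 9 -> `|y th - y0 th| <= 6 * j * G * `|x|.
    by move=> /yn /le_trans; apply.
  have yn2 th : `|th - th0| <= 9 -> `|y th - y0 th| <= eta2.
    by move=> /yn1 /le_trans; apply.
  by split => // th /yn2 h; apply: yd; exact: le_trans h eta2e.
have vom r : `|r| < eps -> `|vt r + om - th0| <= 9.
  by move=> /pts'[_ _ hr]; have [_] := norm_turn hr hr.
have ret x : `|x| < e3 -> first_return X (E th0 (y0 th0)) m eps x (Pi x).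
  move=> hx; have [y Py] := hPi x hx; have [_ yn2 yd2] := fam1 x y hx Py.
  have [ycont yx _ yd [x'e yx']] := Py; have xe := e3eps x hx.
  apply: (graph_first_return (y := y) pts' ycont) => //.
  - by move=> th /yn2 /le_trans; apply.
  - move=> r hr yr; apply: (inj y) => // r' /pts'[_ _ /near9]; [exact: yn2|exact: yd2].
  (* By periodicity the graph shifted by a full turn solves the same equation, so it too meets the
     segment only once. *)
  - move=> r hr yr; apply: (inj (fun th => y (th + om))) => // r' hr'.
      by rewrite -y0om; apply: yn2; exact: vom.
    have dsh : is_derive (vt r') 1 (fun th => th + om) 1 by der; ring.
    apply: isd_eq (isd_comp (f := y) (g := fun th => th + om) (yd2 _ (vom r' hr')) dsh) _.
    by rewrite mulr1 gfom.
have Wret x y : `|x| < e3 -> P x (Pi x) y ->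
    W0 (Pi x) = y (vt (Pi x) + om) - y0 (vt (Pi x) + om).
  by move=> hx [_ _ _ _ [_ ->]]; rewrite y0om.
have PiB x : `|x| < e3 -> `|Pi x| <= 3 * G * `|x|.
  move=> hx; have [y Py] := hPi x hx; have [yn1 _ _] := fam1 x y hx Py.
  have [_ _ _ _ [x'e _]] := Py; have /andP[h1 _] := hW0 _ x'e.
  have h2 := yn1 _ (vom _ x'e); rewrite -(Wret x y hx Py) in h2.
  have := le_trans h1 h2; have -> : 6 * j * G * `|x| = 2 * j * (3 * G * `|x|) by ring.
  by rewrite ler_pM2l// mulr_gt0.
have Pi0 : Pi 0 = 0.
  have := PiB 0; rewrite normr0 mulr0 => /(_ e30); rewrite normr_le0 => /eqP//.
have mu0 : mu != 0.
  by have := M0 (th0 + om); rewrite MT mulf_eq0 negb_or => /andP[].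
pose W r := W0 r / M (vt r).
(* The deviation over the turn is at most 6 j G |x|, and this is the [del] fed into [trans]; one
   turn multiplies [M] by [mu]. *)
have trW x : `|x| < e3 ->
    `|W (Pi x) - mu * W x| <= `|mu| * C * (6 * j * G) * `|x| * `|W x|.
  move=> hx; have [y Py] := hPi x hx; have [yn1 yn2 yd2] := fam1 x y hx Py.
  have [_ yx _ _ [x'e _]] := Py; have [_ [b2 _]] := e3W x hx.
  have [_ _ vx] := pts' x (e3eps x hx); have [_ _ vx'] := pts' _ x'e.
  have hint th : Num.min (vt x) (vt (Pi x) + om) <= th <= Num.max (vt x) (vt (Pi x) + om) ->
    `|th - th0| <= 9 by apply: min_max_near; [exact: near9|exact: vom].
  have del1 : 0 <= 6 * j * G * `|x| <= eta.
    by rewrite (le_trans b2 eta2e) andbT mulr_ge0// ltW.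
  have hl : `|vt (Pi x) + om - vt x| <= 10%:R by have [] := norm_turn vx vx'.
  have := trans y (vt x) (vt (Pi x) + om) _ del1 hl (fun th h => yn1 th (hint th h))
    (fun th h => yd2 th (hint th h)).
  rewrite -(Wret x y hx Py) yx MT -/(W0 x) -/(W x) => h.
  have -> : W (Pi x) - mu * W x = mu * (W0 (Pi x) / (mu * M (vt (Pi x))) - W x).
    by rewrite /W; field; rewrite mu0 !M0.
  rewrite normrM; have -> : `|mu| * C * (6 * j * G) * `|x| * `|W x| =
    `|mu| * (C * (6 * j * G * `|x|) * `|W x|) by ring.
  by rewrite ler_wpM2l.
have h0 : `|0 : R| < eps by rewrite normr0.
have dW : is_derive (0 : R) 1 W (J 0 / M (vt 0)).
  have d1 := isd_add (du 0 h0) (isd_opp (isd_comp (y0gs (vt 0)).2 (dv 0 h0))).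
  have d2 := isd_inv (f := fun r => M (vt r)) (M0 _) (isd_comp (dM (vt 0)) (dv 0 h0)).
  apply: isd_eq (isd_mul d1 d2) _; rewrite -/(W0 0) W00 mul0r addr0 //.
have c0 : J 0 / M (vt 0) != 0 by rewrite mulf_neq0 ?invr_neq0.
have WW0 : W 0 = 0 by rewrite /W W00 mul0r.
have dPi := conjugate_derivative c0 dW WW0 Pi0 e30 PiB trW.
exists eps, Pi; split.
  split => //; apply/nbhs_ballP; exists e3 => // x.
  by rewrite /ball /= sub0r normrN; exact: ret.
have dF : is_derive (0 : R) 1 (fun r => Pi r - r) (mu - 1).
  exact: isd_add dPi (isd_opp (isd_id 0)).
split => //.
- by case=> [|i]//; move=> _; split; [exact: (@ex_derive _ _ _ _ _ _ _ dF)|rewrite /= Pi0 subr0].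
- rewrite derive1n1 derive1E (@derive_val _ _ _ _ _ _ _ dF) subr_eq0 //.
Qed.

End ReturnMap.

(** * Homogeneous polynomial systems *)

Section Polynomials.
Variable R : realType.
Implicit Types (f g : R -> R -> R) (P Q : mpoly2 R) (x y t th a b c r K M : R).

(** The bound on [f] itself is included so that products can be treated. *)
Definition locally_lipschitz2 f : Prop := forall M, exists2 K, 0 <= K &
  forall x y x' y', `|x| <= M -> `|y| <= M -> `|x'| <= M -> `|y'| <= M ->
  `|f x y| <= K /\ `|f x y - f x' y'| <= K * (`|x - x'| + `|y - y'|).

(** What is needed of a polynomial, in a form that passes to sums and products: local Lipschitz
    bounds, continuity along curves, and a continuous derivative along continuously differentiable
    curves. *)
Definition smooth2 f : Prop :=
  [/\ locally_lipschitz2 f,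
      forall u v : R -> R, continuous u -> continuous v -> continuous (fun t => f (u t) (v t))
    & forall u v du dv : R -> R, continuous du -> continuous dv ->
      (forall t, is_derive t 1 u (du t)) -> (forall t, is_derive t 1 v (dv t)) ->
      exists2 df : R -> R, continuous df &
        forall t, is_derive t 1 (fun t => f (u t) (v t)) (df t)].

Lemma smooth2_cst c : smooth2 (fun _ _ => c).
Proof.
split.
- move=> M; exists `|c| => // x y x' y' _ _ _ _; split => //.
  by rewrite subrr normr0 mulr_ge0// addr_ge0.
- by move=> u v _ _ t; exact: cvg_cst.
- by move=> u v du dv _ _ _ _; exists (fun=> 0) => t; [exact: cvg_cst|exact: isd_cst].
Qed.

Lemma smooth2_fst : smooth2 (fun x _ => x).
Proof.
split=> [M|//|u v du dv ? _ hu _]; last by exists du.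
exists (`|M| + 1); first by have := normr_ge0 M; lra.
move=> x y x' y' h _ _ _; split.
  by apply: le_trans h _; have := ler_norm M; lra.
apply: (@le_trans _ _ (`|x - x'| + `|y - y'|)); first by rewrite lerDl.
by rewrite ler_peMl ?addr_ge0//; have := normr_ge0 M; lra.
Qed.

Lemma smooth2_snd : smooth2 (fun _ y => y).
Proof.
split=> [M|//|u v du dv _ ? _ hv]; last by exists dv.
exists (`|M| + 1); first by have := normr_ge0 M; lra.
move=> x y x' y' _ h _ _; split.
  by apply: le_trans h _; have := ler_norm M; lra.
apply: (@le_trans _ _ (`|x - x'| + `|y - y'|)); first by rewrite lerDr.
by rewrite ler_peMl ?addr_ge0//; have := normr_ge0 M; lra.
Qed.

Lemma smooth2_add f g : smooth2 f -> smooth2 g -> smooth2 (fun x y => f x y + g x y).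
Proof.
move=> [lf cf df] [lg cg dg]; split.
- move=> M; have [K1 K10 h1] := lf M; have [K2 K20 h2] := lg M.
  exists (K1 + K2); first exact: addr_ge0.
  move=> x y x' y' a1 a2 a3 a4; have [b1 c1] := h1 x y x' y' a1 a2 a3 a4.
  have [b2 c2] := h2 x y x' y' a1 a2 a3 a4; split.
    by apply: le_trans (ler_normD _ _) _; exact: lerD.
  have -> : f x y + g x y - (f x' y' + g x' y') = (f x y - f x' y') + (g x y - g x' y') by ring.
  by apply: le_trans (ler_normD _ _) _; rewrite mulrDl; exact: lerD.
- by move=> u v hu hv t; apply: cvgD; [exact: cf hu hv t|exact: cg hu hv t].
- move=> u v du dv cu cv hu hv; have [d1 cd1 h1] := df u v du dv cu cv hu hv.
  have [d2 cd2 h2] := dg u v du dv cu cv hu hv; exists (fun t => d1 t + d2 t) => t.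
    by apply: cvgD; [exact: cd1|exact: cd2].
  exact: isd_add (h1 t) (h2 t).
Qed.

Lemma smooth2_mul f g : smooth2 f -> smooth2 g -> smooth2 (fun x y => f x y * g x y).
Proof.
move=> [lf cf df] [lg cg dg]; split.
- move=> M; have [K1 K10 h1] := lf M; have [K2 K20 h2] := lg M.
  exists (2 * K1 * K2); first by rewrite !mulr_ge0.
  move=> x y x' y' a1 a2 a3 a4; have [b1 c1] := h1 x y x' y' a1 a2 a3 a4.
  have [b2 c2] := h2 x y x' y' a1 a2 a3 a4; have [b3 _] := h2 x' y' x y a3 a4 a1 a2; split.
    rewrite normrM -mulrA; apply: (@le_trans _ _ (K1 * K2)); first exact: ler_pM.
    by rewrite ler_peMl ?mulr_ge0// ler1n.
  have -> : f x y * g x y - f x' y' * g x' y' =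
    f x y * (g x y - g x' y') + (f x y - f x' y') * g x' y' by ring.
  have -> : 2 * K1 * K2 * (`|x - x'| + `|y - y'|) =
    K1 * (K2 * (`|x - x'| + `|y - y'|)) + K1 * (`|x - x'| + `|y - y'|) * K2 by ring.
  by apply: le_trans (ler_normD _ _) _; rewrite !normrM; apply: lerD; exact: ler_pM.
- by move=> u v hu hv t; apply: cvgM; [exact: cf hu hv t|exact: cg hu hv t].
- move=> u v du dv cu cv hu hv; have [d1 cd1 h1] := df u v du dv cu cv hu hv.
  have [d2 cd2 h2] := dg u v du dv cu cv hu hv.
  have ucont : continuous u by move=> t; exact: isd_cont (hu t).
  have vcont : continuous v by move=> t; exact: isd_cont (hv t).
  exists (fun t => d1 t * g (u t) (v t) + f (u t) (v t) * d2 t) => t; last first.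
    exact: isd_mul (h1 t) (h2 t).
  apply: cvgD; apply: cvgM; [exact: cd1|exact: cg ucont vcont t|exact: cf ucont vcont t|exact: cd2].
Qed.

Lemma smooth2_exp f (k : nat) : smooth2 f -> smooth2 (fun x y => f x y ^+ k).
Proof.
move=> hf; elim: k => [|k IH]; first exact: smooth2_cst.
rewrite (_ : (fun x y => f x y ^+ k.+1) = (fun x y => f x y * f x y ^+ k)).
  exact: smooth2_mul hf IH.
by apply/funext => x; apply/funext => y; rewrite exprS.
Qed.

Lemma eval2E P x y : eval2 P x y =
  \sum_(k <- msupp P) mcoeff k P * (x ^+ k ord0 * y ^+ k (lift ord0 ord0)).
Proof.
by rewrite /eval2 mevalE; apply: eq_bigr => k _; rewrite !big_ord_recl big_ord0 /= mulr1.
Qed.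

Lemma eval2_smooth P : smooth2 (eval2 P).
Proof.
have -> : eval2 P = fun x y => \sum_(k <- msupp P)
    mcoeff k P * (x ^+ k ord0 * y ^+ k (lift ord0 ord0)).
  by apply/funext => x; apply/funext => y; exact: eval2E.
elim: (msupp P : seq _) => [|k s IH].
  rewrite (_ : (fun x y => _) = fun _ _ => 0); first exact: smooth2_cst.
  by apply/funext => x; apply/funext => y; rewrite big_nil.
rewrite (_ : (fun x y => _) = fun x y => mcoeff k P * (x ^+ k ord0 * y ^+ k (lift ord0 ord0)) +
  \sum_(k <- s) mcoeff k P * (x ^+ k ord0 * y ^+ k (lift ord0 ord0))); last first.
  by apply/funext => x; apply/funext => y; rewrite big_cons.
apply: smooth2_add IH; apply: smooth2_mul; first exact: smooth2_cst.
by apply: smooth2_mul; apply: smooth2_exp; [exact: smooth2_fst|exact: smooth2_snd].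
Qed.

Lemma eval2_homog P (m : nat) r x y : homogeneous m P ->
  eval2 P (r * x) (r * y) = r ^+ m * eval2 P x y.
Proof.
move=> /dhomogP hP; rewrite !eval2E mulr_sumr; apply: eq_big_seq => k /hP.
by rewrite /= mdegE !big_ord_recl big_ord0 addn0 => <-; rewrite !exprMn exprD; ring.
Qed.

Lemma cos_sin_cont : continuous (@cos R) /\ continuous (@sin R).
Proof. by split; [exact: continuous_cos|exact: continuous_sin]. Qed.

Lemma eval2_circle P (w := fun th : R => eval2 P (cos th) (sin th)) :
  [/\ continuous w, forall th, w (th + 2 * pi) = w th
    & exists2 dw : R -> R, continuous dw & forall th, is_derive th 1 w (dw th)].
Proof.
have [_ hc hd] := eval2_smooth P; have [c1 c2] := cos_sin_cont; split.
- exact: hc c1 c2.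
- by move=> th; rewrite /w mulr_natl cosD2pi sinD2pi.
- have cm : continuous (fun th : R => - sin th) by move=> th; apply: cvgN; exact: c2.
  have [dw cw hw] := hd _ _ _ _ cm c1 (@is_derive_cos R) (@is_derive_sin R).
  by exists dw.
Qed.

Lemma per_derive (f df : R -> R) c : (forall t, is_derive t 1 f (df t)) ->
  (forall t, f (t + c) = f t) -> forall t, df (t + c) = df t.
Proof.
move=> hf fT t; have h : is_derive t 1 (fun t => t + c) 1 by der; ring.
have h1 := isd_comp (f := f) (g := fun t => t + c) (hf (t + c)) h.
have fE : (fun t => f (t + c)) = f by apply/funext.
rewrite fE mulr1 in h1.
by rewrite -(@derive_val _ _ _ _ _ _ _ h1) -(@derive_val _ _ _ _ _ _ _ (hf t)).
Qed.

Lemma psi_derive P Q : [/\ continuous (derive1 (psi P Q)),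
  forall th, is_derive th 1 (psi P Q) (derive1 (psi P Q) th)
  & forall th, psi P Q (th + 2 * pi) = psi P Q th].
Proof.
have [cP pP [dP cdP hP]] := eval2_circle P; have [cQ pQ [dQ cdQ hQ]] := eval2_circle Q.
have [c1 c2] := cos_sin_cont.
pose d th := - sin th * eval2 Q (cos th) (sin th) + cos th * dQ th +
  - (cos th * eval2 P (cos th) (sin th) + sin th * dP th).
have hd th : is_derive th 1 (psi P Q) (d th).
  exact: isd_add (isd_mul (is_derive_cos th) (hQ th))
    (isd_opp (isd_mul (is_derive_sin th) (hP th))).
have -> : derive1 (psi P Q) = d.
  by apply/funext => th; rewrite derive1E (@derive_val _ _ _ _ _ _ _ (hd th)).
split=> // [th|th].
  apply: cvgD; last apply: cvgN; apply: cvgD; apply: cvgM.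
  - by apply: cvgN; exact: c2.
  - exact: cQ.
  - exact: c1.
  - exact: cdQ.
  - exact: c1.
  - exact: cP.
  - exact: c2.
  - exact: cdP.
by rewrite /psi pP pQ mulr_natl cosD2pi sinD2pi.
Qed.

(** A zero recurs after 2 pi, so Rolle's theorem on that interval produces a zero of the expression
    in the hypothesis. *)
Lemma psi_nonzero a (m : nat) P Q : psi_condition a m P Q -> forall th, psi P Q th != 0.
Proof.
move=> hpsi th; have [_ hd hT] := psi_derive P Q; apply/eqP => p0.
pose k := (m%:R - 1) * a.
have dF t : is_derive t 1 (fun t => expR (k * t) * psi P Q t)
    (expR (k * t) * (k * psi P Q t + derive1 (psi P Q) t)).
  by have := hd t => ?; der; ring.
have pi2 : th < th + 2 * pi by rewrite ltrDl mulr_gt0 ?pi_gt0.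
have [w _] := mean_value pi2 (fun t _ => dF t).
rewrite hT p0 !mulr0 subrr => /esym/eqP; rewrite !mulf_eq0 (gt_eqF (expR_gt0 _)) /=.
rewrite addrAC subrr add0r mulf_eq0 [pi == 0]gt_eqF ?pi_gt0// orbF pnatr_eq0 /= orbF.
exact/negP/hpsi.
Qed.

Lemma hom_system_polar a (m : nat) P Q : (2 <= m)%N ->
  homogeneous m P -> homogeneous m Q -> psi_condition a m P Q ->
  exists e s : R, polar_system m.-1 a e s
    (fun th => cos th * eval2 P (cos th) (sin th) + sin th * eval2 Q (cos th) (sin th))
    (psi P Q) (derive1 (psi P Q)) (hom_system a P Q).
Proof.
move=> m2 hP hQ hpsi; have [cd hd hT] := psi_derive P Q.
have [cP pP _] := eval2_circle P; have [cQ pQ _] := eval2_circle Q.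
have [c1 c2] := cos_sin_cont; have psi0 := psi_nonzero hpsi.
have m1 : (0 < m.-1)%N by rewrite -subn1 subn_gt0.
have mE : m = m.-1.+1 by rewrite prednK// ltnW.
have nE : m.-1%:R = m%:R - 1 :> R by rewrite {2}mE -natr1 addrK.
have psic : continuous (psi P Q) by move=> th; exact: isd_cont (hd th).
have [e e1 he] := const_sign psic psi0.
pose S th : R := m.-1%:R * a + derive1 (psi P Q) th / psi P Q th.
have Sc : continuous S.
  move=> th; apply: cvgD; first exact: cvg_cst.
  by apply: cvgM; [exact: cd|apply: cvgV; [exact: psi0|exact: psic]].
have S0 th : S th != 0.
  apply: contraNneq (hpsi th) => h; rewrite -nE.
  have -> : m.-1%:R * a * psi P Q th + derive1 (psi P Q) th = S th * psi P Q th.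
    by rewrite /S; field; exact: psi0.
  by rewrite h mul0r.
have [s s1 hs] := const_sign Sc S0.
exists e, s; split => //.
- by move=> th; apply: cvgD; apply: cvgM; [exact: c1|exact: cP|exact: c2|exact: cQ].
- by move=> th; rewrite pP pQ mulr_natl cosD2pi sinD2pi.
- exact: per_derive hd hT.
- have z A : homogeneous m A -> eval2 A 0 0 = 0 :> R.
    move=> hA; have := eval2_homog 0 0 0 hA; rewrite !mul0r => ->.
    by rewrite mE expr0n /= mul0r.
  by rewrite /hom_system /= !mulr0 (z P)// (z Q)// !addr0 subrr.
- move=> r th r0; rewrite /hom_system /= (eval2_homog _ _ _ hP) (eval2_homog _ _ _ hQ).
  have -> : r ^+ m = r * r ^+ m.-1 by rewrite -exprS -mE.
  have cs := cos2Dsin2 th; rewrite /psi; set u := eval2 P _ _; set v := eval2 Q _ _.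
  congr pair.
    transitivity (a * (r * cos th) - r * sin th +
      r * r ^+ m.-1 * (u * (cos th ^+ 2 + sin th ^+ 2))); first by rewrite cs mulr1.
    ring.
  transitivity (r * cos th + a * (r * sin th) +
    r * r ^+ m.-1 * (v * (cos th ^+ 2 + sin th ^+ 2))); first by rewrite cs mulr1.
  ring.
- have [lP _ _] := eval2_smooth P; have [lQ _ _] := eval2_smooth Q.
  move=> M; have [K1 K10 h1] := lP M; have [K2 K20 h2] := lQ M.
  exists (`|a| + 1 + K1 + K2) => p q a1 a2 a3 a4.
  have [_ b1] := h1 _ _ _ _ a1 a2 a3 a4; have [_ b2] := h2 _ _ _ _ a1 a2 a3 a4.
  rewrite /hom_system /=; set dx := `|p.1 - q.1| in b1 b2 *; set dy := `|p.2 - q.2| in b1 b2 *.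
  have dx0 : 0 <= dx by exact: normr_ge0.
  have dy0 : 0 <= dy by exact: normr_ge0.
  have a0 := normr_ge0 a.
  split.
    have -> : a * p.1 - p.2 + eval2 P p.1 p.2 - (a * q.1 - q.2 + eval2 P q.1 q.2) =
      a * (p.1 - q.1) - (p.2 - q.2) + (eval2 P p.1 p.2 - eval2 P q.1 q.2) by ring.
    apply: le_trans (ler_normD _ _) _.
    have := ler_normB (a * (p.1 - q.1)) (p.2 - q.2); rewrite normrM -/dx -/dy => h3.
    have : 0 <= `|a| * dy + dx + K2 * (dx + dy) by rewrite !addr_ge0 ?mulr_ge0 ?addr_ge0.
    lra.
  have -> : p.1 + a * p.2 + eval2 Q p.1 p.2 - (q.1 + a * q.2 + eval2 Q q.1 q.2) =
    (p.1 - q.1) + a * (p.2 - q.2) + (eval2 Q p.1 p.2 - eval2 Q q.1 q.2) by ring.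
  apply: le_trans (ler_normD _ _) _.
  have := ler_normD (p.1 - q.1) (a * (p.2 - q.2)); rewrite normrM -/dx -/dy => h3.
  have : 0 <= `|a| * dx + dy + K1 * (dx + dy) by rewrite !addr_ge0 ?mulr_ge0 ?addr_ge0.
  lra.
- have [_ hcP _] := eval2_smooth P; have [_ hcQ _] := eval2_smooth Q.
  move=> x y dx dy hx hy.
  have cx : continuous x by move=> t; exact: isd_cont (hx t).
  have cy : continuous y by move=> t; exact: isd_cont (hy t).
  split=> t; rewrite /hom_system /=; apply: cvgD.
  + by apply: cvgB; [apply: cvgM; [exact: cvg_cst|exact: cx]|exact: cy].
  + exact: hcP cx cy t.
  + by apply: cvgD; [exact: cx|apply: cvgM; [exact: cvg_cst|exact: cy]].
  + exact: hcQ cx cy t.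
Qed.

End Polynomials.

(** * Limit cycles of a polar system *)

Section Cycles.
Variables (R : realType) (n : nat) (a e s : R) (phi psi dpsi : R -> R).
Variable X : R * R -> R * R.
Hypothesis H : polar_system n a e s phi psi dpsi X.
Implicit Types (g : set (R * R)).

Lemma cycle_properties g : periodic_orbit X g ->
  [/\ cycle_multiplicity X g 1, surrounds g 0, s = 1 -> stable_cycle X g
    & s = -1 -> unstable_cycle X g].
Proof.
move=> /(cycle_graph H)[kap [y [kap1 ys yT ->]]].
have yc : continuous y by move=> th; exact: isd_cont (ys th).2.
have [eta [B [eta0 yeta yB]]] := near_constants ys yT.
split.
- by move=> p m hp tr; exact: (graph_multiplicity H kap1 ys yT eta0 yeta yB hp tr).
- by apply: (graph_surrounds H) => // th; exact: (ys th).1.1.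
- move=> s1; have := graph_stable H kap1 ys yT (or_introl erefl).
  rewrite s1 mulr1 => /(_ ltr01); congr stable_cycle.
  by apply/funext => q; rewrite !mul1r -surjective_pairing.
- move=> s1; have := graph_stable H kap1 ys yT (or_intror erefl).
  rewrite s1 mulrNN mulr1 => /(_ ltr01); congr stable_cycle.
  by apply/funext => q; rewrite !mulN1r.
Qed.

Lemma limit_cycle_unique g g' : limit_cycle X g -> limit_cycle X g' -> g = g'.
Proof. by move=> [h _] [h' _]; exact: periodic_orbit_unique H _ _ h h'. Qed.

(** There is only one periodic orbit, so the whole plane serves as isolating neighbourhood. *)
Lemma periodic_orbit_limit_cycle g : periodic_orbit X g -> limit_cycle X g.
Proof.
move=> hg; split => //; exists setT; split; [exact: openT|by []|].
by move=> g' hg' _; exact: periodic_orbit_unique H _ _ hg' hg.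
Qed.

Lemma at_most_one_limit_cycle : at_most_limit_cycles X 1.
Proof.
exists (fun=> 1%N); split; first by move=> g [/cycle_properties[]].
case=> [|g [|g' l]] us hl; rewrite ?big_nil ?big_seq1//.
have : g = g' by apply: limit_cycle_unique; apply: hl; rewrite !inE eqxx ?orbT.
by move: us => /= /andP[]; rewrite inE negb_or => /andP[/eqP].
Qed.

End Cycles.

(** * Sharpness: a cubic system with exactly one limit cycle *)

Section Example.
Variable R : realType.
Implicit Types (x y t th : R).

Let Xx : mpoly2 R := mpolyX R (mnm1 ord0).
Let Xy : mpoly2 R := mpolyX R (mnm1 (lift ord0 ord0)).

(** With a = 1 and m = 3 these give phi = -1 and psi = 1, that is r' = r (1 - r^2) and th' = 1 +
    r^2. The unit circle is then a cycle traversed at angular speed 2, hence with period pi. *)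
Definition exampleP : mpoly2 R := - ((Xx + Xy) * (Xx ^+ 2 + Xy ^+ 2)).
Definition exampleQ : mpoly2 R := (Xx - Xy) * (Xx ^+ 2 + Xy ^+ 2).

Lemma eval2_exampleP x y : eval2 exampleP x y = - ((x + y) * (x ^+ 2 + y ^+ 2)).
Proof. by rewrite /eval2 /exampleP !(mevalN, mevalD, mevalM, rmorphXn, mevalXU) /=. Qed.

Lemma eval2_exampleQ x y : eval2 exampleQ x y = (x - y) * (x ^+ 2 + y ^+ 2).
Proof. by rewrite /eval2 /exampleQ !(mevalN, mevalD, mevalM, rmorphXn, mevalXU) /=. Qed.

Lemma example_homogeneous : homogeneous 3 exampleP /\ homogeneous 3 exampleQ.
Proof.
have hX i : (mpolyX R (mnm1 i) : mpoly2 R) \is ishomog1 1 mdeg by rewrite dhomogX /= mdeg1.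
have hq : Xx ^+ 2 + Xy ^+ 2 \is ishomog1 2 mdeg.
  by apply: dhomogD; [exact: (dhomogMn 2 (hX _))|exact: (dhomogMn 2 (hX _))].
split; rewrite /homogeneous.
  by rewrite dhomogN; apply: (@dhomogM _ _ _ 1 _ 2) => //; apply: dhomogD; exact: hX.
apply: (@dhomogM _ _ _ 1 _ 2) => //; apply: dhomogD; first exact: hX.
by rewrite dhomogN; exact: hX.
Qed.

Lemma psi_example : psi exampleP exampleQ = fun=> 1.
Proof.
apply/funext => th; rewrite /psi eval2_exampleP eval2_exampleQ cos2Dsin2 !mulr1 -(cos2Dsin2 th).
by ring.
Qed.

Lemma example_psi_condition : psi_condition 1 3 exampleP exampleQ.
Proof.
move=> th; rewrite psi_example derive1E derive_val addr0 !mulr1.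
by rewrite gt_eqF//; lra.
Qed.

Lemma example_periodic_orbit : periodic_orbit (hom_system 1 exampleP exampleQ)
  (range (fun t => (cos (2 * t), sin (2 * t)))).
Proof.
exists (fun t => (cos (2 * t), sin (2 * t))), pi; split => //.
- move=> t _; rewrite /hom_system /= eval2_exampleP eval2_exampleQ cos2Dsin2.
  by split; der; ring.
- split; first exact: pi_gt0.
  by move=> t; rewrite mulrDr mulr_natl [2 * pi]mulr_natl cosD2pi sinD2pi.
- exists (pi / 2); rewrite mulrC divfK ?pnatr_eq0// mulr0 cospi cos0.
  by rewrite xpair_eqE negb_and lt_eqF//; lra.
Qed.

End Example.

Theorem corollary1p2 (R : realType) :
  (forall (a : R) (m : nat) (P Q : mpoly2 R),
     (2 <= m)%N -> homogeneous m P -> homogeneous m Q ->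
     psi_condition a m P Q ->
     at_most_limit_cycles (hom_system a P Q) 1 /\
     (forall g : set (R * R), limit_cycle (hom_system a P Q) g ->
        [/\ surrounds g 0,
            (forall th : R, 0 < stability_index a m P Q th) ->
              stable_cycle (hom_system a P Q) g
          & (forall th : R, stability_index a m P Q th < 0) ->
              unstable_cycle (hom_system a P Q) g])) /\
  (exists (a : R) (m : nat) (P Q : mpoly2 R),
     [/\ (2 <= m)%N, homogeneous m P, homogeneous m Q,
         psi_condition a m P Q
       & exists! g : set (R * R), limit_cycle (hom_system a P Q) g]).
Proof.
split=> [a m P Q m2 hP hQ hpsi|].
  have [e [s H]] := hom_system_polar m2 hP hQ hpsi.
  have sE th : 0 < s * stability_index a m P Q th.
    by have := ps_S H th; rewrite -subn1 natrB// ltnW.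
  split=> [|g [hg _]]; first exact: at_most_one_limit_cycle H.
  have [_ sur st un] := cycle_properties H hg; split=> // hs.
    apply: st; case: (ps_s H) => // s1; have := sE 0; rewrite s1 mulN1r oppr_gt0 => h.
    by have := lt_trans h (hs 0); rewrite ltxx.
  apply: un; case: (ps_s H) => // s1; have := sE 0; rewrite s1 mul1r => h.
  by have := lt_trans h (hs 0); rewrite ltxx.
have [hP hQ] := example_homogeneous R.
exists 1, 3, (exampleP R), (exampleQ R); split => //; first exact: example_psi_condition.
have [e [s H]] := hom_system_polar (isT : (2 <= 3)%N) hP hQ (@example_psi_condition R).
have hc := periodic_orbit_limit_cycle H (example_periodic_orbit R).
by eexists; split; [exact: hc|move=> g hg; exact: limit_cycle_unique H _ _ hc hg].
Qed.
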